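(* Let $m>1$, $0<\kappa\le1$, $0<\alpha\le 1$, let $\mu$ be an $\alpha$-dimensional measure on $\mathbb R$ and let $\gamma\in\Gamma(\kappa)$. If $s>\max\left\{\frac14,\frac{1-\alpha}{2},\frac{1-m\alpha\kappa}{2}\right\}$, then there exists a constant $C$ such that $$\left(\int_{-1}^1\sup_{t\in[-1,1]}|S_tf(\gamma(x,t))|^2\,d\mu(x)\right)^{\frac12}\le C\|f\|_{H^s}$$ for all $f\in H^s(\mathbb R)$.
   Context: For $0<\alpha\le1$, a positive Borel measure $\mu$ on $\mathbb R$ is called $\alpha$-dimensional if there is a constant $c$ such that $\mu(\mathbb B(x,r))\le c\,r^\alpha$ for all $x\in\mathbb R$ and $r>0$, where $\mathbb B(x,r)$ is the ball (interval) centered at $x$ with radius $r$. For $0<\kappa\le1$, $\Gamma(\kappa)$ is the collection of continuous functions $\gamma:\mathbb R\times[-1,1]\to\mathbb R$ with $\gamma(x,0)=x$ for which there are constants $C_1,C_2>0$ such that $|\gamma(x,t)-\gamma(x,t')|\le C_1|t-t'|^\kappa$ for all $x\in\mathbb R$, $t,t'\in[-1,1]$, and $\frac1{C_2}|x-x'|\le|\gamma(x,t)-\gamma(x',t)|\le C_2|x-x'|$ for all $t\in[-1,1]$, $x,x'\in\mathbb R$. $H^s(\mathbb R)$ is the Sobolev space of order $s$ with norm $\|f\|_{H^s}=\|(1-\Delta)^{s/2}f\|_{L^2(\mathbb R)}$, and $\widehat f(\xi)=\int_{\mathbb R}e^{-ix\xi}f(x)\,dx$. The evolution operator $S_t$ (giving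 the formal solution of the fractional Schrödinger equation $i\partial_tu+(-\Delta)^{m/2}u=0$ with $u(\cdot,0)=f$) is defined on appropriate input functions by $$S_tf(x)=\frac1{2\pi}\int_{\mathbb R}e^{i(x\xi+t|\xi|^m)}\widehat f(\xi)\,d\xi .$$ *)

(* Defs.v *)
From HB Require Import structures.
From mathcomp Require Import all_boot all_order all_algebra.
From mathcomp Require Import complex.
From mathcomp Require Import all_classical all_reals all_analysis.

Set Implicit Arguments.
Unset Strict Implicit.
Unset Printing Implicit Defensive.

Import Order.TTheory GRing.Theory Num.Theory.
Import numFieldNormedType.Exports.

Local Open Scope classical_set_scope.
Local Open Scope ring_scope.
Local Open Scope complex_scope.

(* The real-valued modulus; the library's [`|z|] lives in [R[i]]. *)
Definition cabs (R : realType) (z : R[i]) : R := ComplexField.Normc.normc z.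

Definition cis (R : realType) (a : R) : R[i] := cos a +i* sin a.

Definition cintegral (R : realType) (D : set R) (f : R -> R[i]) : R[i] :=
  (\int[@lebesgue_measure R]_(x in D) complex.Re (f x)) +i*
  (\int[@lebesgue_measure R]_(x in D) complex.Im (f x)).

Definition L2norm (R : realType) (f : R -> R[i]) : \bar R :=
  Lnorm (@lebesgue_measure R) 2%:E (fun x => (cabs (f x))%:E).

Definition inL2 (R : realType) (f : R -> R[i]) : Prop :=
  [/\ measurable_fun [set: R] (fun x => complex.Re (f x)),
      measurable_fun [set: R] (fun x => complex.Im (f x)) &
      (L2norm f < +oo)%E].

Definition fourier_trunc (R : realType) (f : R -> R[i]) (N : nat) (xi : R) :
    R[i] :=
  cintegral `[- N%:R, N%:R] (fun x => cis (- (x * xi)) * f x).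

(* [g] is a representative of the Fourier-Plancherel transform of [f] in L^2:
   the integral of exp(-i x xi) f(x) over [-N, N] tends to [g] in L^2. *)
Definition is_fourier (R : realType) (f g : R -> R[i]) : Prop :=
  [/\ inL2 f, inL2 g &
      (fun N : nat => L2norm (fun xi => g xi - fourier_trunc f N xi)) @ \oo
        --> 0%E].

(* A representative of the transform; by Plancherel's theorem one exists for
   every [f] in L^2, and it is unique almost everywhere. *)
Definition fourier (R : realType) (f : R -> R[i]) : R -> R[i] :=
  xget (fun=> 0) [set g | is_fourier f g].

(* [h] = (1 - Delta)^(s/2) f, the Fourier multiplier (1 + xi^2)^(s/2). *)
Definition is_bessel (R : realType) (s : R) (f h : R -> R[i]) : Prop :=
  is_fourier h (fun xi => ((1 + xi ^+ 2) `^ (s / 2))%:C * fourier f xi).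

Definition bessel (R : realType) (s : R) (f : R -> R[i]) : R -> R[i] :=
  xget (fun=> 0) [set h | is_bessel s f h].

(* Membership in H^s(R) for s >= 0, where H^s is contained in L^2. *)
Definition inHs (R : realType) (s : R) (f : R -> R[i]) : Prop :=
  inL2 f /\ exists h, is_bessel s f h.

Definition Hsnorm (R : realType) (s : R) (f : R -> R[i]) : \bar R :=
  L2norm (bessel s f).

Definition schrodinger_trunc (R : realType) (m t : R) (f : R -> R[i])
    (x : R) (N : nat) : R[i] :=
  ((2 * pi)^-1)%:C *
  cintegral `[- N%:R, N%:R]
    (fun xi => cis (x * xi + t * (`|xi| `^ m)) * fourier f xi).

(* For [f] in H^s with s <= 1/2 the transform of [f] need not be integrable, so
   the integral over R is taken as the limit of the integrals over [-N, N]; by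
   dominated convergence this is the Lebesgue integral whenever the transform
   is integrable.  [limn] is meaningful only where [schrodinger_defined] holds.
   Real instead of integer cutoffs would give the same limits, since the
   integral of the modulus over N <= |xi| <= N + 1 tends to 0 for a square
   integrable transform. *)
Definition schrodinger_defined (R : realType) (m t : R) (f : R -> R[i])
    (x : R) : Prop :=
  cvgn (fun N => complex.Re (schrodinger_trunc m t f x N)) /\
  cvgn (fun N => complex.Im (schrodinger_trunc m t f x N)).

Definition schrodinger (R : realType) (m t : R) (f : R -> R[i]) (x : R) :
    R[i] :=
  limn (fun N => complex.Re (schrodinger_trunc m t f x N)) +i*
  limn (fun N => complex.Im (schrodinger_trunc m t f x N)).

Definition dimensional (R : realType) (alpha : R)
    (mu : {measure set (measurableTypeR R) -> \bar R}) : Prop :=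
  exists c : R, forall x r : R, 0 < r ->
    (mu (ball x r) <= (c * r `^ alpha)%:E)%E.

(* Only the values of [gamma] on R x [-1, 1] are constrained. *)
Definition Gamma (R : realType) (kappa : R) (gamma : R -> R -> R) : Prop :=
  [/\ {within [set p : R * R | p.2 \in `[-1, 1]],
         continuous (fun p : R * R => gamma p.1 p.2)},
      (forall x, gamma x 0 = x) &
      exists C1 C2 : R, [/\ 0 < C1, 0 < C2,
        (forall x t t', t \in `[-1, 1] -> t' \in `[-1, 1] ->
           `|gamma x t - gamma x t'| <= C1 * `|t - t'| `^ kappa) &
        (forall t x x', t \in `[-1, 1] ->
           C2^-1 * `|x - x'| <= `|gamma x t - gamma x' t| <= C2 * `|x - x'|)]].

(* Main.v *)
(** Split the frequencies into dyadic annuli of radius 2^k and linearize the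
    supremum over t, and over the cutoffs, by a measurable selector.  By the
    TT^* method and Schur's test each piece is governed by the kernel
      int cos ((gamma x t - gamma y t') xi + (t - t') |xi|^m) dxi.
    If |x - y| dominates |t - t'|^kappa the coefficient of xi is comparable to
    |x - y| and van der Corput's lemma gives 2^k (2^k |x - y|)^-theta, for any
    theta <= 1/2; otherwise |t - t'| is at least a multiple of
    |x - y|^(1/kappa) and the second derivative test gives
    2^k (2^(m k) |x - y|^(1/kappa))^-theta', for any theta' <= 1/2.  Both are
    uniformly integrable against mu when theta < alpha and
    theta' < alpha kappa, and the hypothesis on s says that theta and theta'
    can be chosen with 1 - theta < 2 s and 1 - m theta' < 2 s; the pieces then
    sum geometrically.  The bound of the transform of h by the L^2 norm of h
    comes from the same TT^* argument. *)

Require Import Defs.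
From HB Require Import structures.
From mathcomp Require Import all_boot all_order all_algebra.
From mathcomp Require Import complex.
From mathcomp Require Import all_classical all_reals all_analysis.
From mathcomp Require Import measurable_realfun ring lra.

Set Implicit Arguments.
Unset Strict Implicit.
Unset Printing Implicit Defensive.

Import Order.TTheory GRing.Theory Num.Theory.
Import numFieldNormedType.Exports.

Local Open Scope classical_set_scope.
Local Open Scope ring_scope.
Local Open Scope complex_scope.

(** The supremum over t is uncountable, so it is never integrated itself: it is compared with
    measurable majorants. On one dyadic piece the phase is kappa-Hoelder in t, with a constant that
    may depend on the piece and on the function; a finite grid of times then suffices, up to an
    error of prescribed small integral. The cutoffs N are a second parameter of the maximal
    function. Only finitely many of them matter in each annulus, so the same selector handles them,
    and the bound also gives convergence of the truncated integrals wherever the summed majorant is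
    finite, on a set of points that does not depend on t. All measures in TT^* are made finite: mu
    is restricted to [-1, 1], Lebesgue measure to the current frequency range. Amplitudes and
    kernels are then bounded, and the norm to be absorbed is finite. Complex amplitudes are carried
    as pairs of a cosine and a sine; a free shift of the phase turns bounds for one into bounds for
    the other. For the transform of h a sharp cutoff would produce a kernel whose Schur norm is not
    uniform; a parabolic window replaces it. *)

(** * Monotonicity, domination and Fubini on finite measure spaces *)

(** The integral of a nonnegative function is a supremum over the simple functions below it, hence
    monotone without measurability. This is how the supremum over t is compared with a measurable
    majorant. *)
Lemma ge0_le_integral_nonmeasurable d (T : measurableType d) (R : realType)
    (m : {measure set T -> \bar R}) (D : set T) (f g : T -> \bar R) :
  (forall x, D x -> 0 <= f x)%E -> (forall x, D x -> f x <= g x)%E ->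
  (\int[m]_(x in D) f x <= \int[m]_(x in D) g x)%E.
Proof.
move=> f0 fg.
have g0 x : D x -> (0 <= g x)%E by move=> Dx; exact: (le_trans (f0 _ Dx) (fg _ Dx)).
rewrite !ge0_integralE//; apply: le_ereal_sup => _ /= [h hf <-].
exists h => // x; apply: (le_trans (hf x)); rewrite /patch.
by case: ifPn => // /set_mem; exact: fg.
Qed.

Lemma bounded_integrable d (T : measurableType d) (R : realType)
    (m : {finite_measure set T -> \bar R}) (f : T -> R) (M : R) :
  measurable_fun setT f -> (forall x, `|f x| <= M) ->
  m.-integrable setT (EFin \o f).
Proof.
move=> mf fM; apply: measurable_bounded_integrable => //.
  by rewrite -ge0_fin_numE// fin_num_measure.
by exists M; split; [exact: num_real|move=> x Mx y _; apply: (le_trans (fM y)); apply: ltW].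
Qed.

Lemma Rintegral_norm_le d (T : measurableType d) (R : realType)
    (m : {measure set T -> \bar R}) (f a : T -> R) :
  measurable_fun setT f -> m.-integrable setT (EFin \o a) ->
  (forall x, `|f x| <= a x) -> `|\int[m]_x f x| <= \int[m]_x a x.
Proof.
move=> mf ia fa.
have intf : m.-integrable setT (EFin \o f).
  apply: (le_integrable measurableT _ _ ia); first exact/measurable_EFinP.
  by move=> x _ /=; rewrite lee_fin (le_trans (fa x))// ler_norm.
apply: (le_trans (le_normr_Rintegral measurableT intf)).
by apply: le_Rintegral => //; exact: integrable_norm.
Qed.

Section dominated_fubini.
Context d1 d2 (T1 : measurableType d1) (T2 : measurableType d2) (R : realType).
Variables (m1 : {finite_measure set T1 -> \bar R})
          (m2 : {finite_measure set T2 -> \bar R}).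
Variables (F : T1 * T2 -> R) (a : T2 -> R).
Hypotheses (mF : measurable_fun setT F) (ia : m2.-integrable setT (EFin \o a))
  (Fa : forall x y, `|F (x, y)| <= a y).

Lemma dominated_integrable1 x : m2.-integrable setT (fun y => (F (x, y))%:E).
Proof.
apply: (le_integrable measurableT _ _ ia).
  by apply/measurable_EFinP; exact: measurableT_comp.
by move=> y _ /=; rewrite lee_fin (le_trans (Fa x y))// ler_norm.
Qed.

Lemma dominated_Rintegral x : `|\int[m2]_y F (x, y)| <= \int[m2]_y a y.
Proof.
apply: Rintegral_norm_le => //; exact: measurableT_comp.
Qed.

(** The majorant [a] lives on the second factor, where it is integrable, and the first factor has
    finite mass. This covers products [c (x, z) * g z] with [c] bounded and [g] unbounded. *)
Lemma dominated_integrable : (m1 \x m2)%E.-integrable setT (EFin \o F).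
Proof.
have mEF : measurable_fun setT (EFin \o F) by exact/measurable_EFinP.
apply: (proj2 (integrable12ltyP m1 m2 mEF)).
apply: (@le_lt_trans _ _ (\int[m1]_x (\int[m2]_y (`|a y|)%:E))%E).
  apply: ge0_le_integral_nonmeasurable.
    by move=> x _; exact: integral_ge0.
  move=> x _; apply: ge0_le_integral_nonmeasurable => // y _; rewrite lee_fin.
  by rewrite (le_trans (Fa x y))// ler_norm.
rewrite integral_cst//; move/integrableP : ia => [_ /=].
have m1T : m1 setT \is a fin_num by rewrite fin_num_measure.
move=> aoo; apply: lte_mul_pinfty => //.
- exact: integral_ge0.
- by rewrite ge0_fin_numE//; exact: integral_ge0.
- by rewrite -ge0_fin_numE.
Qed.

Lemma measurable_Rintegral1 : measurable_fun setT (fun x => \int[m2]_y F (x, y)).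
Proof.
apply: measurableT_comp => //.
by have := measurable_fubini_F dominated_integrable.
Qed.

Lemma dominated_integrable2x y : m1.-integrable setT (fun x => (F (x, y))%:E).
Proof.
apply: (@bounded_integrable _ _ _ _ (fun x => F (x, y)) (a y)) => //.
exact: measurableT_comp.
Qed.

Lemma dominated_Fubini :
  \int[m1]_x (\int[m2]_y F (x, y)) = \int[m2]_y (\int[m1]_x F (x, y)).
Proof.
rewrite /Rintegral.
under eq_integral do rewrite fineK ?(integrable_fin_num measurableT (dominated_integrable1 _))//.
under [in RHS]eq_integral do rewrite fineK ?(integrable_fin_num measurableT (dominated_integrable2x _))//.
congr fine; exact: (Fubini dominated_integrable).
Qed.

End dominated_fubini.

(** A class closed under products, sections and partial integration, and integrable for every finite
    measure; it discharges the side conditions of Fubini's theorem in the TT^* argument. *)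
Definition bounded_measurable d (T : measurableType d) (R : realType) (f : T -> R) :=
  measurable_fun setT f /\ exists M, forall x, `|f x| <= M.

Section bounded_measurable.
Context d (T : measurableType d) (R : realType).
Implicit Types f g : T -> R.

Lemma bounded_measurable_cst (r : R) : bounded_measurable (fun _ : T => r).
Proof. by split => //; exists `|r|. Qed.

Lemma bounded_measurableD f g : bounded_measurable f -> bounded_measurable g ->
  bounded_measurable (fun x => f x + g x).
Proof.
move=> [mf [M fM]] [mg [N gN]]; split; first exact: measurable_funD.
by exists (M + N) => x; rewrite (le_trans (ler_normD _ _))// lerD.
Qed.

Lemma bounded_measurableM f g : bounded_measurable f -> bounded_measurable g ->
  bounded_measurable (fun x => f x * g x).
Proof.
move=> [mf [M fM]] [mg [N gN]]; split; first exact: measurable_funM.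
by exists (M * N) => x; rewrite normrM ler_pM.
Qed.

Lemma bounded_measurableN f : bounded_measurable f ->
  bounded_measurable (fun x => - f x).
Proof.
move=> [mf [M fM]]; split; first exact: measurableT_comp.
by exists M => x; rewrite normrN.
Qed.

Lemma bounded_measurableB f g : bounded_measurable f -> bounded_measurable g ->
  bounded_measurable (fun x => f x - g x).
Proof. by move=> bf bg; apply/bounded_measurableD => //; exact: bounded_measurableN. Qed.

Lemma bounded_measurableX f n : bounded_measurable f ->
  bounded_measurable (fun x => f x ^+ n).
Proof.
move=> bf; elim: n => [|n ih].
  exact: bounded_measurable_cst.
rewrite (_ : (fun x => f x ^+ n.+1) = (fun x => f x * f x ^+ n)).
  exact: bounded_measurableM.
by apply/funext => x; rewrite exprS.
Qed.

Lemma bounded_measurable_integrable (m : {finite_measure set T -> \bar R}) f :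
  bounded_measurable f -> m.-integrable setT (EFin \o f).
Proof. by move=> [mf [M fM]]; exact: bounded_integrable fM. Qed.

End bounded_measurable.

Lemma bounded_measurable_comp d d' (T : measurableType d) (T' : measurableType d')
    (R : realType) (f : T' -> R) (h : T -> T') :
  bounded_measurable f -> measurable_fun setT h -> bounded_measurable (f \o h).
Proof.
move=> [mf [M fM]] mh; split; first exact: measurableT_comp.
by exists M => x; exact: fM.
Qed.

Section bounded_fubini.
Context d1 d2 (T1 : measurableType d1) (T2 : measurableType d2) (R : realType).
Variables (m1 : {finite_measure set T1 -> \bar R})
          (m2 : {finite_measure set T2 -> \bar R}).
Variable F : T1 * T2 -> R.
Hypothesis bF : bounded_measurable F.

Lemma bounded_measurable_pair1 x : bounded_measurable (fun y => F (x, y)).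
Proof. exact: (bounded_measurable_comp bF (measurable_pair1 x)). Qed.

Lemma bounded_measurable_pair2 y : bounded_measurable (fun x => F (x, y)).
Proof. exact: (bounded_measurable_comp bF (measurable_pair2 y)). Qed.

Let icst (M : R) : m2.-integrable setT (EFin \o (fun _ : T2 => M)).
Proof. apply: bounded_measurable_integrable; exact: bounded_measurable_cst. Qed.

Lemma bounded_measurable_Rintegral1 :
  bounded_measurable (fun x => \int[m2]_y F (x, y)).
Proof.
have [mF [M FM]] := bF.
split; first exact: (measurable_Rintegral1 m1 mF (icst M)).
exists (\int[m2]_y M) => x; exact: (dominated_Rintegral mF (icst M)).
Qed.

Lemma bounded_Fubini :
  \int[m1]_x (\int[m2]_y F (x, y)) = \int[m2]_y (\int[m1]_x F (x, y)).
Proof. by have [mF [M FM]] := bF; exact: (dominated_Fubini m1 mF (icst M)). Qed.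

End bounded_fubini.

Lemma bounded_measurable_swap d1 d2 (T1 : measurableType d1)
  (T2 : measurableType d2) (R : realType) (F : T1 * T2 -> R) :
  bounded_measurable F -> bounded_measurable (fun z : T2 * T1 => F (z.2, z.1)).
Proof.
move=> bF; apply: (bounded_measurable_comp bF (h := fun z : T2 * T1 => (z.2, z.1))).
by apply: measurable_fun_pair; [exact: measurable_snd|exact: measurable_fst].
Qed.

Lemma bounded_measurable_Rintegral2 d1 d2 (T1 : measurableType d1)
  (T2 : measurableType d2) (R : realType) (m1 : {finite_measure set T1 -> \bar R})
  (m2 : {finite_measure set T2 -> \bar R}) (F : T1 * T2 -> R) :
  bounded_measurable F -> bounded_measurable (fun y => \int[m1]_x F (x, y)).
Proof.
by move=> /bounded_measurable_swap bF; exact: (bounded_measurable_Rintegral1 m2 m1 bF).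
Qed.

(** * The TT^* method and Schur's test for a pair of real amplitudes *)

Section ttstar.
Context d1 d2 (T1 : measurableType d1) (T2 : measurableType d2) (R : realType).
Variables (m1 : {finite_measure set T1 -> \bar R})
          (m2 : {finite_measure set T2 -> \bar R}).
Variables (c s : T1 * T2 -> R) (k : T1 * T1 -> R) (B : R).
Hypotheses (bc : bounded_measurable c) (bs : bounded_measurable s)
  (bk : bounded_measurable k)
  (ksym : forall x y, k (x, y) = k (y, x))
  (kc : forall x y,
    `|\int[m2]_z (c (x, z) * c (y, z) + s (x, z) * s (y, z))| <= k (x, y))
  (ks : forall x y,
    `|\int[m2]_z (c (x, z) * s (y, z) - s (x, z) * c (y, z))| <= k (x, y))
  (B0 : 0 < B) (kB : forall x, \int[m1]_y k (x, y) <= B).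
Variable g : T2 -> R.
Hypotheses (mg : measurable_fun setT g)
  (ig2 : m2.-integrable setT (fun z => (g z ^+ 2)%:E)).

(** |g| <= 1 + g^2, and constants are integrable for a finite measure. *)
Lemma square_integrable_integrable : m2.-integrable setT (EFin \o g).
Proof.
have i1 : m2.-integrable setT (fun z => (1 + g z ^+ 2)%:E).
  have := integrableD measurableT
    (bounded_measurable_integrable m2 (bounded_measurable_cst T2 1)) ig2.
  by apply: eq_integrable.
apply: (le_integrable measurableT _ _ i1); first exact/measurable_EFinP.
move=> z _ /=; rewrite lee_fin [leRHS]ger0_norm; last by rewrite addr_ge0// sqr_ge0.
rewrite -[g z ^+ 2]real_normK ?num_real//.
by have := sqr_ge0 (`|g z| - 1); have := normr_ge0 (g z); lra.
Qed.

Let ig := square_integrable_integrable.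

Let bmM := bounded_measurableM.
Let bmD := bounded_measurableD.
Let bmB := bounded_measurableB.
Let bmc := bounded_measurable_comp.
Let int d (T : measurableType d) (m : {finite_measure set T -> \bar R}) f :=
  @bounded_measurable_integrable d T R m f.

(** A bounded amplitude against the integrable [g] gives at most its sup norm times the L^1 norm of
    [g], so the output is bounded although [g] is not. *)
Lemma bounded_measurable_operator (e : T1 * T2 -> R) : bounded_measurable e ->
  bounded_measurable (fun x => \int[m2]_z (e (x, z) * g z)).
Proof.
move=> [me [M eM]].
have mF : measurable_fun setT (fun p : T1 * T2 => e p * g p.2).
  by apply: measurable_funM => //; apply: measurableT_comp => //; exact: measurable_snd.
have ia : m2.-integrable setT (EFin \o (fun z => M * `|g z|)).
  apply: (@integrableZl _ _ _ m2 _ measurableT M (fun z => `|g z|%:E)).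
  exact: integrable_norm.
have Fa x y : `|e (x, y) * g y| <= M * `|g y| by rewrite normrM ler_wpM2r.
split; first exact: (measurable_Rintegral1 m1 mF ia).
exists (\int[m2]_z (M * `|g z|)) => x; exact: (dominated_Rintegral mF ia).
Qed.

(** With the complex amplitude c + i s, [u] and [v] are the real and imaginary parts of T g for the
    real function [g], and [w] is the squared modulus of T g. *)
Let u x := \int[m2]_z (c (x, z) * g z).
Let v x := \int[m2]_z (s (x, z) * g z).
Let w x := u x ^+ 2 + v x ^+ 2.
Let bu : bounded_measurable u := bounded_measurable_operator bc.
Let bv : bounded_measurable v := bounded_measurable_operator bs.
Let bw : bounded_measurable w.
Proof. by apply: bmD; exact: bounded_measurableX. Qed.

(** Real and imaginary parts of T g times the conjugate amplitude c - i s; integrated in x they give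
    the real and imaginary parts [P] and [Q] of T^* T g. *)
Let p (xz : T1 * T2) := u xz.1 * c xz + v xz.1 * s xz.
Let q (xz : T1 * T2) := v xz.1 * c xz - u xz.1 * s xz.
Let bp : bounded_measurable p.
Proof.
by apply: bmD; apply: bmM => //; apply: (bmc _ _ (h := fst)) => //; exact: measurable_fst.
Qed.
Let bq : bounded_measurable q.
Proof.
by apply: bmB; apply: bmM => //; apply: (bmc _ _ (h := fst)) => //; exact: measurable_fst.
Qed.
Let P z := \int[m1]_x p (x, z).
Let Q z := \int[m1]_x q (x, z).
Let bP : bounded_measurable P := bounded_measurable_Rintegral2 m1 m2 bp.
Let bQ : bounded_measurable Q := bounded_measurable_Rintegral2 m1 m2 bq.

Let A := \int[m1]_x w x.

(** The pairing of T g with itself is that of T^* T g with g; only the real part [P] survives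
    because [g] is real. *)
Let A_eq : A = \int[m2]_z (P z * g z).
Proof.
have [mp [M pM]] := bp.
have mF : measurable_fun setT (fun xz : T1 * T2 => p xz * g xz.2).
  by apply: measurable_funM => //; apply: measurableT_comp => //; exact: measurable_snd.
have ia : m2.-integrable setT (EFin \o (fun z => M * `|g z|)).
  apply: (@integrableZl _ _ _ m2 _ measurableT M (fun z => `|g z|%:E)).
  exact: integrable_norm.
have Fa x y : `|p (x, y) * g y| <= M * `|g y| by rewrite normrM ler_wpM2r.
transitivity (\int[m2]_z (\int[m1]_x (p (x, z) * g z))); last first.
  apply: eq_Rintegral => z _; rewrite RintegralZr//.
  by apply: int; exact: bounded_measurable_pair2.
rewrite -(dominated_Fubini m1 mF ia)//=; apply: eq_Rintegral => x _.
have ie (e : T1 * T2 -> R) : bounded_measurable e ->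
    m2.-integrable setT (EFin \o (fun z => e (x, z) * g z)).
  move=> [me [N eN]].
  have mF' : measurable_fun setT (fun p : T1 * T2 => e p * g p.2).
    by apply: measurable_funM => //; apply: measurableT_comp => //; exact: measurable_snd.
  have ia' : m2.-integrable setT (EFin \o (fun z => N * `|g z|)).
    apply: (@integrableZl _ _ _ m2 _ measurableT N (fun z => `|g z|%:E)).
    exact: integrable_norm.
  have Fa' x' y : `|e (x', y) * g y| <= N * `|g y| by rewrite normrM ler_wpM2r.
  exact: (dominated_integrable1 mF' ia').
transitivity (\int[m2]_z (u x * (c (x, z) * g z) + v x * (s (x, z) * g z))); last first.
  by apply: eq_Rintegral => z _; rewrite /p /=; ring.
rewrite RintegralD//; last 2 first.
- exact: (@integrableZl _ _ _ m2 _ measurableT (u x) (fun z => (c (x, z) * g z)%:E) (ie _ bc)).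
- exact: (@integrableZl _ _ _ m2 _ measurableT (v x) (fun z => (s (x, z) * g z)%:E) (ie _ bs)).
by rewrite !RintegralZl//; exact: ie.
Qed.

Let L x := \int[m2]_z (P z * p (x, z) + Q z * q (x, z)).

Let PQ_eq : \int[m2]_z (P z * P z + Q z * Q z) = \int[m1]_x L x.
Proof.
have bF : bounded_measurable (fun xz : T1 * T2 => P xz.2 * p xz + Q xz.2 * q xz).
  by apply: bmD; apply: bmM => //; apply: (bmc _ _ (h := snd)) => //; exact: measurable_snd.
rewrite (bounded_Fubini m1 m2 bF); apply: eq_Rintegral => z _ /=.
have bpz := bounded_measurable_pair2 bp z.
have bqz := bounded_measurable_pair2 bq z.
rewrite RintegralD//; last 2 first.
- by apply: (int m1 (f := fun x => P z * p (x, z))); apply: bmM => //; exact: bounded_measurable_cst.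
- by apply: (int m1 (f := fun x => Q z * q (x, z))); apply: bmM => //; exact: bounded_measurable_cst.
by rewrite !RintegralZl//; exact: int.
Qed.

(** Integrating in z first turns the product of the amplitudes at x and y into the two kernels
    bounded by [k]. Each of their coefficients is at most half of [w y + w x] by the
    arithmetic-geometric inequality, whence the total weight [w y + w x]. *)
Let L_le x : L x <= \int[m1]_y ((w y + w x) * k (y, x)).
Proof.
have bpx := bounded_measurable_pair1 bp x.
have bqx := bounded_measurable_pair1 bq x.
have bF : bounded_measurable
    (fun yz : T1 * T2 => p yz * p (x, yz.2) + q yz * q (x, yz.2)).
  apply: bmD; apply: bmM => //.
    by apply: (bmc bpx (h := snd)); exact: measurable_snd.
  by apply: (bmc bqx (h := snd)); exact: measurable_snd.
have -> : L x = \int[m1]_y \int[m2]_z (p (y, z) * p (x, z) + q (y, z) * q (x, z)).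
  rewrite (bounded_Fubini m1 m2 bF); apply: eq_Rintegral => z _ /=.
  have bpz := bounded_measurable_pair2 bp z.
  have bqz := bounded_measurable_pair2 bq z.
  rewrite RintegralD//; last 2 first.
  - by apply: (int m1 (f := fun y => p (y, z) * p (x, z))); apply: bmM => //; exact: bounded_measurable_cst.
  - by apply: (int m1 (f := fun y => q (y, z) * q (x, z))); apply: bmM => //; exact: bounded_measurable_cst.
  by rewrite !RintegralZr//; exact: int.
apply: le_Rintegral => //.
- exact: int (bounded_measurable_Rintegral1 m1 m2 bF).
- apply: (int m1 (f := fun y => (w y + w x) * k (y, x))).
  apply: bmM; last exact: bounded_measurable_pair2.
  by apply: bmD => //; exact: bounded_measurable_cst.
move=> y _.
set Kc := \int[m2]_z (c (y, z) * c (x, z) + s (y, z) * s (x, z)).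
set Ks := \int[m2]_z (c (y, z) * s (x, z) - s (y, z) * c (x, z)).
have cx := bounded_measurable_pair1 bc x; have cy := bounded_measurable_pair1 bc y.
have sx := bounded_measurable_pair1 bs x; have sy := bounded_measurable_pair1 bs y.
have i1 : m2.-integrable setT
    (EFin \o (fun z => c (y, z) * c (x, z) + s (y, z) * s (x, z))).
  by apply: int; apply: bmD; apply: bmM.
have i2 : m2.-integrable setT
    (EFin \o (fun z => c (y, z) * s (x, z) - s (y, z) * c (x, z))).
  by apply: int; apply: bmB; apply: bmM.
have lin (a b : R) : a * Kc + b * Ks =
    \int[m2]_z (a * (c (y, z) * c (x, z) + s (y, z) * s (x, z)) +
                b * (c (y, z) * s (x, z) - s (y, z) * c (x, z))).
  rewrite RintegralD//.
  - by rewrite !RintegralZl.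
  - exact: (@integrableZl _ _ _ m2 _ measurableT a _ i1).
  - exact: (@integrableZl _ _ _ m2 _ measurableT b _ i2).
have -> : \int[m2]_z (p (y, z) * p (x, z) + q (y, z) * q (x, z)) =
   (u y * u x + v y * v x) * Kc + (u y * v x - v y * u x) * Ks.
  by rewrite lin; apply: eq_Rintegral => z _; rewrite /p /q /=; ring.
have := kc y x; rewrite -/Kc ler_norml => /andP[Kc1 Kc2].
have := ks y x; rewrite -/Ks ler_norml => /andP[Ks1 Ks2].
have k0 : 0 <= k (y, x) by apply: le_trans (kc y x).
rewrite /w; clear lin; move: (k (y, x)) k0 Kc Ks Kc1 Kc2 Ks1 Ks2 => kk k0 Kc Ks *.
have aux (a b t r : R) : 0 <= b -> `|a| <= b -> - t <= r -> r <= t -> a * r <= b * t.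
  move=> b0 ab h1 h2; apply: (le_trans (ler_norm _)); rewrite normrM.
  by apply: ler_pM => //; rewrite ler_norml h1 h2.
set W := u y ^+ 2 + v y ^+ 2 + (u x ^+ 2 + v x ^+ 2).
have W0 : 0 <= W / 2 by rewrite divr_ge0// !addr_ge0// sqr_ge0.
have -> : W * kk = W / 2 * kk + W / 2 * kk by field.
apply: lerD; apply: aux => //; rewrite /W ler_norml.
  have := sqr_ge0 (u y - u x); have := sqr_ge0 (u y + u x).
  have := sqr_ge0 (v y - v x); have := sqr_ge0 (v y + v x).
  by move=> *; apply/andP; split; lra.
have := sqr_ge0 (u y - v x); have := sqr_ge0 (u y + v x).
have := sqr_ge0 (v y - u x); have := sqr_ge0 (v y + u x).
by move=> *; apply/andP; split; lra.
Qed.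

Let int_wk : \int[m1]_x (w x * \int[m1]_y k (x, y)) <= B * A.
Proof.
rewrite /A -RintegralZl//; last exact: int.
apply: le_Rintegral => //.
- apply: (int m1 (f := fun x => w x * _)); apply: bmM => //.
  exact: bounded_measurable_Rintegral1.
- apply: (int m1 (f := fun x => B * w x)); apply: bmM => //; exact: bounded_measurable_cst.
- by move=> x _; rewrite mulrC ler_wpM2r// addr_ge0 ?sqr_ge0.
Qed.

(** Schur's test: by the symmetry of [k], each of the two terms of the weight integrates to at most
    [B * A]. *)
Let PQ_le : \int[m2]_z (P z * P z + Q z * Q z) <= 2 * B * A.
Proof.
rewrite PQ_eq.
have bF : bounded_measurable (fun xy : T1 * T1 => (w xy.2 + w xy.1) * k (xy.2, xy.1)).
  apply: bmM; last exact: bounded_measurable_swap.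
  apply: bmD; first by apply: (bmc bw (h := snd)); exact: measurable_snd.
  by apply: (bmc bw (h := fst)); exact: measurable_fst.
have bG1 : bounded_measurable (fun xy : T1 * T1 => w xy.2 * k (xy.2, xy.1)).
  apply: bmM; last exact: bounded_measurable_swap.
  by apply: (bmc bw (h := snd)); exact: measurable_snd.
have bG2 : bounded_measurable (fun xy : T1 * T1 => w xy.1 * k (xy.2, xy.1)).
  apply: bmM; last exact: bounded_measurable_swap.
  by apply: (bmc bw (h := fst)); exact: measurable_fst.
have bL : bounded_measurable L.
  have bF' : bounded_measurable (fun xz : T1 * T2 => P xz.2 * p xz + Q xz.2 * q xz).
    by apply: bmD; apply: bmM => //; apply: (bmc _ _ (h := snd)) => //; exact: measurable_snd.
  exact: (bounded_measurable_Rintegral1 m1 m2 bF').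
apply: (@le_trans _ _ (\int[m1]_x \int[m1]_y ((w y + w x) * k (y, x)))).
  apply: le_Rintegral => //; first exact: int.
  exact: (int m1 (bounded_measurable_Rintegral1 m1 m1 bF)).
have -> : \int[m1]_x \int[m1]_y ((w y + w x) * k (y, x)) =
  \int[m1]_x \int[m1]_y (w y * k (y, x)) + \int[m1]_x \int[m1]_y (w x * k (y, x)).
  rewrite -RintegralD//; last 2 first.
  - exact: (int m1 (bounded_measurable_Rintegral1 m1 m1 bG1)).
  - exact: (int m1 (bounded_measurable_Rintegral1 m1 m1 bG2)).
  apply: eq_Rintegral => x _; rewrite -RintegralD//; last 2 first.
  - exact: (int m1 (bounded_measurable_pair1 bG1 x)).
  - exact: (int m1 (bounded_measurable_pair1 bG2 x)).
  by apply: eq_Rintegral => y _; rewrite mulrDl.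
have -> : 2 * B * A = B * A + B * A by ring.
apply: lerD; last first.
  apply: le_trans int_wk; rewrite le_eqVlt; apply/orP; left; apply/eqP.
  apply: eq_Rintegral => x _; rewrite -RintegralZl//; last first.
    by apply: int; exact: bounded_measurable_pair1.
  by apply: eq_Rintegral => y _; rewrite ksym.
apply: le_trans int_wk; rewrite (bounded_Fubini m1 m1 bG1)/= le_eqVlt.
apply/orP; left; apply/eqP; apply: eq_Rintegral => x _.
rewrite -RintegralZl//; apply: int; exact: bounded_measurable_pair1.
Qed.

(** [A] is the pairing of [P] with [g], and Young's inequality with weight [4 * B] splits it into
    [B] times the integral of g^2 and at most half of [A]. The half is absorbed, which is legitimate
    because [A] is finite: [w] is bounded and [m1] has finite mass. *)
Lemma ttstar : \int[m1]_x (u x ^+ 2 + v x ^+ 2) <= 4 * B * \int[m2]_z (g z ^+ 2).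
Proof.
rewrite -/A.
suff : A <= B * \int[m2]_z (g z ^+ 2) + (4 * B)^-1 * (2 * B * A).
  have -> : (4 * B)^-1 * (2 * B * A) = A / 2 by field; rewrite gt_eqF.
  have : 0 <= \int[m2]_z (g z ^+ 2) by apply: Rintegral_ge0 => z _; exact: sqr_ge0.
  by move: (\int[m2]_z (g z ^+ 2)) => G G0; have := mulr_ge0 (ltW B0) G0; lra.
have iPQ : m2.-integrable setT (EFin \o (fun z => P z * P z + Q z * Q z)).
  by apply: int; apply: bmD; apply: bmM.
apply: (@le_trans _ _ (B * \int[m2]_z (g z ^+ 2) +
   (4 * B)^-1 * \int[m2]_z (P z * P z + Q z * Q z))); last first.
  by rewrite lerD2l ler_pM2l// invr_gt0 mulr_gt0.
rewrite A_eq -!RintegralZl// -RintegralD//; last 2 first.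
- exact: (@integrableZl _ _ _ m2 _ measurableT B _ ig2).
- exact: (@integrableZl _ _ _ m2 _ measurableT _ _ iPQ).
have iPg : m2.-integrable setT (EFin \o (fun z => P z * g z)).
  have [mP [M PM]] := bP.
  have ia : m2.-integrable setT (EFin \o (fun z => M * `|g z|)).
    apply: (@integrableZl _ _ _ m2 _ measurableT M (fun z => `|g z|%:E)).
    exact: integrable_norm.
  apply: (le_integrable measurableT _ _ ia).
    by apply/measurable_EFinP; exact: measurable_funM.
  by move=> z _; rewrite lee_fin (le_trans _ (ler_norm _))// normrM ler_wpM2r.
apply: le_Rintegral => //.
  have := integrableD measurableT
    (@integrableZl _ _ _ m2 _ measurableT B _ ig2)
    (@integrableZl _ _ _ m2 _ measurableT (4 * B)^-1 _ iPQ).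
  by apply: eq_integrable.
move=> z _; rewrite -subr_ge0.
have -> : B * g z ^+ 2 + (4 * B)^-1 * (P z * P z + Q z * Q z) - P z * g z =
  (4 * B)^-1 * ((2 * B * g z - P z) ^+ 2 + Q z ^+ 2) by field; rewrite gt_eqF.
by rewrite mulr_ge0 ?invr_ge0 ?mulr_ge0 ?(ltW B0)// addr_ge0 ?sqr_ge0.
Qed.

End ttstar.

(** * Calculus on intervals and van der Corput's lemma *)

Section interval_integrals.
Variable R : realType.
Implicit Types (f F : R -> R) (a b c x : R).
Local Notation leb := (@lebesgue_measure R).

Lemma is_derive_continuous f x d : is_derive x 1 f d -> {for x, continuous f}.
Proof.
by move=> [df _]; apply: differentiable_continuous; exact/derivable1_diffP.
Qed.

Lemma continuous_itv_within f a b :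
  (forall x, a <= x <= b -> {for x, continuous f}) -> {within `[a, b], continuous f}.
Proof.
by move=> cf; apply: continuous_in_subspaceT => x /set_mem /=; rewrite in_itv; exact: cf.
Qed.

Lemma continuous_itv_integrable f a b :
  (forall x, a <= x <= b -> {for x, continuous f}) ->
  leb.-integrable `[a, b] (EFin \o f).
Proof.
move=> cf; apply: continuous_compact_integrable; first exact: segment_compact.
exact: continuous_itv_within.
Qed.

Lemma Rintegral_itv_split f a b c :
  leb.-integrable `[a, b] (EFin \o f) -> a <= c -> c <= b ->
  \int[leb]_(x in `[a, b]) f x =
  \int[leb]_(x in `[a, c]) f x + \int[leb]_(x in `[c, b]) f x.
Proof.
move=> fi ac cb.
have fi' : leb.-integrable `]c, b] (EFin \o f).
  by apply: integrableS fi => //; apply: subset_itv; rewrite bnd_simp.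
have := Rintegral_itvB fi (x := c); rewrite !bnd_simp => /(_ ac cb).
by rewrite Rintegral_itv_obnd_cbnd// => <-; rewrite addrC subrK.
Qed.

Lemma Rintegral_itv_derive f F a b : a <= b ->
  (forall x, a <= x <= b -> is_derive x 1 F (f x)) ->
  (forall x, a <= x <= b -> {for x, continuous f}) ->
  \int[leb]_(x in `[a, b]) f x = F b - F a.
Proof.
rewrite le_eqVlt => /predU1P[<-|ab] dF cf.
  by rewrite set_itv1 Rintegral_set1 subrr.
have cF x : a <= x <= b -> {for x, continuous F} by move=> /dF; exact: is_derive_continuous.
have cFW := continuous_itv_within cF.
rewrite /Rintegral (continuous_FTC2 (F := F) ab)//.
- exact: continuous_itv_within.
- have [? ? ?] := (continuous_within_itvP F ab).1 cFW.
  split => // x; rewrite in_itv /= => /andP[/ltW ax /ltW xb].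
  by have [] : is_derive x 1 F (f x) by apply: dF; rewrite ax xb.
- move=> x; rewrite in_itv /= => /andP[/ltW ax /ltW xb].
  have h : is_derive x 1 F (f x) by apply: dF; rewrite ax xb.
  by rewrite derive1E derive_val.
Qed.

Lemma Rintegral_itv_le_cst f a b r : a <= b ->
  leb.-integrable `[a, b] (EFin \o f) -> (forall x, a <= x <= b -> f x <= r) ->
  \int[leb]_(x in `[a, b]) f x <= r * (b - a).
Proof.
move=> ab fi fr.
apply: (@le_trans _ _ (\int[leb]_(x in `[a, b]) r)).
  apply: le_Rintegral => //.
  by apply: continuous_itv_integrable => x _; exact: cvg_cst.
have -> : \int[leb]_(x in `[a, b]) r = r * fine (leb `[a, b]).
  by apply: Rintegral_cst; exact: measurable_itv.
rewrite lebesgue_measure_itv /= lte_fin.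
by move: ab; rewrite le_eqVlt => /predU1P[->|->]//; rewrite ltxx subrr.
Qed.

End interval_integrals.

Section van_der_corput.
Variable R : realType.
Variables (phi phi1 phi2 : R -> R) (l r : R).
Local Notation leb := (@lebesgue_measure R).
Hypotheses (dphi : forall x, l <= x <= r -> is_derive x 1 phi (phi1 x))
  (dphi1 : forall x, l <= x <= r -> is_derive x 1 phi1 (phi2 x))
  (cphi2 : forall x, l <= x <= r -> {for x, continuous phi2})
  (phi2_ge0 : forall x, l <= x <= r -> 0 <= phi2 x).

Lemma continuous_cos_phase x : l <= x <= r -> {for x, continuous (cos \o phi)}.
Proof.
move=> xlr; apply: continuous_comp; last exact: continuous_cos.
exact: is_derive_continuous (dphi xlr).
Qed.

Lemma continuous_sin_phase x : l <= x <= r -> {for x, continuous (sin \o phi)}.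
Proof.
move=> xlr; apply: continuous_comp; last exact: continuous_sin.
exact: is_derive_continuous (dphi xlr).
Qed.

Lemma integrable_cos_phase a b : l <= a -> b <= r ->
  leb.-integrable `[a, b] (fun x => (cos (phi x))%:E).
Proof.
move=> la br; apply: (continuous_itv_integrable (f := cos \o phi)) => x /andP[ax xb].
by apply: continuous_cos_phase; rewrite (le_trans la ax) (le_trans xb br).
Qed.

(* [(sin phi - 1) / phi'] has derivative
   [cos phi + (1 - sin phi) phi'' / phi'^2 >= cos phi]. *)
Lemma van_der_corput1 a b delta : l <= a -> a <= b -> b <= r -> 0 < delta ->
  (forall x, a <= x <= b -> delta <= phi1 x) \/
  (forall x, a <= x <= b -> phi1 x <= - delta) ->
  \int[leb]_(x in `[a, b]) cos (phi x) <= 2 / delta.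
Proof.
move=> la ab br d0 hphi1.
have lr x : a <= x <= b -> l <= x <= r.
  by move=> /andP[ax xb]; rewrite (le_trans la ax) (le_trans xb br).
have phi1_neq0 x : a <= x <= b -> phi1 x != 0.
  by case: hphi1 => h /h; [move=> ?; rewrite gt_eqF//|move=> ?; rewrite lt_eqF//]; lra.
pose F x := (sin (phi x) - 1) * (phi1 x)^-1.
pose f x := cos (phi x) + (1 - sin (phi x)) * phi2 x * ((phi1 x)^-1 * (phi1 x)^-1).
have dF x : a <= x <= b -> is_derive x 1 F (f x).
  move=> xab; have dx := dphi (lr _ xab); have dx1 := dphi1 (lr _ xab).
  have d1 := is_deriveV (phi1_neq0 _ xab) dx1.
  have d2 : is_derive x 1 (sin \o phi) (cos (phi x) * phi1 x).
    exact: is_derive1_comp.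
  have d3 : is_derive x 1 (sin \o phi - cst 1) (cos (phi x) * phi1 x - 0).
    exact: is_deriveB.
  have d4 := is_deriveM d3 d1.
  rewrite (_ : f x = (sin \o phi - cst 1) x *: (- phi1 x ^- 2 *: phi2 x) +
    (phi1 x)^-1 *: (cos (phi x) * phi1 x - 0)); first exact: d4.
  rewrite /f !fctE /GRing.scale /=.
  by move: (phi1_neq0 _ xab) => ?; field.
have cf x : a <= x <= b -> {for x, continuous f}.
  move=> xab; have xlr := lr _ xab.
  have c1 : {for x, continuous (fun y => (phi1 y)^-1)}.
    apply: continuousV; first exact: phi1_neq0.
    exact: is_derive_continuous (dphi1 xlr).
  apply: continuousD; first exact: continuous_cos_phase.
  apply: continuousM; last exact: continuousM.
  apply: continuousM; last exact: cphi2.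
  apply: continuousB; [exact: cvg_cst|exact: continuous_sin_phase].
apply: (@le_trans _ _ (F b - F a)).
  rewrite -(Rintegral_itv_derive ab dF cf); apply: le_Rintegral => //.
  - exact: integrable_cos_phase.
  - exact: continuous_itv_integrable.
  move=> x /=; rewrite in_itv /= => xab; rewrite /f lerDl mulr_ge0//.
    by rewrite mulr_ge0 ?phi2_ge0 ?lr// subr_ge0 sin_le1.
  by rewrite -expr2 sqr_ge0.
have hs x : - 2 <= sin (phi x) - 1 <= 0.
  by have := sin_geN1 (phi x); have := sin_le1 (phi x); move=> ? ?; apply/andP; split; lra.
have ha : a <= a <= b by rewrite lexx ab.
have hb : a <= b <= b by rewrite lexx ab.
(* Since sin - 1 <= 0, [F] has a constant sign in each case: one endpoint is dropped and the other
   costs at most [2 / delta]. *)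
case: hphi1 => h.
  have Fb : F b <= 0.
    have /andP[_ sb] := hs b; rewrite /F pmulr_lle0//.
    by rewrite invr_gt0 (lt_le_trans d0)// h.
  have Fa : - F a <= 2 / delta.
    rewrite /F -mulNr ler_pM//.
    - by rewrite invr_ge0 (le_trans (ltW d0))// h.
    - by have /andP[? ?] := hs a; lra.
    - by rewrite lef_pV2 ?posrE// ?h// (lt_le_trans d0)// h.
  lra.
have Fa : 0 <= F a.
  have /andP[_ sa] := hs a; rewrite /F mulr_le0//.
  by rewrite invr_le0 (le_trans (h _ ha))// oppr_le0 ltW.
have Fb : F b <= 2 / delta.
  rewrite /F -mulrNN -invrN ler_pM//.
  - by rewrite invr_ge0 oppr_ge0 (le_trans (h _ hb))// oppr_le0 ltW.
  - by have /andP[? ?] := hs b; lra.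
  - have hdb : delta <= - phi1 b by rewrite lerNr h.
    by rewrite lef_pV2 ?posrE// (lt_le_trans d0).
lra.
Qed.

Variable rho : R.
Hypotheses (rho0 : 0 < rho)
  (growth : forall x y, l <= x -> x <= y -> y <= r -> rho * (y - x) <= phi1 y - phi1 x).

Let cos_le1_itv a b : l <= a -> a <= b -> b <= r ->
  \int[leb]_(x in `[a, b]) cos (phi x) <= b - a.
Proof.
move=> la ab br; rewrite -[leRHS]mul1r; apply: Rintegral_itv_le_cst => //.
exact: integrable_cos_phase.
Qed.

(** Beyond [a + h] the hypothesis [growth] gives [phi1] at least [rho * h], so the first derivative
    test applies; the stretch of length [h] before it is bounded by its length. *)
Let vdc_right h a b : 0 < h -> l <= a -> a <= b -> b <= r -> 0 <= phi1 a ->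
  \int[leb]_(x in `[a, b]) cos (phi x) <= h + 2 / (rho * h).
Proof.
move=> h0 la ab br a0.
have rh0 : 0 < rho * h by rewrite mulr_gt0.
have rh2 : 0 <= 2 / (rho * h) by rewrite divr_ge0// ltW.
have [bah|ahb] := leP b (a + h).
  by apply: (le_trans (cos_le1_itv la ab br)); lra.
rewrite (@Rintegral_itv_split _ _ _ _ (a + h)) ?lerDl ?(ltW h0) ?(ltW ahb)//; last first.
  exact: integrable_cos_phase.
apply: lerD.
  have := @cos_le1_itv a (a + h); rewrite la lerDl (ltW h0) => /(_ isT isT).
  by rewrite (le_trans (ltW ahb))// => /(_ isT); lra.
apply: van_der_corput1 => //; first by lra.
  exact: ltW.
left => x /andP[ahx xb]; have ax : a <= x by lra.
have := growth la ax (le_trans xb br); have : rho * h <= rho * (x - a).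
  by rewrite ler_pM2l//; lra.
lra.
Qed.

Let vdc_left h a b : 0 < h -> l <= a -> a <= b -> b <= r -> phi1 b <= 0 ->
  \int[leb]_(x in `[a, b]) cos (phi x) <= h + 2 / (rho * h).
Proof.
move=> h0 la ab br b0.
have rh0 : 0 < rho * h by rewrite mulr_gt0.
have rh2 : 0 <= 2 / (rho * h) by rewrite divr_ge0// ltW.
have [bah|ahb] := leP (b - h) a.
  by apply: (le_trans (cos_le1_itv la ab br)); lra.
rewrite (@Rintegral_itv_split _ _ _ _ (b - h)) ?gerBl ?(ltW h0) ?(ltW ahb)//; last first.
  exact: integrable_cos_phase.
rewrite addrC; apply: lerD.
  have := @cos_le1_itv (b - h) b; rewrite (le_trans la (ltW ahb)) gerBl (ltW h0) br.
  by move=> /(_ isT isT isT); lra.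
apply: van_der_corput1 => //; first exact: ltW.
  by lra.
right => x /andP[ahx xb]; have ax : x <= b by lra.
have := growth (le_trans la ahx) ax br; have : rho * h <= rho * (b - x).
  by rewrite ler_pM2l//; lra.
lra.
Qed.

(** [phi1] is increasing, so if it changes sign the interval is cut at its zero and one half goes to
    each of the one-sided estimates. The length [h] of the excised stretches stays free; it is
    balanced against [rho] when the phase is known. *)
Lemma van_der_corput2 h a b : 0 < h -> l <= a -> a <= b -> b <= r ->
  \int[leb]_(x in `[a, b]) cos (phi x) <= 2 * (h + 2 / (rho * h)).
Proof.
move=> h0 la ab br.
have hr : 0 <= h + 2 / (rho * h) by rewrite addr_ge0 ?divr_ge0 ?mulr_ge0// ltW.
have [a0|a0] := leP 0 (phi1 a); first by have := vdc_right h0 la ab br a0; lra.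
have [b0|b0] := leP (phi1 b) 0; first by have := vdc_left h0 la ab br b0; lra.
have cphi1 : {within `[a, b], continuous phi1}.
  apply: continuous_itv_within => x /andP[ax xb].
  by apply: is_derive_continuous; apply: dphi1; rewrite (le_trans la ax) (le_trans xb br).
have phi1ab : phi1 a <= phi1 b by rewrite (le_trans (ltW a0))// ltW.
have v0 : Num.min (phi1 a) (phi1 b) <= 0 <= Num.max (phi1 a) (phi1 b).
  by rewrite min_l// max_r// (ltW a0) (ltW b0).
have [c] := IVT ab cphi1 v0.
rewrite in_itv /= => /andP[ac cb] c0.
rewrite (@Rintegral_itv_split _ _ _ _ c)//; last exact: integrable_cos_phase.
rewrite (_ : 2 * _ = (h + 2 / (rho * h)) + (h + 2 / (rho * h))); last by ring.
apply: lerD.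
  by apply: vdc_left => //; rewrite ?c0// (le_trans cb).
by apply: vdc_right => //; rewrite ?c0// (le_trans la).
Qed.

End van_der_corput.

(** * Oscillatory integrals of power phases over one octave *)

Section power_phase.
Variable R : realType.
Variable m : R.
Hypothesis m1 : 1 < m.
Local Notation leb := (@lebesgue_measure R).

(** The shift [theta] is free: adding pi changes the sign of the cosine, and pi / 2 turns it into a
    sine, so bounds uniform in [theta] are two-sided and cover both. *)
Definition power_phase (theta D tau xi : R) := theta + D * xi + tau * xi `^ m.

Let phi1 (D tau xi : R) := D + tau * (m * xi `^ (m - 1)).
Let phi2 (tau xi : R) := tau * (m * ((m - 1) * xi `^ (m - 2))).

Let m0 : 0 < m. Proof. exact: lt_trans m1. Qed.

Lemma is_derive_power_phase (theta D tau xi : R) : 0 < xi ->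
  is_derive xi 1 (power_phase theta D tau) (D + tau * (m * xi `^ (m - 1))).
Proof.
move=> xi0.
have d1 : is_derive xi 1 (cst theta + D \*: id) (0 + D *: 1) by exact: is_deriveD.
have d2 := is_deriveZ tau (is_derive1_powR m xi0).
apply: (@is_derive_eq _ _ _ (power_phase theta D tau) _ _ _ _ (is_deriveD d1 d2)).
by rewrite /GRing.scale /= add0r mulr1.
Qed.

Let dphi (theta D tau xi : R) : 0 < xi ->
  is_derive xi 1 (power_phase theta D tau) (phi1 D tau xi).
Proof. exact: is_derive_power_phase. Qed.

Let dphi1 (D tau xi : R) : 0 < xi ->
  is_derive xi 1 (phi1 D tau) (phi2 tau xi).
Proof.
move=> xi0.
have d2 := is_deriveZ tau (is_deriveZ m (is_derive1_powR (m - 1) xi0)).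
apply: (@is_derive_eq _ _ _ (phi1 D tau) _ _ _ _ (is_deriveD (is_derive_cst D xi 1) d2)).
by rewrite /phi2 /GRing.scale /= add0r (_ : m - 1 - 1 = m - 2)//; ring.
Qed.

Let cphi2 (tau xi : R) : 0 < xi -> {for xi, continuous (phi2 tau)}.
Proof.
move=> xi0; have d2 := is_deriveZ tau (is_deriveZ m (is_deriveZ (m - 1) (is_derive1_powR (m - 2) xi0))).
exact: is_derive_continuous d2.
Qed.

Let phi2_ge0 (tau xi : R) : 0 <= tau -> 0 <= phi2 tau xi.
Proof.
move=> t0; rewrite mulr_ge0// mulr_ge0 ?(le_trans ler01 (ltW m1))//.
by rewrite mulr_ge0 ?powR_ge0// subr_ge0 ltW.
Qed.

(** Bounding xi^m and xi^2 separately in their quotient covers both signs of m - 2. *)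
Let powRm2 (lambda xi : R) : 0 < lambda -> lambda <= xi <= 2 * lambda ->
  lambda `^ m / (4 * lambda ^+ 2) <= xi `^ (m - 2).
Proof.
move=> l0 /andP[lx x2l]; have x0 : 0 < xi by exact: lt_le_trans lx.
rewrite powRB ?(gt_eqF x0) ?implybT//.
rewrite powR_mulrn ?(ltW x0)// ler_pM ?powR_ge0//.
- by rewrite invr_ge0 mulr_ge0 ?sqr_ge0.
- by apply: ge0_ler_powR; rewrite ?nnegrE ?(ltW l0) ?(ltW x0) ?(le_trans ler01 (ltW m1)).
- rewrite lef_pV2 ?posrE ?exprn_gt0 ?mulr_gt0 ?exprn_gt0//.
  rewrite (_ : 4 * _ = (2 * lambda) ^+ 2); last by ring.
  by rewrite ler_pXn2r ?nnegrE ?(ltW x0)// mulr_ge0 ?(ltW l0).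
Qed.

Let growth (D tau lambda x y : R) : 0 <= tau -> 0 < lambda ->
  lambda <= x -> x <= y -> y <= 2 * lambda ->
  tau * (m * ((m - 1) * (lambda `^ m / (4 * lambda ^+ 2)))) * (y - x) <=
    phi1 D tau y - phi1 D tau x.
Proof.
move=> t0 l0 lx; rewrite le_eqVlt => /predU1P[->|xy] y2l; first by rewrite !subrr mulr0.
have x0 : 0 < x by exact: lt_le_trans lx.
have d1 z : z \in `]x, y[ -> is_derive z 1 (phi1 D tau) (phi2 tau z).
  by rewrite in_itv /= => /andP[xz _]; apply: dphi1; exact: lt_trans xz.
have c1 : {within `[x, y], continuous (phi1 D tau)}.
  apply: continuous_itv_within => z /andP[xz _].
  by apply: is_derive_continuous; apply: dphi1; exact: lt_le_trans xz.
have [c] := MVT xy d1 c1.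
rewrite in_itv /= => /andP[xc cy] ->.
rewrite ler_pM2r ?subr_gt0// ler_wpM2l// ler_pM2l// ler_pM2l ?subr_gt0//.
by apply: powRm2 => //; rewrite (le_trans lx (ltW xc)) (le_trans (ltW cy) y2l).
Qed.

Variables (lambda a b : R).
Hypotheses (l0 : 0 < lambda) (la : lambda <= a) (ab : a <= b) (bl : b <= 2 * lambda).

Let in_pos (x : R) : lambda <= x <= 2 * lambda -> 0 < x.
Proof. by move=> /andP[lx _]; exact: lt_le_trans lx. Qed.

Let vdc2 (theta D tau : R) : 0 < tau ->
  \int[leb]_(x in `[a, b]) cos (power_phase theta D tau x) <=
    (2 + 16 / (m * (m - 1))) * (lambda / Num.sqrt (tau * lambda `^ m)).
Proof.
have m1' := m1; have ab' := ab; have bl' := bl; have la' := la.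
move=> t0; set X := tau * _; have X0 : 0 < X by rewrite mulr_gt0// powR_gt0.
have S0 : 0 < Num.sqrt X by rewrite sqrtr_gt0.
have mm : 0 < m * (m - 1) by rewrite mulr_gt0//; lra.
set rho := tau * (m * ((m - 1) * (lambda `^ m / (4 * lambda ^+ 2)))).
have rho0 : 0 < rho.
  rewrite !mulr_gt0 ?powR_gt0 ?invr_gt0 ?mulr_gt0 ?exprn_gt0//; lra.
(* This [h] balances the two terms of [van_der_corput2], because [rho * lambda ^+ 2] equals X m (m -
   1) / 4; the constant 2 + 16 / (m (m - 1)) comes out of this choice. *)
have h0 : 0 < lambda / Num.sqrt X by rewrite divr_gt0.
apply: (le_trans (@van_der_corput2 _ (power_phase theta D tau) (phi1 D tau) (phi2 tau)
  lambda (2 * lambda) _ _ _ _ rho rho0 _ (lambda / Num.sqrt X) a b h0 la ab bl)).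
- by move=> x /in_pos; exact: dphi.
- by move=> x /in_pos; exact: dphi1.
- by move=> x /in_pos; exact: cphi2.
- by move=> x _; apply: phi2_ge0; exact: ltW.
- by move=> x y; apply: growth => //; exact: ltW.
rewrite le_eqVlt; apply/orP; left; apply/eqP.
have -> : rho = X * (m * (m - 1)) / (4 * lambda ^+ 2).
  by rewrite /rho /X; field; rewrite gt_eqF.
rewrite -(sqr_sqrtr (ltW X0)) -/X; move: (Num.sqrt X) S0 => S S0.
rewrite sqrtr_sqr gtr0_norm//; field.
by rewrite !gt_eqF//; lra.
Qed.

(** The derivative of the power term stays below half of |D|, so [phi1] keeps the sign of [D] and
    has size at least |D| / 2: there is no stationary point. *)
Let vdc1 (theta D tau : R) : 0 <= tau -> 0 < `|D| ->
  2 * (m * (2 * lambda) `^ (m - 1) * tau) <= `|D| ->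
  \int[leb]_(x in `[a, b]) cos (power_phase theta D tau x) <= 4 / `|D|.
Proof.
have m1' := m1; have ab' := ab; have bl' := bl; have la' := la.
move=> t0 D0 tD.
have bnd x : a <= x <= b -> 0 <= tau * (m * x `^ (m - 1)) <= `|D| / 2.
  move=> /andP[ax xb]; have x0 : 0 < x by rewrite (lt_le_trans l0)// (le_trans la).
  rewrite mulr_ge0 ?mulr_ge0 ?powR_ge0//=; last by lra.
  apply: (@le_trans _ _ (tau * (m * (2 * lambda) `^ (m - 1)))); last by lra.
  rewrite ler_wpM2l// ler_wpM2l//; first by lra.
  apply: ge0_ler_powR; rewrite ?nnegrE ?(ltW x0)//; first by lra.
    by rewrite mulr_ge0 ?(ltW l0).
  exact: (le_trans xb).
have -> : 4 / `|D| = 2 / (`|D| / 2) by field; rewrite gt_eqF.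
apply: (@van_der_corput1 _ (power_phase theta D tau) (phi1 D tau) (phi2 tau)
  lambda (2 * lambda)) => //.
- by move=> x /in_pos; exact: dphi.
- by move=> x /in_pos; exact: dphi1.
- by move=> x /in_pos; exact: cphi2.
- by move=> x _; exact: phi2_ge0.
- by rewrite divr_gt0.
have [Dp|Dn] := leP 0 D.
  by left => x /bnd; rewrite /phi1 (ger0_norm Dp) => /andP[? ?]; lra.
by right => x /bnd; rewrite /phi1 (ltr0_norm Dn) => /andP[? ?]; lra.
Qed.

Lemma integrable_power_phase (theta D tau : R) :
  leb.-integrable `[a, b] (fun x => (cos (power_phase theta D tau x))%:E).
Proof.
apply: (continuous_itv_integrable (f := cos \o power_phase theta D tau)).
move=> x /andP[ax xb]; apply: continuous_comp; last exact: continuous_cos.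
apply: is_derive_continuous; apply: dphi; rewrite (lt_le_trans l0)// (le_trans la)//.
Qed.

(** Shifting the phase by pi negates the integral, so an upper bound uniform in the shift is also a
    lower bound. *)
Let two_sided (theta D tau r : R) :
  (forall theta', \int[leb]_(x in `[a, b]) cos (power_phase theta' D tau x) <= r) ->
  `|\int[leb]_(x in `[a, b]) cos (power_phase theta D tau x)| <= r.
Proof.
move=> h; rewrite ler_norml h andbT lerNl -mulN1r -RintegralZl//; last first.
  exact: integrable_power_phase.
apply: le_trans (h (theta + pi)); rewrite le_eqVlt; apply/orP; left; apply/eqP.
apply: eq_Rintegral => x _; rewrite mulN1r -cosDpi; congr cos.
by rewrite /power_phase; ring.
Qed.

(** Cosine is even; this moves a negative [tau] to a positive one, for which the second derivative
    of the phase is nonnegative as van der Corput's lemma asks. *)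
Let flip (theta D tau : R) :
  \int[leb]_(x in `[a, b]) cos (power_phase theta D tau x) =
  \int[leb]_(x in `[a, b]) cos (power_phase (- theta) (- D) (- tau) x).
Proof.
apply: eq_Rintegral => x _; rewrite -cosN; congr cos.
by rewrite /power_phase; ring.
Qed.

Lemma power_phase_le (theta D tau : R) :
  `|\int[leb]_(x in `[a, b]) cos (power_phase theta D tau x)| <= lambda.
Proof.
have m1' := m1; have ab' := ab; have bl' := bl; have la' := la.
apply: two_sided => theta'; apply: (@le_trans _ _ (1 * (b - a))); last by lra.
by apply: Rintegral_itv_le_cst => //; exact: integrable_power_phase.
Qed.

Lemma power_phase_le_sqrt (theta D tau : R) : tau != 0 ->
  `|\int[leb]_(x in `[a, b]) cos (power_phase theta D tau x)| <=
    (2 + 16 / (m * (m - 1))) * (lambda / Num.sqrt (`|tau| * lambda `^ m)).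
Proof.
move=> t0; have [tp|tn|t_0] := ltgtP 0 tau; last by rewrite -t_0 eqxx in t0.
  by apply: two_sided => theta'; rewrite gtr0_norm//; exact: vdc2.
rewrite flip; apply: two_sided => theta'; rewrite ltr0_norm//.
by apply: vdc2; rewrite oppr_gt0.
Qed.

Lemma power_phase_le_inv (theta D tau : R) : 0 < `|D| ->
  2 * (m * (2 * lambda) `^ (m - 1) * `|tau|) <= `|D| ->
  `|\int[leb]_(x in `[a, b]) cos (power_phase theta D tau x)| <= 4 / `|D|.
Proof.
move=> D0 tD; have [tp|tn] := leP 0 tau.
  by rewrite ger0_norm// in tD; apply: two_sided => theta'; exact: vdc1.
rewrite ltr0_norm// in tD.
rewrite flip; apply: two_sided => theta'; rewrite -(normrN D).
by apply: vdc1; rewrite ?normrN// oppr_ge0 ltW.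
Qed.

End power_phase.

(** * From oscillatory integrals to decay in the distance of the points *)

Section interpolation.
Variable R : realType.
Implicit Types (K c lambda Y theta : R).

(** For Y <= 1 the factor Y^-theta is at least 1 and the trivial bound suffices; for Y > 1 it
    dominates Y^(-1/2). This is where the exponents are free to move below one half. *)
Lemma interpolate_sqrt K c lambda Y theta : 0 <= lambda -> 0 < Y -> 0 <= theta <= 2^-1 ->
  1 <= c -> K <= lambda -> K <= c * (lambda / Num.sqrt Y) ->
  K <= c * (lambda * Y `^ (- theta)).
Proof.
move=> l0 Y0 /andP[th0 th1] c1 Kl KY; have c0 : 0 <= c by exact: le_trans c1.
have [Y1|Y1] := leP Y 1.
  apply: (le_trans Kl); rewrite -[leLHS]mul1r ler_pM// -[leLHS]mulr1 ler_wpM2l//.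
  rewrite -(powRr0 Y); apply: ger_powR; first by rewrite Y0.
  by rewrite oppr_le0.
apply: (le_trans KY); rewrite ler_wpM2l// ler_wpM2l//.
rewrite -powR12_sqrt ?(ltW Y0)// -powRN; apply: ler_powR; first exact: ltW.
by rewrite lerN2.
Qed.

Lemma interpolate_inv K c lambda Y : 0 <= lambda -> 0 < Y ->
  1 <= c -> K <= lambda -> K <= c * (lambda / Y) ->
  K <= c * (lambda / Num.sqrt Y).
Proof.
move=> l0 Y0 c1 Kl KY; have c0 : 0 <= c by exact: le_trans c1.
have S0 : 0 < Num.sqrt Y by rewrite sqrtr_gt0.
have [Y1|Y1] := leP Y 1.
  apply: (le_trans Kl); rewrite -[leLHS]mul1r ler_pM// -[leLHS]mulr1 ler_wpM2l//.
  by rewrite invf_ge1// -sqrtr1 ler_sqrt.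
apply: (le_trans KY); rewrite ler_wpM2l// ler_wpM2l// lef_pV2 ?posrE//.
rewrite -[leRHS]sqr_sqrtr ?(ltW Y0)// expr2 -[leLHS]mul1r ler_pM2r//.
by rewrite -sqrtr1 ler_sqrt// ltW.
Qed.

End interpolation.

Section kernel_bound.
Variable R : realType.
Variables (m kappa C1 C2 cm : R).
Hypotheses (m1 : 1 < m) (kappa0 : 0 < kappa) (C10 : 0 < C1) (C20 : 0 < C2) (cm0 : 0 < cm).

(** One summand per case of the kernel bound: the trivial estimate, the first derivative test, the
    second derivative test near a stationary point while [D] dominates, and the second derivative
    test when the difference of times dominates. *)
Definition kernel_cst : R :=
  1 + 8 * C2 + cm * Num.sqrt (4 * C2 * m * 2 `^ (m - 1)) +
  cm * Num.sqrt ((2 * C1 * C2) `^ kappa^-1).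

Lemma kernel_cst_ge1 : 1 <= kernel_cst.
Proof.
rewrite /kernel_cst -!addrA lerDl !addr_ge0// ?mulr_ge0 ?sqrtr_ge0//; exact: ltW.
Qed.

Variables (lambda tau D u K theta theta' : R).
Hypotheses (l0 : 0 < lambda) (u0 : 0 < u)
  (hth : 0 <= theta <= 2^-1) (hth' : 0 <= theta' <= 2^-1)
  (K0 : 0 <= K) (K1 : K <= lambda)
  (K2 : tau != 0 -> K <= cm * (lambda / Num.sqrt (`|tau| * lambda `^ m)))
  (K3 : 0 < `|D| -> 2 * (m * (2 * lambda) `^ (m - 1) * `|tau|) <= `|D| ->
    K <= 4 / `|D|)
  (hD : u / C2 - C1 * `|tau| `^ kappa <= `|D|).

Let m0 : 0 < m. Proof. exact: lt_trans m1. Qed.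

Let from_sqrt Y d : tau != 0 -> 0 < Y -> 0 < d -> Y <= d * (`|tau| * lambda `^ m) ->
  K <= cm * Num.sqrt d * (lambda / Num.sqrt Y).
Proof.
move=> t0 Y0 d0 Yd; apply: (le_trans (K2 t0)).
have X0 : 0 < `|tau| * lambda `^ m by rewrite mulr_gt0 ?normr_gt0 ?powR_gt0.
rewrite -mulrA ler_pM2l// mulrCA ler_pM2l// ler_pdivlMr ?sqrtr_gt0// mulrC.
rewrite -[leRHS]mulr1 -ler_pdivlMr ?invr_gt0 ?sqrtr_gt0// mulr1 invrK.
by rewrite -sqrtrM ?(ltW d0)//; exact: ler_wsqrtr.
Qed.

(** Even when |D| is comparable to [u] the phase can be stationary, namely if |tau| lambda^(m - 1)
    is not small against |D|. In that case |tau| lambda^m is at least a multiple of [lambda * u],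
    and the second derivative test gives the rate (lambda u)^(-1/2) instead of (lambda u)^-1; this
    is what limits [theta] to one half. *)
Lemma kernel_bound :
  K <= kernel_cst * (lambda `^ (1 - theta) * u `^ (- theta)) \/
  K <= kernel_cst * (lambda `^ (1 - m * theta') * u `^ (- (theta' / kappa))).
Proof.
have s1 : 0 <= cm * Num.sqrt (4 * C2 * m * 2 `^ (m - 1)).
  by rewrite mulr_ge0 ?sqrtr_ge0// ltW.
have s2 : 0 <= cm * Num.sqrt ((2 * C1 * C2) `^ kappa^-1).
  by rewrite mulr_ge0 ?sqrtr_ge0// ltW.
have C2' := C20.
have lu0 : 0 < lambda * u by rewrite mulr_gt0.
have wide c Y : 0 < Y -> c <= kernel_cst ->
    K <= c * (lambda / Num.sqrt Y) -> K <= kernel_cst * (lambda / Num.sqrt Y).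
  move=> Y0 ck h; by apply: (le_trans h); rewrite ler_wpM2r// divr_ge0 ?(ltW l0) ?sqrtr_ge0.
(* The threshold is such that in the second case the Hoelder term in [hD] is at most half of
   [u / C2], whence |D| is at least [u / (2 * C2)]. *)
have [uB|uA] := ltP u (2 * C1 * C2 * `|tau| `^ kappa).
  right; have t0 : tau != 0.
    apply: contraTneq uB => ->; rewrite normr0 powR0 ?mulr0 ?gt_eqF//.
    by rewrite -leNgt ltW.
  have Z0 : 0 < lambda `^ m * u `^ kappa^-1 by rewrite mulr_gt0 ?powR_gt0.
  have -> : lambda `^ (1 - m * theta') * u `^ (- (theta' / kappa)) =
      lambda * (lambda `^ m * u `^ kappa^-1) `^ (- theta').
    rewrite powRM ?powR_ge0// -!powRrM powRD ?(gt_eqF l0) ?implybT//.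
    by rewrite powRr1 ?(ltW l0)// -mulrA !mulrN (mulrC theta').
  apply: interpolate_sqrt => //; [exact: ltW|exact: kernel_cst_ge1|].
  apply: (wide (cm * Num.sqrt ((2 * C1 * C2) `^ kappa^-1))) => //.
    by rewrite /kernel_cst; lra.
  apply: from_sqrt => //; first by rewrite powR_gt0// !mulr_gt0.
  rewrite mulrC mulrA ler_pM2r ?powR_gt0//.
  have -> : `|tau| = (`|tau| `^ kappa) `^ kappa^-1.
    by rewrite -powRrM mulfV ?gt_eqF// powRr1.
  rewrite -powRM ?powR_ge0//; last by rewrite !mulr_ge0// ltW.
  apply: ge0_ler_powR; rewrite ?nnegrE ?(ltW u0) ?invr_ge0 ?(ltW kappa0) ?(ltW uB)//.
  by rewrite !mulr_ge0 ?powR_ge0// ltW.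
left.
have D1 : u / (2 * C2) <= `|D|.
  apply: le_trans hD.
  have -> : u / C2 - C1 * `|tau| `^ kappa =
     u / (2 * C2) + (u - 2 * C1 * C2 * `|tau| `^ kappa) / (2 * C2).
    by field; rewrite gt_eqF.
  by rewrite lerDl divr_ge0 ?subr_ge0// mulr_ge0// ltW.
have uC : 0 < u / (2 * C2) by rewrite divr_gt0// mulr_gt0.
have D0 : 0 < `|D| by exact: lt_le_trans D1.
have -> : lambda `^ (1 - theta) * u `^ (- theta) = lambda * (lambda * u) `^ (- theta).
  rewrite powRM ?(ltW l0) ?(ltW u0)// powRD ?(gt_eqF l0) ?implybT//.
  by rewrite powRr1 ?(ltW l0)// mulrA.
apply: interpolate_sqrt => //; [exact: ltW|exact: kernel_cst_ge1|].
have [t1|t2] := leP (2 * (m * (2 * lambda) `^ (m - 1) * `|tau|)) `|D|.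
  apply: interpolate_inv => //; [exact: ltW|exact: kernel_cst_ge1|].
  apply: (le_trans (K3 D0 t1)).
  apply: (@le_trans _ _ (4 / (u / (2 * C2)))).
    by rewrite ler_pM2l// lef_pV2.
  have -> : lambda / (lambda * u) = u^-1 by field; rewrite !gt_eqF.
  have -> : 4 / (u / (2 * C2)) = 8 * C2 * u^-1 by field; rewrite !gt_eqF.
  by rewrite ler_pM2r ?invr_gt0// /kernel_cst; lra.
have P0 : 0 < (2 : R) `^ (m - 1) by rewrite powR_gt0.
have t0 : tau != 0.
  by apply: contraTneq t2 => ->; rewrite normr0 !mulr0 -leNgt.
apply: (wide (cm * Num.sqrt (4 * C2 * m * 2 `^ (m - 1)))) => //.
  by rewrite /kernel_cst; lra.
apply: from_sqrt => //; first by rewrite !mulr_gt0.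
have e : lambda `^ m = lambda * lambda `^ (m - 1).
  rewrite -{2}(powRr1 (ltW l0)) -powRD ?(gt_eqF l0) ?implybT//.
  by rewrite addrC subrK.
rewrite powRM ?(ltW l0)// in t2; rewrite e.
have h : u <= 2 * C2 * `|D| by rewrite -ler_pdivrMl ?mulr_gt0// mulrC.
have -> : 4 * C2 * m * 2 `^ (m - 1) * (`|tau| * (lambda * lambda `^ (m - 1))) =
   lambda * (2 * C2 * (2 * (m * (2 `^ (m - 1) * lambda `^ (m - 1)) * `|tau|))) by ring.
rewrite ler_pM2l//; apply: (le_trans h).
by rewrite ler_pM2l ?mulr_gt0// ltW.
Qed.

End kernel_bound.

(** * A bounded dyadic substitute for the singular weight |u|^-beta *)

Section dyadic_weight.
Variable R : realType.
Implicit Types (beta u X : R).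

(** A sum of indicators of balls of radius 2^(1 - j) with heights 2^(beta j). It is comparable to
    |u|^-beta down to the scale 2^-J, where it is capped, so it remains bounded and measurable. *)
Definition dyadic_weight beta (J : nat) u : R :=
  \sum_(j < J.+1) (2 `^ beta) ^+ j * (`|u| <= 2 * 2^-1 ^+ j)%R%:R.

Lemma dyadic_weight_ge0 beta J u : 0 <= dyadic_weight beta J u.
Proof. by apply: sumr_ge0 => j _; rewrite mulr_ge0 ?exprn_ge0 ?powR_ge0. Qed.

(** Either [u] lies in the smallest ball and the last term alone reaches the cap, or |u| > 2^-J
    after removing that ball, and then |u|^-beta is below the cap of the next coarser weight. The
    cap is the only information at u = 0. *)
Lemma dyadic_weight_ge beta J u X : 0 <= beta -> `|u| <= 2 ->
  (u != 0 -> X <= `|u| `^ (- beta)) -> X <= (2 `^ beta) ^+ J ->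
  X <= dyadic_weight beta J u.
Proof.
move=> b0 u2 hX; elim: J => [|J ih] XJ; rewrite /dyadic_weight.
  by rewrite big_ord_recl big_ord0 expr0 mulr1 u2 mulr1 addr0.
rewrite big_ord_recr/=; have [uJ|uJ] := leP `|u| (2 * 2^-1 ^+ J.+1).
  rewrite mulr1 (le_trans XJ)// lerDr.
  exact: dyadic_weight_ge0.
rewrite mulr0 addr0; apply: ih.
have u0 : u != 0.
  by rewrite -normr_gt0 (le_lt_trans _ uJ)// mulr_ge0// exprn_ge0// invr_ge0.
apply: (le_trans (hX u0)).
have h : 2^-1 ^+ J < `|u| by move: uJ; rewrite exprS mulrA mulfV// mul1r.
have p0 : 0 < (2 : R)^-1 ^+ J by rewrite exprn_gt0// invr_gt0.
have e2 : (2^-1 : R) `^ beta = (2 `^ beta)^-1.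
  by rewrite -[2^-1]powR_inv1// -powRrM mulN1r powRN.
have <- : (2^-1 ^+ J) `^ (- beta) = (2 `^ beta) ^+ J.
  rewrite powRN -[2^-1 ^+ J]powR_mulrn ?invr_ge0// -powRrM mulrC powRrM e2.
  by rewrite powR_mulrn ?invr_ge0 ?powR_ge0// exprVn invrK.
rewrite !powRN lef_pV2 ?posrE ?powR_gt0 ?normr_gt0//.
by apply: ge0_ler_powR; rewrite ?nnegrE ?(ltW h) ?(ltW p0).
Qed.

Lemma dyadic_weightN beta J u : dyadic_weight beta J (- u) = dyadic_weight beta J u.
Proof. by rewrite /dyadic_weight normrN. Qed.

End dyadic_weight.

Section dyadic_weight_integral.
Variables (R : realType) (alpha c : R) (m : {finite_measure set (measurableTypeR R) -> \bar R}).
Hypotheses (alpha0 : 0 < alpha) (c0 : 0 <= c)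
  (mball : forall x r : R, 0 < r -> (m (ball x r) <= (c * r `^ alpha)%:E)%E).

Lemma bounded_measurable_norm_le (r : R) :
  bounded_measurable (fun u : measurableTypeR R => (`|u| <= r)%R%:R : R).
Proof.
rewrite (_ : (fun u => _) = \1_(`[- r, r]%classic : set (measurableTypeR R))); last first.
  by apply/funext => u; rewrite indicE; congr (nat_of_bool _)%:R; rewrite mem_setE in_itv /= ler_norml.
split; first by apply: measurable_indic; exact: measurable_itv.
by exists 1 => x; rewrite indicE; case: (_ \in _); rewrite ?normr1 ?normr0.
Qed.

Lemma bounded_measurable_sum d (T : measurableType d) (n : nat) (f : 'I_n -> T -> R) :
  (forall i, bounded_measurable (f i)) -> bounded_measurable (fun x => \sum_(i < n) f i x).
Proof.
elim: n f => [|n ih] f bf.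
  rewrite (_ : (fun x => _) = fun=> 0); first exact: bounded_measurable_cst.
  by apply/funext => x; rewrite big_ord0.
rewrite (_ : (fun x => _) = (fun x => \sum_(i < n) f (widen_ord (leqnSn n) i) x + f ord_max x)).
  by apply: bounded_measurableD => //; exact: ih.
by apply/funext => x; rewrite big_ord_recr.
Qed.

Lemma bounded_measurable_dyadic_weight (beta : R) J :
  bounded_measurable (fun u : measurableTypeR R => dyadic_weight beta J u).
Proof.
apply: bounded_measurable_sum => i; apply: bounded_measurableM.
  exact: bounded_measurable_cst.
exact: bounded_measurable_norm_le.
Qed.

Let Rintegral_norm_le_cst (x r : R) : 0 < r ->
  \int[m]_y (`|x - y| <= r)%R%:R <= c * (2 * r) `^ alpha.
Proof.
move=> r0.
have mI : measurable (`[x - r, x + r]%classic : set (measurableTypeR R)) by exact: measurable_itv.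
have -> : (\int[m]_y (`|x - y| <= r)%R%:R) =
    \int[m]_y (\1_(`[x - r, x + r]%classic : set (measurableTypeR R)) y).
  apply: eq_Rintegral => y _; rewrite indicE; congr (nat_of_bool _)%:R.
  rewrite mem_setE in_itv /= ler_norml; apply/idP/idP => /andP[? ?]; apply/andP; split; lra.
rewrite /Rintegral integral_indic// setIT.
rewrite -lee_fin fineK ?fin_num_measure//.
apply: (le_trans _ (mball x (r := 2 * r) _)); last by rewrite mulr_gt0.
apply: le_measure; rewrite ?inE//.
  exact: measurable_ball.
move=> y /=; rewrite in_itv /= => /andP[h1 h2]; rewrite /ball /= ltr_norml.
by apply/andP; split; lra.
Qed.

(** A closed ball of radius 2^(1 - j) sits in the open ball of twice the radius, of mass at most c
    4^alpha 2^(-alpha j). Against the height 2^(beta j) this is a geometric series of ratio 2^(beta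
    - alpha) < 1, so the bound does not depend on [J]. *)
Lemma dyadic_weight_integral (beta : R) J x : 0 <= beta < alpha ->
  \int[m]_y dyadic_weight beta J (x - y) <= c * 4 `^ alpha / (1 - 2 `^ (beta - alpha)).
Proof.
move=> /andP[b0 ba].
set rho := 2 `^ (beta - alpha).
have rho0 : 0 < rho by rewrite powR_gt0.
have rho1 : rho < 1.
  rewrite -(powRr0 2) /rho /powR (gt_eqF (ltr0n _ 2)) ltr_expR ltr_pM2r ?ltr_ln ?ln_gt0 ?ltr1n//.
  by rewrite subr_lt0.
have c4 : 0 <= c * 4 `^ alpha by rewrite mulr_ge0// powR_ge0.
have rho1' : 0 < 1 - rho by rewrite subr_gt0.
(* The exact partial geometric sum is kept so that the induction on [J] closes. *)
apply: (@le_trans _ _ (c * 4 `^ alpha * ((1 - rho ^+ J.+1) / (1 - rho)))); last first.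
  rewrite ler_wpM2l// ler_pdivrMr// mulVf ?gt_eqF// gerBl exprn_ge0//; exact: ltW.
have mB : measurable_fun [set: measurableTypeR R] (fun y : measurableTypeR R => x - y : measurableTypeR R).
  exact: measurable_funB.
have term j : \int[m]_y ((2 `^ beta) ^+ j * (`|x - y| <= 2 * 2^-1 ^+ j)%R%:R) <=
    c * 4 `^ alpha * rho ^+ j.
  rewrite RintegralZl//; last first.
    apply: bounded_measurable_integrable.
    exact: (@bounded_measurable_comp _ _ _ (measurableTypeR R) _
      (fun u => (`|u| <= 2 * 2^-1 ^+ j)%R%:R) _ (bounded_measurable_norm_le _) mB).
  have p0 : 0 < 2 * (2 : R)^-1 ^+ j by rewrite mulr_gt0// exprn_gt0// invr_gt0.
  apply: (@le_trans _ _ ((2 `^ beta) ^+ j * (c * (2 * (2 * 2^-1 ^+ j)) `^ alpha))).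
    by rewrite ler_wpM2l ?exprn_ge0 ?powR_ge0//; exact: Rintegral_norm_le_cst.
  have -> : 2 * (2 * (2 : R)^-1 ^+ j) = 4 * 2^-1 ^+ j by ring.
  rewrite powRM ?exprn_ge0 ?invr_ge0//.
  rewrite le_eqVlt; apply/orP; left; apply/eqP.
  have -> : (2^-1 ^+ j) `^ alpha = (2 `^ (- alpha)) ^+ j.
    have e : (2^-1 : R) `^ alpha = 2 `^ (- alpha).
      by rewrite -[2^-1]powR_inv1// -powRrM mulN1r.
    rewrite -[2^-1 ^+ j]powR_mulrn ?invr_ge0// -powRrM mulrC powRrM e.
    by rewrite powR_mulrn ?powR_ge0.
  rewrite /rho powRD; last by rewrite pnatr_eq0 implybT.
  by rewrite exprMn; ring.
elim: J => [|J ih].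
  rewrite expr1 mulfV ?gt_eqF// mulr1.
  rewrite -[leRHS]mulr1 -(expr0 rho); apply: le_trans (term 0%N).
  rewrite le_eqVlt; apply/orP; left; apply/eqP; apply: eq_Rintegral => y _.
  by rewrite /dyadic_weight big_ord_recl big_ord0 addr0.
have -> : \int[m]_y dyadic_weight beta J.+1 (x - y) =
   \int[m]_y (dyadic_weight beta J (x - y) +
     (2 `^ beta) ^+ J.+1 * (`|x - y| <= 2 * 2^-1 ^+ J.+1)%R%:R).
  by apply: eq_Rintegral => y _; rewrite /dyadic_weight big_ord_recr.
rewrite RintegralD//.
- apply: (le_trans (lerD ih (term J.+1))).
  rewrite le_eqVlt; apply/orP; left; apply/eqP.
  by rewrite [in RHS]exprS; field; rewrite gt_eqF.
- apply: (bounded_measurable_integrable m (f := fun y => dyadic_weight beta J (x - y))).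
  exact: (@bounded_measurable_comp _ _ _ (measurableTypeR R) _
    (dyadic_weight beta J) _ (bounded_measurable_dyadic_weight _ _) mB).
- apply: (bounded_measurable_integrable m (f := fun y => (2 `^ beta) ^+ J.+1 * (`|x - y| <= 2 * 2^-1 ^+ J.+1)%R%:R)).
  apply: bounded_measurableM; first exact: bounded_measurable_cst.
  exact: (@bounded_measurable_comp _ _ _ (measurableTypeR R) _
    (fun u => (`|u| <= 2 * 2^-1 ^+ J.+1)%R%:R) _ (bounded_measurable_norm_le _) mB).
Qed.

End dyadic_weight_integral.

(** * Symmetric frequency annuli *)

Section annulus.
Variables (R : realType) (m : R).
Hypothesis m1 : 1 < m.
Local Notation leb := (@lebesgue_measure R).

(** The strict inequality on the left makes consecutive annuli disjoint, and [a = -1] gives a full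
    closed ball. *)
Definition annulus (a b xi : R) : R := ((a < `|xi|) && (`|xi| <= b))%:R.

Definition full_phase (theta D tau xi : R) := theta + D * xi + tau * `|xi| `^ m.

Lemma measurable_annulus a b : measurable_fun setT (annulus a b).
Proof.
rewrite (_ : annulus a b = \1_((fun u : R => `|u|) @^-1` `]a, b]%classic)); last first.
  apply/funext => u; rewrite indicE; congr (nat_of_bool _)%:R.
  by apply/idP/idP => [h|/set_mem /=]; [apply/mem_set; rewrite /= in_itv|rewrite in_itv].
apply: measurable_indic; rewrite -[X in measurable X]setTI.
by apply: (@normr_measurable R setT) => //; exact: measurable_itv.
Qed.

Lemma annulus01 a b xi : 0 <= annulus a b xi <= 1.
Proof. by rewrite /annulus ler0n lern1 leq_b1. Qed.

Lemma measurable_full_phase theta D tau : measurable_fun setT (full_phase theta D tau).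
Proof.
apply: measurable_funD; first exact: measurable_funD.
apply: measurable_funM => //; apply: (measurableT_comp (measurable_powR m)).
exact: normr_measurable.
Qed.

(** The reflection of xi fixes |xi|^m and flips the sign of [D], so both halves of the annulus
    become one-sided integrals of [power_phase]. *)
Lemma annulus_integral theta D tau a b L : 0 < a -> a <= b -> b <= L ->
  \int[leb]_(xi in `[- L, L]) (annulus a b xi * cos (full_phase theta D tau xi)) =
  \int[leb]_(xi in `[a, b]) cos (power_phase m theta D tau xi) +
  \int[leb]_(xi in `[a, b]) cos (power_phase m theta (- D) tau xi).
Proof.
move=> a0 ab bL; have b0 : 0 < b by exact: lt_le_trans ab.
have eN z : z < 0 -> cos (power_phase m theta (- D) tau (- z)) = cos (full_phase theta D tau z).
  by move=> z0; rewrite /full_phase /power_phase ltr0_norm// mulrNN.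
have Ufin : (leb ([set` `[(- b)%R, (- a)%R[] `|` [set` `]a, b]]) < +oo)%E.
  apply: (@le_lt_trans _ _ (leb `[(- b)%R, b])).
    apply: le_measure; rewrite ?inE//=; first exact: measurableU.
    by move=> xi /= [] /=; rewrite !in_itv /= => /andP[? ?]; apply/andP; split; lra.
  by rewrite lebesgue_measure_itv /=; case: ifP => _; rewrite ltry.
have disj : [disjoint `[- b, - a[%classic & `]a, b]%classic].
  rewrite disj_set2E; apply/eqP; rewrite -subset0 => xi [] /=.
  by rewrite !in_itv /= => /andP[? ?] /andP[? ?]; lra.
have mcos : measurable_fun setT (fun xi => cos (full_phase theta D tau xi)).
  apply: (@measurableT_comp _ _ _ _ _ _ (@cos R)); last exact: measurable_full_phase.
  by apply: continuous_measurable_fun; exact: continuous_cos.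
have bcos (A : set R) : measurable A -> (leb A < +oo)%E ->
    leb.-integrable A (fun xi => (cos (full_phase theta D tau xi))%:E).
  move=> mA Afin; apply: (@measurable_bounded_integrable _ _ _ leb
    (fun xi => cos (full_phase theta D tau xi))) => //.
    exact: measurable_funTS.
  exists 1; split => // x x1 y _; apply: le_trans (ltW x1).
  by rewrite ler_norml cos_geN1 cos_le1.
have -> : \int[leb]_(xi in `[- L, L]) (annulus a b xi * cos (full_phase theta D tau xi)) =
    \int[leb]_(xi in `[- b, - a[ `|` `]a, b]) cos (full_phase theta D tau xi).
  rewrite Rintegral_mkcond [in RHS]Rintegral_mkcond; apply: eq_Rintegral => xi _.
  rewrite /patch /annulus !mem_setE /=.
  have -> : (xi \in [set` `[(- b), (- a)[] `|` [set` `]a, b]]) =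
      (a < `|xi|) && (`|xi| <= b).
    apply/idP/idP.
      rewrite inE /= !in_itv /= => -[] /andP[h1 h2].
        by rewrite ltr0_norm ?(lt_trans h2) ?oppr_lt0//; apply/andP; split; lra.
      by rewrite gtr0_norm ?(lt_trans a0)// h1 h2.
    rewrite inE /= !in_itv /= => /andP[h1 h2]; have [x0|x0] := leP 0 xi.
      by right; rewrite -(ger0_norm x0) h1 h2.
    by left; rewrite ltr0_norm// in h1 h2; apply/andP; split; lra.
  case: ifPn => [|xiL]; first by case: ifPn; rewrite ?mul1r ?mul0r.
  rewrite ifN//; apply: contra xiL => /andP[_ xb]; rewrite in_itv /= -ler_norml.
  exact: le_trans bL.
have fin (u v : bool) : (leb [set` Interval (BSide u a) (BSide v b)] < +oo)%E.
  by rewrite lebesgue_measure_itv /=; case: ifP => _; rewrite ltry.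
have finN (u v : bool) : (leb [set` Interval (BSide u (- b)%R) (BSide v (- a)%R)] < +oo)%E.
  by rewrite lebesgue_measure_itv /=; case: ifP => _; rewrite ltry.
have pos : \int[leb]_(xi in `]a, b]) cos (full_phase theta D tau xi) =
    \int[leb]_(xi in `[a, b]) cos (power_phase m theta D tau xi).
  rewrite Rintegral_itv_obnd_cbnd; last by apply: bcos; [exact: measurable_itv|exact: fin].
  apply: eq_Rintegral => xi; rewrite inE /= in_itv /= => /andP[axi _].
  by rewrite /full_phase /power_phase ger0_norm// (le_trans (ltW a0)).
have neg : \int[leb]_(xi in `[- b, - a[) cos (full_phase theta D tau xi) =
    \int[leb]_(xi in `[a, b]) cos (power_phase m theta (- D) tau xi).
  rewrite Rintegral_itv_bndo_bndc; last by apply: bcos; [exact: measurable_itv|exact: finN].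
  rewrite /Rintegral; congr fine; rewrite integration_by_substitution_oppr.
  - apply: eq_integral => xi; rewrite inE /= in_itv /= => /andP[axi _].
    congr (cos _)%:E; rewrite /full_phase /power_phase normrN ger0_norm; last exact: le_trans (ltW a0) axi.
    by rewrite mulrN mulNr.
  - exact: ab.
  - apply: continuous_itv_within => xi /andP[h1 h2].
    have xi0 : 0 < - xi by rewrite oppr_gt0 (le_lt_trans h2)// oppr_lt0.
    have cN : {for xi, continuous (fun z => cos (power_phase m theta (- D) tau (- z)))}.
      apply: (@continuous_comp _ _ _ (fun z => power_phase m theta (- D) tau (- z)) (@cos R)).
        apply: (@continuous_comp _ _ _ -%R (power_phase m theta (- D) tau)).
          exact: opp_continuous.
        exact: is_derive_continuous (@is_derive_power_phase _ m theta (- D) tau (- xi) xi0).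
      exact: continuous_cos.
    rewrite /prop_for /continuous_at -eN; last by rewrite -oppr_gt0.
    apply: cvg_trans cN; apply: near_eq_cvg; near=> z; apply: eN.
    by near: z; apply: lt_nbhsl; rewrite -oppr_gt0.
rewrite Rintegral_setU.
- rewrite pos neg; exact: addrC.
- exact: measurable_itv.
- exact: measurable_itv.
- by apply: bcos; [apply: measurableU; exact: measurable_itv|exact: Ufin].
- exact: disj.
Unshelve. all: by end_near.
Qed.

End annulus.

(** * Restriction to sets of finite measure *)

Section restricted_measure.
Context d (T : measurableType d) (R : realType).
Variables (mu : {measure set T -> \bar R}) (D : set T) (mD : measurable D)
  (Doo : (mu D < +oo)%E).

Lemma integral_mfrestr (f : T -> \bar R) : measurable_fun setT f ->
  (\int[mfrestr mD Doo]_x f x = \int[mu]_(x in D) f x)%E.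
Proof.
have ge0 (h : T -> \bar R) : measurable_fun setT h -> (forall x, 0 <= h x)%E ->
    (\int[mfrestr mD Doo]_x h x = \int[mu]_(x in D) h x)%E.
  move=> mh h0; rewrite -(setUv D) ge0_integral_setU//=; last 3 first.
  - exact: measurableC.
  - by rewrite setUv.
  - exact/disj_setPCl.
  rewrite [X in (_ + X)%E]null_set_integral ?adde0//.
  - apply: eq_measure_integral => A mA AD.
    by rewrite /= /mfrestr /mrestr setIidl.
  - exact: measurableC.
  - exact: measurable_funTS.
  - by rewrite /= /mfrestr /mrestr setICl measure0.
move=> mf; rewrite [LHS]integralE [RHS]integralE ge0//; last exact: measurable_funepos.
by rewrite ge0//; exact: measurable_funeneg.
Qed.

Lemma Rintegral_mfrestr (f : T -> R) : measurable_fun setT f ->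
  \int[mfrestr mD Doo]_x f x = \int[mu]_(x in D) f x.
Proof. by move=> mf; rewrite /Rintegral integral_mfrestr//; exact/measurable_EFinP. Qed.

End restricted_measure.

Section lebesgue_itv.
Variable R : realType.
Implicit Types a b : R.
Local Notation leb := (@lebesgue_measure R).

Lemma lebesgue_itv_lty a b :
  (leb (`[a, b]%classic : set (measurableTypeR R)) < +oo)%E.
Proof. by rewrite lebesgue_measure_itv /=; case: ifP => _; rewrite ltry. Qed.

Lemma measurable_segment a b : measurable (`[a, b]%classic : set (measurableTypeR R)).
Proof. exact: measurable_itv. Qed.

(** Lebesgue measure on a segment as a finite measure on the whole line, the form that the TT^*
    bound takes. *)
Definition lebesgue_itv a b : {finite_measure set (measurableTypeR R) -> \bar R} :=
  mfrestr (measurable_segment a b) (lebesgue_itv_lty a b).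

Lemma Rintegral_lebesgue_itv a b (f : R -> R) : measurable_fun setT f ->
  \int[lebesgue_itv a b]_x f x = \int[leb]_(x in `[a, b]) f x.
Proof.
move=> mf.
exact: (Rintegral_mfrestr (measurable_segment a b) (lebesgue_itv_lty a b) mf).
Qed.

Lemma integral_lebesgue_itv a b (f : R -> \bar R) : measurable_fun setT f ->
  (\int[lebesgue_itv a b]_x f x = \int[leb]_(x in `[a, b]) f x)%E.
Proof.
move=> mf.
exact: (integral_mfrestr (measurable_segment a b) (lebesgue_itv_lty a b) mf).
Qed.

Lemma integrable_lebesgue_itv a b (f : R -> \bar R) : measurable_fun setT f ->
  (lebesgue_itv a b).-integrable setT f <-> leb.-integrable `[a, b] f.
Proof.
move=> mf; split=> /integrableP[_ fi]; apply/integrableP; split => //.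
- exact: measurable_funTS.
- by move: fi; rewrite integral_lebesgue_itv//; exact: measurableT_comp.
- by rewrite integral_lebesgue_itv//; exact: measurableT_comp.
Qed.

Lemma Rintegral_lebesgue_itv_cst a b (r : R) : a <= b ->
  \int[lebesgue_itv a b]_x r = r * (b - a).
Proof.
move=> ab; rewrite Rintegral_cst//= /mfrestr /mrestr setTI lebesgue_measure_itv /= lte_fin.
by move: ab; rewrite le_eqVlt => /predU1P[->|->]//; rewrite ltxx subrr.
Qed.

End lebesgue_itv.

(** * The kernel of one dyadic piece *)

Section pieces.
Variables (R : realType) (m kappa alpha c C1 C2 theta theta' e : R).
Variable gamma : R -> R -> R.
Variable nu : {finite_measure set (measurableTypeR R) -> \bar R}.
Hypotheses (m1 : 1 < m) (kappa0 : 0 < kappa) (alpha0 : 0 < alpha) (c0 : 0 <= c)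
  (C10 : 0 < C1) (C20 : 0 < C2).
Hypothesis nu_ball : forall x r : R, 0 < r -> (nu (ball x r) <= (c * r `^ alpha)%:E)%E.
Hypothesis gamma_holder : forall x t t', `|t| <= 1 -> `|t'| <= 1 ->
  `|gamma x t - gamma x t'| <= C1 * `|t - t'| `^ kappa.
Hypothesis gamma_bilip : forall t x x', `|t| <= 1 ->
  C2^-1 * `|x - x'| <= `|gamma x t - gamma x' t| <= C2 * `|x - x'|.
Hypotheses (theta_gt0 : 0 < theta) (theta_le : theta <= 2^-1) (theta_alpha : theta < alpha)
  (theta'_gt0 : 0 < theta') (theta'_le : theta' <= 2^-1) (theta'_alpha : theta' / kappa < alpha)
  (e_ge0 : 0 <= e) (theta_e : 1 - theta <= e) (theta'_e : 1 - m * theta' <= e).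
Local Notation leb := (@lebesgue_measure R).

Definition piece_hi (k : nat) : R := 2 ^+ k.
(** The value -1 makes piece 0 the whole ball |xi| <= 1; every later piece is one octave. *)
Definition piece_lo (k : nat) : R := if k is j.+1 then 2 ^+ j else -1.

Definition piece_weight J (u : R) : R :=
  dyadic_weight theta J u + dyadic_weight (theta' / kappa) J u.

(** The factor 2 accounts for the positive and the negative half of the annulus. *)
Definition piece_cst : R := 2 * kernel_cst m kappa C1 C2 (2 + 16 / (m * (m - 1))).

(** Supplies the depth at which the cap of a dyadic weight reaches the trivial bound 2^j of the
    kernel. *)
Lemma expr2_le_powR (beta : R) j : 0 < beta -> exists J, 2 ^+ j <= (2 `^ beta) ^+ J :> R.
Proof.
move=> b0; exists (Num.Def.archi_bound (j%:R / beta)).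
have := archi_boundP (divr_ge0 (ler0n R j) (ltW b0)).
rewrite -powR_mulrn// -[leRHS]powR_mulrn ?powR_ge0// -powRrM => h.
by apply: ler_powR; rewrite ?ler1n// mulrC -ler_pdivrMr// ltW.
Qed.

Lemma dyadic_weight0 (beta u : R) : `|u| <= 2 -> 1 <= dyadic_weight beta 0 u.
Proof. by move=> u2; rewrite /dyadic_weight big_ord_recl big_ord0 expr0 mulr1 u2 mulr1 addr0. Qed.

Let m0 : 0 < m. Proof. exact: lt_trans m1. Qed.

Let cm0 : 0 < 2 + 16 / (m * (m - 1)).
Proof. by rewrite addr_gt0// divr_gt0// mulr_gt0// subr_gt0. Qed.

Let KC1 : 1 <= kernel_cst m kappa C1 C2 (2 + 16 / (m * (m - 1))).
Proof. exact: kernel_cst_ge1. Qed.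

(** As |x - y| tends to 0 the decay estimates blow up and the trivial bound [lam] takes over; [J] is
    chosen so that the cap of both weights reaches [lam]. On piece 0 the length 2 of the interval is
    enough. [J] depends on [k], which the integral of the weight does not feel. *)
Lemma piece_kernel k : exists J, forall x y t t' b theta0,
  `|x| <= 1 -> `|y| <= 1 -> `|t| <= 1 -> `|t'| <= 1 -> b <= piece_hi k ->
  `|\int[leb]_(xi in `[- piece_hi k, piece_hi k]) (annulus (piece_lo k) b xi *
      cos (full_phase m theta0 (gamma x t - gamma y t') (t - t') xi))| <=
  piece_cst * piece_hi k `^ e * piece_weight J (x - y).
Proof.
have xy2 (x y : R) : `|x| <= 1 -> `|y| <= 1 -> `|x - y| <= 2.
  move=> x1 y1; rewrite (le_trans (ler_normB _ _))// (_ : 2 = 1 + 1)//; exact: lerD.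
have hK := KC1.
set KC := kernel_cst m kappa C1 C2 (2 + 16 / (m * (m - 1))) in hK *.
case: k => [|j].
  exists 0%N => x y t t' b theta0 x1 y1 _ _ _.
  apply: (@le_trans _ _ 2); last first.
    rewrite /piece_cst -/KC /piece_hi expr0 powR1 mulr1 -[leLHS]mulr1.
    apply: ler_pM => //; first by lra.
    rewrite /piece_weight; have := dyadic_weight0 theta (xy2 _ _ x1 y1).
    by have := dyadic_weight_ge0 (theta' / kappa) 0 (x - y); lra.
  have mf : measurable_fun setT (fun xi => annulus (-1) b xi *
      cos (full_phase m theta0 (gamma x t - gamma y t') (t - t') xi)).
    apply: measurable_funM; first exact: measurable_annulus.
    apply: (@measurableT_comp _ _ _ _ _ _ (@cos R)).
      by apply: continuous_measurable_fun; exact: continuous_cos.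
    exact: measurable_full_phase.
  rewrite /piece_hi expr0 -(Rintegral_lebesgue_itv _ _ mf).
  have -> : (2 : R) = \int[lebesgue_itv (-1) 1]_xi (cst 1 xi).
    by rewrite Rintegral_lebesgue_itv_cst; lra.
  apply: Rintegral_norm_le => //.
    exact: (bounded_measurable_integrable _ (bounded_measurable_cst _ 1)).
  move=> xi; rewrite normrM -[leRHS]mulr1; apply: ler_pM => //.
    by have /andP[a0 a1] := annulus01 (-1) b xi; rewrite ger0_norm.
  by rewrite ler_norml cos_geN1 cos_le1.
set lam : R := 2 ^+ j; have l0 : 0 < lam by exact: exprn_gt0.
have hiE : piece_hi j.+1 = 2 * lam by rewrite /piece_hi exprS.
have l1 : 1 <= lam by rewrite exprn_ege1// ler1n.
have [J1 hJ1] := expr2_le_powR j theta_gt0.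
have tk0 : 0 < theta' / kappa by rewrite divr_gt0.
have [J2 hJ2] := expr2_le_powR j tk0.
have q1 (beta : R) : 0 < beta -> 1 <= 2 `^ beta.
  by move=> b0; rewrite -[leLHS](powRr0 2); apply: ler_powR; rewrite ?ler1n// ltW.
exists (maxn J1 J2) => x y t t' b theta0 x1 y1 t1 t'1 bhi; rewrite hiE /=.
have lJ1 : lam <= (2 `^ theta) ^+ maxn J1 J2.
  by apply: (le_trans hJ1); apply: ler_weXn2l; rewrite ?q1// leq_maxl.
have lJ2 : lam <= (2 `^ (theta' / kappa)) ^+ maxn J1 J2.
  by apply: (le_trans hJ2); apply: ler_weXn2l; rewrite ?q1// leq_maxr.
set J := maxn J1 J2 in lJ1 lJ2 *.
set D := gamma x t - gamma y t'; set tau := t - t'.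
have W1 := dyadic_weight_ge0 theta J (x - y).
have W2 := dyadic_weight_ge0 (theta' / kappa) J (x - y).
have le1 : 1 <= lam `^ e by rewrite -[leLHS](powRr0 lam); exact: ler_powR.
have KCl : 1 <= KC * lam `^ e by rewrite -[leLHS]mulr1 ler_pM.
have KCl0 : 0 < KC * lam `^ e by exact: lt_le_trans KCl.
have hi_e : lam `^ e <= (2 * lam) `^ e.
  by apply: ge0_ler_powR; rewrite ?nnegrE ?mulr_ge0 ?(ltW l0)// ler_peMl ?ler1n// ltW.
have [bl|lb] := ltP b lam.
  rewrite (_ : (\int[leb]_(xi in _) _) = 0); last first.
    rewrite (@eq_Rintegral _ _ _ _ _ (cst 0)) ?Rintegral_cst ?mul0r// => xi _.
    rewrite /annulus (_ : _ && _ = false) ?mul0r//.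
    by apply/negP => /andP[h1 h2]; have := lt_le_trans h1 (le_trans h2 (ltW bl)); rewrite ltxx.
  rewrite normr0 mulr_ge0//; last exact: addr_ge0.
  by rewrite mulr_ge0 ?powR_ge0// /piece_cst -/KC mulr_ge0// (le_trans ler01).
have bl2 : b <= 2 * lam by rewrite -hiE.
rewrite annulus_integral//.
(* Both halves of the annulus admit the same estimate, since the kernel bound sees [D] only through
   its absolute value. *)
suff main D' : `|D'| = `|D| ->
    `|\int[leb]_(xi in `[lam, b]) cos (power_phase m theta0 D' tau xi)| <=
    KC * lam `^ e * piece_weight J (x - y).
  apply: (le_trans (ler_normD _ _)).
  apply: (le_trans (lerD (main D erefl) (main (- D) (normrN D)))).
  rewrite -mulrDl ler_wpM2r ?addr_ge0// /piece_cst -/KC -mulrDr -mulrA.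
  rewrite (_ : lam `^ e + lam `^ e = 2 * lam `^ e); last by ring.
  rewrite mulrCA ler_pM2l// ler_pM2l ?(lt_le_trans _ hK)//.
move=> DD; set I := \int[leb]_(xi in _) _.
have Il : `|I| <= lam by apply: (power_phase_le m1 l0 (lexx _) lb bl2).
rewrite -ler_pdivrMl// mulrC.
(* [X] is what the weights must dominate: it is capped by [lam] and, off the diagonal, bounded by
   one of the two negative powers of |x - y|. *)
set X := `|I| / (KC * lam `^ e).
have Xl : X <= lam.
  rewrite /X ler_pdivrMr// (le_trans Il)// -[leLHS]mulr1.
  by rewrite ler_pM2l.
have [u0|u0] := eqVneq (x - y) 0.
  apply: (@le_trans _ _ (dyadic_weight theta J (x - y))); last by rewrite lerDl.
  apply: dyadic_weight_ge; [exact: ltW|exact: xy2| |exact: le_trans lJ1].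
  by rewrite u0 eqxx.
have un0 : 0 < `|x - y| by rewrite normr_gt0.
have hth : 0 <= theta <= 2^-1 by rewrite theta_le ltW.
have hth' : 0 <= theta' <= 2^-1 by rewrite theta'_le ltW.
(* The two curves are compared at the common time [t] by the bi-Lipschitz bound; the Hoelder bound
   at [y] then pays for the change of time. *)
have hD : `|x - y| / C2 - C1 * `|tau| `^ kappa <= `|D'|.
  rewrite DD; have /andP[g1 _] := gamma_bilip x y t1.
  have g2 := gamma_holder y t1 t'1.
  rewrite mulrC; apply: (le_trans (lerB g1 g2)).
  have -> : D = (gamma x t - gamma y t) + (gamma y t - gamma y t') by rewrite /D; ring.
  exact: lerB_normD.
have K2 := @power_phase_le_sqrt _ _ m1 _ _ _ l0 (lexx _) lb bl2 theta0 D' tau.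
have K3 := @power_phase_le_inv _ _ m1 _ _ _ l0 (lexx _) lb bl2 theta0 D' tau.
have := kernel_bound m1 kappa0 C10 C20 cm0 l0 un0 hth hth' Il K2 K3 hD.
case=> h.
  apply: (@le_trans _ _ (dyadic_weight theta J (x - y))); last by rewrite lerDl.
  apply: dyadic_weight_ge; [exact: ltW|exact: xy2| |exact: le_trans lJ1].
  move=> _; rewrite /X ler_pdivrMr// (le_trans h)// -/KC.
  rewrite [leRHS]mulrC -mulrA ler_pM2l ?(lt_le_trans _ hK)// ler_wpM2r ?powR_ge0//.
  exact: ler_powR.
apply: (@le_trans _ _ (dyadic_weight (theta' / kappa) J (x - y))); last by rewrite lerDr.
apply: dyadic_weight_ge; [exact: ltW|exact: xy2| |exact: le_trans lJ2].
move=> _; rewrite /X ler_pdivrMr// (le_trans h)// -/KC.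
rewrite [leRHS]mulrC -mulrA ler_pM2l ?(lt_le_trans _ hK)// ler_wpM2r ?powR_ge0//.
exact: ler_powR.
Qed.

End pieces.

(** * Selectors and the maximal function of one piece *)

(** The head of the list is compared with the maximizer of the tail, a measurable comparison. The
    family [G] is carried along so that [gamma] evaluated at a selected time is measurable in x,
    given only measurability at each fixed time. *)
Lemma finite_selector d (T : measurableType d) (R : realType) (l : seq (R * R))
    (W G : R * R -> T -> R) :
  l != [::] -> (forall p, measurable_fun setT (W p)) ->
  (forall p, p \in l -> measurable_fun setT (G p)) ->
  exists sel : T -> R * R, [/\ forall x, sel x \in l,
    measurable_fun setT (fun x => (sel x).1) /\
    measurable_fun setT (fun x => (sel x).2),
    measurable_fun setT (fun x => G (sel x) x),
    measurable_fun setT (fun x => W (sel x) x) &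
    forall p x, p \in l -> W p x <= W (sel x) x].
Proof.
elim: l => [//|p l ih] _ mW mG.
have [->|l0] := eqVneq l [::].
  exists (fun=> p); split => //; first by move=> x; rewrite inE eqxx.
    by apply: mG; rewrite inE eqxx.
  by move=> q x; rewrite inE => /eqP ->.
have [|sel [s1 [s2 s3] s4 s5 s6]] := ih l0 mW.
  by move=> q ql; apply: mG; rewrite inE ql orbT.
have mc : measurable_fun setT (fun x => W p x <= W (sel x) x).
  by apply: measurable_fun_ler.
have mGp : measurable_fun setT (G p) by apply: mG; rewrite inE eqxx.
exists (fun x => if W p x <= W (sel x) x then sel x else p); split.
- by move=> x; case: ifP; rewrite inE ?s1 ?orbT// eqxx.
- split.
    rewrite (_ : (fun x => _) = (fun x => if W p x <= W (sel x) x then (sel x).1 else p.1)).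
      exact: measurable_fun_ifT.
    by apply/funext => x; case: ifP.
  rewrite (_ : (fun x => _) = (fun x => if W p x <= W (sel x) x then (sel x).2 else p.2)).
    exact: measurable_fun_ifT.
  by apply/funext => x; case: ifP.
- rewrite (_ : (fun x => _) = (fun x => if W p x <= W (sel x) x then G (sel x) x else G p x)).
    exact: measurable_fun_ifT.
  by apply/funext => x; case: ifP.
- rewrite (_ : (fun x => _) = (fun x => if W p x <= W (sel x) x then W (sel x) x else W p x)).
    exact: measurable_fun_ifT.
  by apply/funext => x; case: ifP.
- move=> q x; rewrite inE; have [h|h] := leP (W p x) (W (sel x) x).
    by move=> /predU1P[->//|]; exact: s6.
  move=> /predU1P[->//|ql]; apply: le_trans (ltW h); exact: s6.
Qed.

Lemma cos_lipschitz (R : realType) (a b : R) : `|cos a - cos b| <= `|a - b|.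
Proof.
wlog ab : a b / a < b => [h|].
  have [/h//|/h|->] := ltgtP a b; last by rewrite !subrr.
  by rewrite distrC => /le_trans; apply; rewrite distrC.
have d x : x \in `]a, b[ -> is_derive x 1 (@cos R) (- sin x) by move=> _; exact: is_derive_cos.
have cc : {within `[a, b], continuous (@cos R)}.
  by apply: continuous_subspaceT; exact: continuous_cos.
have [x _ e] := MVT ab d cc.
rewrite distrC e normrM normrN (distrC a) -[leRHS]mul1r ler_wpM2r//.
by rewrite ler_norml sin_geN1 sin_le1.
Qed.

Lemma sin_lipschitz (R : realType) (a b : R) : `|sin a - sin b| <= `|a - b|.
Proof.
rewrite -!cosBpihalf (le_trans (cos_lipschitz _ _))// le_eqVlt.
by apply/orP; left; apply/eqP; congr (`|_|); ring.
Qed.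

Section piece.
Variables (R : realType) (m : R) (gamma : R -> R -> R).
Variable nu : {finite_measure set (measurableTypeR R) -> \bar R}.
Variables (lo hi B : R) (W : R -> R).
Hypotheses (hi0 : 0 < hi) (B0 : 0 < B) (W_bm : bounded_measurable (W : measurableTypeR R -> R))
  (W_even : forall u, W (- u) = W u) (W_ge0 : forall u, 0 <= W u)
  (W_int : forall x : R, \int[nu]_y W (x - y) <= B)
  (kernel : forall x y t t' b theta0,
    `|x| <= 1 -> `|y| <= 1 -> `|t| <= 1 -> `|t'| <= 1 -> b <= hi ->
    `|\int[@lebesgue_measure R]_(xi in `[- hi, hi]) (annulus lo b xi *
      cos (full_phase m theta0 (gamma x t - gamma y t') (t - t') xi))| <= W (x - y)).
Variable g : R -> R.
Local Notation leb := (lebesgue_itv (- hi) hi).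
Hypotheses (mg : measurable_fun [set: measurableTypeR R] g)
  (ig2 : leb.-integrable setT (fun xi => (g xi ^+ 2)%:E)).

(** The upper radius [b] is a parameter of the maximal function beside [t]; controlling all [b] at
    once is what later yields convergence of the truncated integrals. *)
Definition piece_cos (x t b : R) : R :=
  \int[leb]_xi (annulus lo b xi * cos (full_phase m 0 (gamma x t) t xi) * g xi).
Definition piece_sin (x t b : R) : R :=
  \int[leb]_xi (annulus lo b xi * sin (full_phase m 0 (gamma x t) t xi) * g xi).

Let unit_ind (x : R) : R := (`|x| <= 1)%R%:R.

(** The indicator confines x to [-1, 1], the only place where the kernel is bounded. [G], [tt] and
    [bb] stand for the position on the curve, the selected time and the selected cutoff. *)
Let amp (F : R -> R) (G tt bb : R -> R) (p : measurableTypeR R * measurableTypeR R) : R :=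
  unit_ind p.1 * (annulus lo (bb p.1) p.2 * F (full_phase m 0 (G p.1) (tt p.1) p.2)).

Let unit_ind01 x : 0 <= unit_ind x <= 1.
Proof. by rewrite /unit_ind ler0n lern1 leq_b1. Qed.

Let amp_bm (F G tt bb : R -> R) : measurable_fun setT F -> (forall a, `|F a| <= 1) ->
  measurable_fun setT G -> measurable_fun setT tt -> measurable_fun setT bb ->
  bounded_measurable (amp F G tt bb).
Proof.
move=> mF F1 mG mtt mbb.
have m1 (h : R -> R) : measurable_fun setT h ->
    measurable_fun setT (fun p : measurableTypeR R * measurableTypeR R => h p.1).
  by move=> mh; apply: measurableT_comp => //; exact: measurable_fst.
have m2 (h : R -> R) : measurable_fun setT h ->
    measurable_fun setT (fun p : measurableTypeR R * measurableTypeR R => h p.2).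
  by move=> mh; apply: measurableT_comp => //; exact: measurable_snd.
split; last first.
  exists 1 => p; have /andP[u0 u1] := unit_ind01 p.1.
  have /andP[a0 a1] := annulus01 lo (bb p.1) p.2.
  rewrite /amp !normrM (ger0_norm u0) (ger0_norm a0) -[leRHS]mul1r.
  by apply: ler_pM => //; rewrite ?mulr_ge0// -[leRHS]mul1r ler_pM.
apply: measurable_funM.
  apply: (m1 unit_ind); exact: (bounded_measurable_norm_le (1 : R)).1.
apply: measurable_funM.
  rewrite /annulus (_ : (fun x => _) = (fun p : measurableTypeR R * measurableTypeR R =>
      if (lo < `|p.2|) && (`|p.2| <= bb p.1) then 1 else 0)); last first.
    by apply/funext => p; case: ifP.
  apply: measurable_fun_ifT => //; apply: measurable_and.
    by apply: measurable_fun_ltr => //; apply: (m2 (fun x => `|x|)); exact: normr_measurable.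
  by apply: measurable_fun_ler; [apply: (m2 (fun x => `|x|)); exact: normr_measurable|exact: m1].
apply: (@measurableT_comp _ _ _ _ _ _ F) => //.
apply: measurable_funD; last first.
  apply: measurable_funM; first exact: m1.
  apply: (m2 (fun x => `|x| `^ m)); apply: (measurableT_comp (measurable_powR m)).
  exact: normr_measurable.
apply: measurable_funD => //; apply: measurable_funM; first exact: m1.
exact: (m2 id).
Qed.

Let mcos : measurable_fun setT (@cos R).
Proof. by apply: continuous_measurable_fun; exact: continuous_cos. Qed.
Let msin : measurable_fun setT (@sin R).
Proof. by apply: continuous_measurable_fun; exact: continuous_sin. Qed.
Let cos1 (a : R) : `|cos a| <= 1. Proof. by rewrite ler_norml cos_geN1 cos_le1. Qed.
Let sin1 (a : R) : `|sin a| <= 1. Proof. by rewrite ler_norml sin_geN1 sin_le1. Qed.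

Let annulusM b b' xi : annulus lo b xi * annulus lo b' xi = annulus lo (Num.min b b') xi.
Proof.
rewrite /annulus -natrM mulnb; congr (nat_of_bool _)%:R.
by rewrite le_min; case: (_ < _) => //=.
Qed.

Let phaseB a t a' t' xi : full_phase m 0 (a - a') (t - t') xi =
  full_phase m 0 a t xi - full_phase m 0 a' t' xi.
Proof. by rewrite /full_phase; ring. Qed.

Lemma measurable_annulus_cos b theta0 D tau : measurable_fun setT
  (fun xi => annulus lo b xi * cos (full_phase m theta0 D tau xi)).
Proof.
apply: measurable_funM; first exact: measurable_annulus.
apply: (@measurableT_comp _ _ _ _ _ _ (@cos R)) => //.
exact: measurable_full_phase.
Qed.

(** Two annuli with the same inner radius meet in the one with the smaller cutoff, and the phases
    subtract, so the TT^* kernel at (x, y) is again one of the integrals in the hypothesis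
    [kernel]. *)
Let piece_linearized (G tt bb : R -> R) :
  measurable_fun setT G -> measurable_fun setT tt -> measurable_fun setT bb ->
  (forall x, `|tt x| <= 1) -> (forall x, bb x <= hi) ->
  (forall x, G x = gamma x (tt x)) ->
  \int[nu]_x ((\int[leb]_xi (amp (@cos R) G tt bb (x, xi) * g xi)) ^+ 2 +
              (\int[leb]_xi (amp (@sin R) G tt bb (x, xi) * g xi)) ^+ 2) <=
  4 * B * \int[leb]_xi (g xi ^+ 2).
Proof.
move=> mG mtt mbb tt1 bbhi GE.
pose k (p : measurableTypeR R * measurableTypeR R) := W (p.1 - p.2).
have bk : bounded_measurable k.
  have mB : measurable_fun [set: measurableTypeR R * measurableTypeR R]
      (fun p : measurableTypeR R * measurableTypeR R => p.1 - p.2 : measurableTypeR R).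
    by apply: measurable_funB; [exact: measurable_fst|exact: measurable_snd].
  exact: (@bounded_measurable_comp _ _ _ (measurableTypeR R) _ W _ W_bm mB).
have ker x y theta0 : `|unit_ind x * unit_ind y *
    \int[leb]_xi (annulus lo (Num.min (bb x) (bb y)) xi *
      cos (full_phase m theta0 (G x - G y) (tt x - tt y) xi))| <= k (x, y).
  rewrite normrM Rintegral_lebesgue_itv; last exact: measurable_annulus_cos.
  rewrite /unit_ind !GE; have [x1|_] := boolP (`|x| <= 1); last first.
    by rewrite !mul0r normr0 mul0r W_ge0.
  have [y1|_] := boolP (`|y| <= 1); last by rewrite mulr0 normr0 mul0r W_ge0.
  by rewrite mulr1 normr1 mul1r; apply: kernel => //; rewrite ge_min bbhi.
have pull x y theta0 : unit_ind x * unit_ind y *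
    \int[leb]_xi (annulus lo (Num.min (bb x) (bb y)) xi *
      cos (full_phase m theta0 (G x - G y) (tt x - tt y) xi)) =
    \int[leb]_xi (unit_ind x * unit_ind y * (annulus lo (Num.min (bb x) (bb y)) xi *
      cos (full_phase m theta0 (G x - G y) (tt x - tt y) xi))).
  rewrite RintegralZl//; apply: (@bounded_integrable _ _ _ _ _ 1).
    exact: measurable_annulus_cos.
  move=> xi; have /andP[a0 a1] := annulus01 lo (Num.min (bb x) (bb y)) xi.
  by rewrite normrM (ger0_norm a0) -[leRHS]mulr1; apply: ler_pM.
apply: (@ttstar _ _ _ _ _ nu leb _ _ k B) => //.
- exact: amp_bm.
- exact: amp_bm.
- by move=> x y; rewrite /k /= -W_even opprB.
- move=> x y; rewrite /k /=; apply: le_trans (ker x y 0); rewrite pull.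
  rewrite le_eqVlt; apply/orP; left; apply/eqP; congr (`|_|); apply: eq_Rintegral => xi _.
  by rewrite phaseB cosB -annulusM /amp /=; ring.
(* The sine part of the kernel is the cosine part with its phase shifted by pi / 2. *)
- move=> x y; rewrite /k /=; apply: le_trans (ker x y (pi / 2)); rewrite pull.
  rewrite le_eqVlt; apply/orP; left; apply/eqP; congr (`|_|); apply: eq_Rintegral => xi _.
  have -> : full_phase m (pi / 2) (G x - G y) (tt x - tt y) xi =
     full_phase m 0 (G x - G y) (tt x - tt y) xi + pi / 2 by rewrite /full_phase; ring.
  by rewrite cosDpihalf phaseB sinB -annulusM /amp /=; ring.
Qed.

Hypothesis mgamma : forall t, `|t| <= 1 -> measurable_fun setT (gamma ^~ t).

(** The maximizing pair of time and cutoff is substituted into the linearized operator, so its bound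
    applies to the maximum over the list. *)
Lemma piece_finite (l : seq (R * R)) :
  (forall p, p \in l -> `|p.1| <= 1) -> (forall p, p \in l -> p.2 <= hi) ->
  exists F : measurableTypeR R -> R, [/\ bounded_measurable F, forall x, 0 <= F x,
    (forall p x, p \in l -> `|x| <= 1 ->
      piece_cos x p.1 p.2 ^+ 2 + piece_sin x p.1 p.2 ^+ 2 <= F x) &
    \int[nu]_x F x <= 4 * B * \int[leb]_xi (g xi ^+ 2)].
Proof.
move=> l1 l2; have [->|l0] := eqVneq l [::].
  exists (fun=> 0); split => //; first exact: bounded_measurable_cst.
  rewrite Rintegral_cst// mul0r mulr_ge0 ?mulr_ge0 ?(ltW B0)//.
  by apply: Rintegral_ge0 => xi _; exact: sqr_ge0.
(* The default 0 makes [G p] measurable for every index; [gamma] is only controlled for times in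
   [-1, 1]. *)
pose G (p : R * R) := if `|p.1| <= 1 then gamma ^~ p.1 else fun=> 0.
have mG p : measurable_fun setT (G p : measurableTypeR R -> R).
  by rewrite /G; case: ifPn => // h; exact: mgamma.
pose U (F : R -> R) (p : R * R) (x : R) := \int[leb]_xi (amp F (G p) (fun=> p.1) (fun=> p.2) (x, xi) * g xi).
have bU (F : R -> R) (p : R * R) : measurable_fun setT F -> (forall a, `|F a| <= 1) ->
    bounded_measurable (U F p : measurableTypeR R -> R).
  move=> mF F1; have bm := amp_bm mF F1 (mG p) (measurable_cst p.1) (measurable_cst p.2).
  exact: (bounded_measurable_operator nu mg ig2 bm).
pose WW p (x : measurableTypeR R) := U (@cos R) p x ^+ 2 + U (@sin R) p x ^+ 2.
have [||sel [s1 [s2 s3] s4 _ s6]] := @finite_selector _ _ _ l WW G l0.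
- by move=> p; apply: measurable_funD; apply: measurable_funX; exact: (bU _ _ _ _).1.
- by move=> p _; exact: mG.
have bA (F : R -> R) : measurable_fun setT F -> (forall a, `|F a| <= 1) -> bounded_measurable
   (fun x : measurableTypeR R => \int[leb]_xi (amp F (fun x => G (sel x) x)
     (fun x => (sel x).1) (fun x => (sel x).2) (x, xi) * g xi)).
  move=> mF F1; have bm := amp_bm mF F1 s4 s2 s3.
  exact: (bounded_measurable_operator nu mg ig2 bm).
exists (fun x => WW (sel x) x); split.
- by apply: bounded_measurableD; apply: bounded_measurableX; exact: bA.
- by move=> x; rewrite addr_ge0// sqr_ge0.
- move=> p x pl x1; apply: le_trans (s6 p x pl).
  rewrite /WW /U /amp /unit_ind /= x1 /G l1//= le_eqVlt; apply/orP; left; apply/eqP.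
  congr (_ ^+ 2 + _ ^+ 2); apply: eq_Rintegral => xi _; by rewrite mul1r.
- apply: (piece_linearized s4 s2 s3).
  + by move=> x; exact: l1.
  + by move=> x; exact: l2.
  + by move=> x; rewrite /G l1.
Qed.

Variables (kappa C1 : R).
Hypotheses (kappa01 : 0 < kappa <= 1) (C10 : 0 < C1).
Hypothesis gamma_holder : forall x t t', `|t| <= 1 -> `|t'| <= 1 ->
  `|gamma x t - gamma x t'| <= C1 * `|t - t'| `^ kappa.
Hypothesis m_ge0 : 0 <= m.

(** A Hoelder constant in t for the localized integrals: the phase moves by at most C1 |t -
    t'|^kappa hi + |t - t'| hi^m, and |t - t'| <= |t - t'|^kappa at distances up to 1. It grows with
    [hi] and depends on [g], but it only decides how fine the grid of times is. *)
Let modulus := (C1 * hi + hi `^ m) * \int[leb]_xi `|g xi|.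

Let ig : leb.-integrable setT (EFin \o g).
Proof. exact: square_integrable_integrable. Qed.

Let modulus_ge0 : 0 <= modulus.
Proof.
apply: mulr_ge0; last by apply: Rintegral_ge0.
by rewrite addr_ge0 ?powR_ge0// mulr_ge0// ltW.
Qed.

Let osc_lipschitz (F : R -> R) x t t' b : measurable_fun setT F ->
  (forall a, `|F a| <= 1) -> (forall a a', `|F a - F a'| <= `|a - a'|) ->
  `|t| <= 1 -> `|t'| <= 1 -> `|t - t'| <= 1 ->
  `|\int[leb]_xi (annulus lo b xi * F (full_phase m 0 (gamma x t) t xi) * g xi) -
    \int[leb]_xi (annulus lo b xi * F (full_phase m 0 (gamma x t') t' xi) * g xi)|
  <= `|t - t'| `^ kappa * modulus.
Proof.
move=> mF F1 FL t1 t'1 tt'.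
have mf a r : measurable_fun [set: measurableTypeR R]
    (fun xi => annulus lo b xi * F (full_phase m 0 a r xi) * g xi).
  apply: measurable_funM => //; apply: measurable_funM; first exact: measurable_annulus.
  apply: (@measurableT_comp _ _ _ _ _ _ F) => //; exact: measurable_full_phase.
have fi a r : leb.-integrable setT
    (fun xi => (annulus lo b xi * F (full_phase m 0 a r xi) * g xi)%:E).
  apply: (le_integrable measurableT _ _ ig); first exact/measurable_EFinP.
  move=> xi _ /=; rewrite lee_fin !normrM -[leRHS]mul1r ler_wpM2r//.
  have /andP[a0 a1] := annulus01 lo b xi.
  by rewrite -[leRHS]mul1r ler_pM// ger0_norm.
have -> : \int[leb]_xi (annulus lo b xi * F (full_phase m 0 (gamma x t) t xi) * g xi) -
    \int[leb]_xi (annulus lo b xi * F (full_phase m 0 (gamma x t') t' xi) * g xi) =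
    \int[@lebesgue_measure R]_(xi in `[- hi, hi])
      (annulus lo b xi * F (full_phase m 0 (gamma x t) t xi) * g xi -
       annulus lo b xi * F (full_phase m 0 (gamma x t') t' xi) * g xi).
  rewrite -Rintegral_lebesgue_itv; last by apply: measurable_funB; exact: mf.
  by rewrite RintegralB//; exact: fi.
have mN : measurable_fun [set: measurableTypeR R] (fun xi => `|g xi|) by exact: measurableT_comp.
have dleb (f : R -> R) : measurable_fun [set: measurableTypeR R] f ->
   leb.-integrable setT (EFin \o f) -> (@lebesgue_measure R).-integrable `[- hi, hi] (EFin \o f).
  by move=> mf' fi'; apply/integrable_lebesgue_itv => //; exact/measurable_EFinP.
have i1 := dleb _ (measurable_funB (mf (gamma x t) t) (mf (gamma x t') t'))
   (integrableB measurableT (fi (gamma x t) t) (fi (gamma x t') t')).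
apply: (le_trans (le_normr_Rintegral _ i1)) => //.
have i2 : (@lebesgue_measure R).-integrable `[- hi, hi] (EFin \o (fun xi => `|g xi|)).
  by apply: dleb => //; exact: integrable_norm.
rewrite /modulus mulrA Rintegral_lebesgue_itv// -RintegralZl//.
apply: le_Rintegral => //; first exact: integrable_norm.
  exact: (@integrableZl _ _ _ (@lebesgue_measure R) _ _ _ (EFin \o (fun xi => `|g xi|))).
move=> xi /=; rewrite in_itv /= -ler_norml => xihi.
rewrite -mulrBl -mulrBr !normrM ler_wpM2r//.
have /andP[a0 a1] := annulus01 lo b xi.
rewrite (ger0_norm a0) -[leRHS]mul1r ler_pM//.
apply: (le_trans (FL _ _)).
have -> : full_phase m 0 (gamma x t) t xi - full_phase m 0 (gamma x t') t' xi =
  (gamma x t - gamma x t') * xi + (t - t') * `|xi| `^ m by rewrite /full_phase; ring.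
apply: (le_trans (ler_normD _ _)); rewrite !normrM mulrDr; apply: lerD.
  rewrite mulrA [X in _ <= X * _]mulrC ler_pM//; exact: gamma_holder.
rewrite (ger0_norm (powR_ge0 _ _)) ler_pM ?powR_ge0//.
  have /andP[k0 k1] := kappa01.
  have [->|tn] := eqVneq (t - t') 0; first by rewrite normr0 powR_ge0.
  by apply: ger1_powR => //; rewrite normr_gt0 tn.
by apply: ge0_ler_powR; rewrite ?nnegrE ?(ltW hi0).
Qed.

Let grid (n : nat) : seq R := [seq -1 + i%:R / n.+1%:R | i <- iota 0 (2 * n.+1).+1].

Let grid_le1 n t : t \in grid n -> `|t| <= 1.
Proof.
move=> /mapP[j + ->]; rewrite mem_iota add0n ltnS => /andP[_ i2].
have n0 : 0 < n.+1%:R :> R by [].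
have h0 : 0 <= j%:R / n.+1%:R :> R by rewrite divr_ge0.
have h2 : j%:R / n.+1%:R <= 2 :> R by rewrite ler_pdivrMr// -natrM ler_nat.
move: (_ / _) h0 h2 => a h0 h2.
by rewrite ler_norml; apply/andP; split; lra.
Qed.

Let grid_near n t : `|t| <= 1 -> exists2 t', t' \in grid n & `|t - t'| <= n.+1%:R^-1.
Proof.
rewrite ler_norml => /andP[t0 t1].
have n0 : 0 < n.+1%:R :> R by [].
have h : 0 <= (t + 1) * n.+1%:R by rewrite mulr_ge0//; lra.
have /andP[i1 i2] := truncn_itv h.
set i := Num.truncn _ in i1 i2.
exists (-1 + i%:R / n.+1%:R).
  apply/mapP; exists i => //; rewrite mem_iota add0n ltnS /=.
  rewrite -(ler_nat R) (le_trans i1)// natrM ler_pM2r//; lra.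
have -> : t - (-1 + i%:R / n.+1%:R) = ((t + 1) * n.+1%:R - i%:R) / n.+1%:R.
  by field; rewrite gt_eqF.
rewrite normrM [X in _ * X]gtr0_norm ?invr_gt0// ler_piMl ?invr_ge0//.
by rewrite ger0_norm ?subr_ge0// lerBlDl natr1 ltW.
Qed.

(** Every time is near a grid time, so the finite maximum controls all of them. Passing to the grid
    costs a factor 2, hence [8 * B], and an additive constant whose integral is at most [eta]. *)
Lemma piece_maximal (bs : seq R) (eta : R) : 0 < eta -> (forall b, b \in bs -> b <= hi) ->
  exists F : measurableTypeR R -> R, [/\ bounded_measurable F, forall x, 0 <= F x,
    (forall x t b, b \in bs -> `|x| <= 1 -> `|t| <= 1 ->
      piece_cos x t b ^+ 2 + piece_sin x t b ^+ 2 <= F x) &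
    \int[nu]_x F x <= 8 * B * \int[leb]_xi (g xi ^+ 2) + eta].
Proof.
move=> eta0 bshi.
pose V := fine (nu setT).
have V0 : 0 <= V by rewrite fine_ge0.
(* The additive loss is [2 * eps ^+ 2] for each of the cosine and the sine, and its integral against
   [nu] must not exceed [eta]; [V + 1] allows for total mass 0. *)
pose eps := Num.sqrt (eta / (4 * (V + 1))).
have eps0 : 0 < eps by rewrite sqrtr_gt0 divr_gt0// mulr_gt0//; lra.
have eps2 : 4 * eps ^+ 2 * V <= eta.
  rewrite sqr_sqrtr; last by rewrite divr_ge0 ?(ltW eta0)//; lra.
  have -> : 4 * (eta / (4 * (V + 1))) * V = eta * (V / (V + 1)) by field; lra.
  by rewrite ler_piMr ?(ltW eta0)// ler_pdivrMr; lra.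
have /andP[k0 k1] := kappa01.
have mod1 : 0 < modulus + 1 by have := modulus_ge0; lra.
(* Solves delta^kappa (modulus + 1) = eps: at this mesh each integral changes by at most [eps]. *)
pose delta := (eps / (modulus + 1)) `^ kappa^-1.
have delta0 : 0 < delta by rewrite powR_gt0// divr_gt0.
pose n := Num.Def.archi_bound delta^-1.
have nd : n.+1%:R^-1 <= delta.
  rewrite -[leRHS]invrK lef_pV2 ?posrE ?invr_gt0//.
  have := archi_boundP (ltW (eqbRL (invr_gt0 delta) delta0)).
  by rewrite -/n => /ltW /le_trans; apply; rewrite ler_nat.
have epsP (t t' : R) : `|t - t'| <= n.+1%:R^-1 -> `|t - t'| `^ kappa * modulus <= eps.
  move=> tn; apply: (@le_trans _ _ (delta `^ kappa * modulus)).
    apply: ler_wpM2r; first exact: modulus_ge0.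
    by apply: ge0_ler_powR; rewrite ?nnegrE ?(ltW k0) ?(ltW delta0) ?(le_trans tn nd).
  rewrite /delta -powRrM mulVf ?gt_eqF// powRr1; last by rewrite divr_ge0// ltW.
  rewrite mulrAC -mulrA ler_piMr ?(ltW eps0)// ler_pdivrMr// mul1r; lra.
pose l := [seq (t, b) | t <- grid n, b <- bs].
have [||F [bF F0 FP FI]] := @piece_finite l.
- by move=> p /allpairsP[[t b] /= [tg _ ->]]; exact: grid_le1 tg.
- by move=> p /allpairsP[[t b] /= [_ bb ->]]; exact: bshi.
exists (fun x => 2 * F x + 4 * eps ^+ 2); split.
- apply: bounded_measurableD; last exact: bounded_measurable_cst.
  by apply: bounded_measurableM => //; exact: bounded_measurable_cst.
- by move=> x; rewrite addr_ge0// mulr_ge0// sqr_ge0.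
- move=> x t b bbs x1 t1.
  have [t' t'g tt'] := grid_near n t1.
  have t'1 := grid_le1 t'g.
  have tt'1 : `|t - t'| <= 1.
    by rewrite (le_trans tt')// invf_le1// ler1n.
  have hc := le_trans (osc_lipschitz x b mcos cos1 (@cos_lipschitz R) t1 t'1 tt'1) (epsP _ _ tt').
  have hs := le_trans (osc_lipschitz x b msin sin1 (@sin_lipschitz R) t1 t'1 tt'1) (epsP _ _ tt').
  have h := FP (t', b) x (allpairs_f _ t'g bbs) x1.
  rewrite -/(piece_cos x t b) -/(piece_cos x t' b) in hc.
  rewrite -/(piece_sin x t b) -/(piece_sin x t' b) in hs.
  rewrite /= in h.
  have aux (a a' : R) : `|a - a'| <= eps -> a ^+ 2 <= 2 * a' ^+ 2 + 2 * eps ^+ 2.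
    move=> aa; have : (a - a') ^+ 2 <= eps ^+ 2.
      by rewrite -real_normK ?num_real// ler_pXn2r// nnegrE ltW.
    have := sqr_ge0 (a - 2 * a'); lra.
  have := aux _ _ hc; have := aux _ _ hs; lra.
- rewrite RintegralD//; last 2 first.
  + apply: (bounded_measurable_integrable nu (f := fun x => 2 * F x)).
    by apply: bounded_measurableM => //; exact: bounded_measurable_cst.
  + exact: (bounded_measurable_integrable nu (bounded_measurable_cst _ _)).
  rewrite RintegralZl//; last exact: bounded_measurable_integrable.
  rewrite Rintegral_cst// -/V; apply: lerD => //.
  by rewrite (_ : 8 * B * _ = 2 * (4 * B * \int[leb]_xi g xi ^+ 2)) ?ler_pM2l//; ring.
Qed.

End piece.

(** * Summation of dyadic blocks *)

Section dyadic_blocks.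
Variable R : realType.
Implicit Types (q : R) (a F : nat -> R).

(** Induction on [n]; the new cross term is absorbed because (W b - v A)^2 / (v W) is
    nonnegative. *)
Lemma weighted_cauchy_schwarz (w : nat -> R) a n : (forall k, 0 < w k) ->
  (\sum_(k < n) a k) ^+ 2 <= (\sum_(k < n) w k) * \sum_(k < n) a k ^+ 2 / w k.
Proof.
move=> w0; elim: n => [|n ih]; first by rewrite !big_ord0 expr2 mul0r.
rewrite !big_ord_recr/=; have := w0 n.
have W0 : 0 <= \sum_(k < n) w k by apply: sumr_ge0 => k _; exact: ltW.
have S0 : 0 <= \sum_(k < n) a k ^+ 2 / w k.
  by apply: sumr_ge0 => k _; rewrite divr_ge0 ?sqr_ge0 ?ltW.
move: ih W0 S0; move: (\sum_(k < n) a k) (\sum_(k < n) w k)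
  (\sum_(k < n) a k ^+ 2 / w k) (a n) (w n) => A W S b v ih W0 S0 v0.
rewrite mulrDl !mulrDr sqrrD.
have -> : v * (b ^+ 2 / v) = b ^+ 2 by field; rewrite gt_eqF.
rewrite -addrA -[leRHS]addrA lerD// addrA lerD2r.
move: W0; rewrite le_eqVlt => /predU1P[W0|W0].
  move: ih; rewrite -W0 !mul0r add0r => A0.
  have -> : A = 0 by apply/eqP; rewrite -sqrf_eq0 eq_le A0 sqr_ge0.
  by rewrite mul0r mul0rn mulr_ge0// ltW.
have h : v * A ^+ 2 / W <= v * S by rewrite -mulrA ler_pM2l// ler_pdivrMr// mulrC.
apply: le_trans (lerD (lexx _) h); rewrite -subr_ge0.
have -> : W * (b ^+ 2 / v) + v * A ^+ 2 / W - A * b *+ 2 = (W * b - v * A) ^+ 2 / (v * W).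
  by field; rewrite !gt_eqF.
by rewrite divr_ge0 ?sqr_ge0// mulr_ge0// ltW.
Qed.

Lemma geometric_sum_le q n : 0 < q < 1 -> \sum_(k < n) q ^+ k <= (1 - q)^-1.
Proof.
move=> /andP[q0 q1]; have q1' : 0 < 1 - q by rewrite subr_gt0.
rewrite -[leRHS]mul1r ler_pdivlMr// mulrC.
rewrite -opprB mulNr -subrX1 opprB gerBl exprn_ge0//; exact: ltW.
Qed.

(** Cauchy-Schwarz with weights q^k: the weights have a geometric sum, and shifting the index by [j]
    turns the bound on the series of F k / q^k into a gain q^j. *)
Lemma geometric_block_le q a F Sg j n : 0 < q < 1 -> (forall k, a k ^+ 2 <= F k) ->
  (forall i, \sum_(k < i) F k / q ^+ k <= Sg) ->
  (\sum_(k < n) a (j + k)%N) ^+ 2 <= q ^+ j * (Sg / (1 - q)).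
Proof.
move=> q01 aF FS; have /andP[q0 q1] := q01.
have F0 k : 0 <= F k by apply: le_trans (aF k); exact: sqr_ge0.
have w0 k : 0 < q ^+ k by exact: exprn_gt0.
apply: (le_trans (weighted_cauchy_schwarz (fun k => a (j + k)%N) n w0)).
have i0 : 0 <= (1 - q)^-1 by rewrite invr_ge0 subr_ge0 ltW.
rewrite [Sg / _]mulrC mulrCA; apply: ler_pM.
- by apply: sumr_ge0 => k _; exact: ltW.
- by apply: sumr_ge0 => k _; rewrite divr_ge0 ?sqr_ge0 ?ltW.
- exact: geometric_sum_le.
apply: (@le_trans _ _ (q ^+ j * \sum_(k < n) F (j + k)%N / q ^+ (j + k))).
  rewrite mulr_sumr; apply: ler_sum => k _; rewrite exprD invfM.
  have -> : q ^+ j * (F (j + k)%N * ((q ^+ j)^-1 * (q ^+ k)^-1)) = F (j + k)%N / q ^+ k.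
    by field; rewrite !gt_eqF.
  by rewrite ler_pM2r ?invr_gt0.
rewrite ler_pM2l//; apply: le_trans (FS (j + n)%N).
by rewrite big_split_ord/= lerDr; apply: sumr_ge0 => k _; rewrite divr_ge0 ?F0 ?ltW.
Qed.

(** A truncation beyond 2^j and the truncation at 2^j agree on the blocks 0, ..., j, so their
    difference is a tail with gain q^(j + 1), and the sequence is Cauchy. The partially filled last
    block is harmless because [F k] serves every cutoff in block [k]. *)
Lemma dyadic_cvg (u : nat -> R) (a : nat -> nat -> R) F q Sg : 0 < q < 1 ->
  (forall N K, (N <= 2 ^ K)%N -> u N = \sum_(k < K.+1) a k (minn N (2 ^ k))) ->
  (forall k b, (b <= 2 ^ k)%N -> a k b ^+ 2 <= F k) ->
  (forall i, \sum_(k < i) F k / q ^+ k <= Sg) ->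
  cvgn u /\ forall N, u N ^+ 2 <= Sg / (1 - q).
Proof.
move=> q01 uE aF FS; have /andP[q0 q1] := q01.
have tail j N : (2 ^ j <= N)%N -> (u N - u (2 ^ j)%N) ^+ 2 <= q ^+ j.+1 * (Sg / (1 - q)).
  move=> jN; have NK : (N <= 2 ^ (j + N))%N.
    by apply: (leq_trans (ltnW (ltn_expl N (ltnSn 1)))); rewrite leq_exp2l// leq_addl.
  rewrite (uE _ _ NK) (uE _ _ (leqnn _)) -addSn big_split_ord /= addrAC.
  have -> : \sum_(i < j.+1) a i (minn (2 ^ j) (2 ^ i)) = \sum_(i < j.+1) a i (minn N (2 ^ i)).
    apply: eq_bigr => i _; congr (a i _).
    have ij : (2 ^ i <= 2 ^ j)%N by rewrite leq_exp2l// -ltnS.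
    by rewrite !(minn_idPr _)//; exact: leq_trans jN.
  rewrite subrr add0r.
  apply: (@geometric_block_le q (fun k => a k (minn N (2 ^ k))) F) => // k.
  by apply: aF; exact: geq_minr.
split; last first.
  move=> N; rewrite (uE N N (ltnW (ltn_expl N (ltnSn 1)))).
  have := @geometric_block_le q (fun k => a k (minn N (2 ^ k))) F Sg 0 N.+1 q01.
  by rewrite expr0 mul1r; apply => // k; apply: aF; exact: geq_minr.
apply: cauchy_cvg; apply: cauchy_exP => e e0.
have Sg0 : 0 <= Sg by have := FS 0%N; rewrite big_ord0.
have S0 : 0 <= Sg / (1 - q) by rewrite divr_ge0// subr_ge0 ltW.
have : (fun j => q ^+ j) @ \oo --> (0 : R) by apply: cvg_expr; rewrite gtr0_norm.
move=> /cvgrPdist_lt /(_ (e ^+ 2 / (Sg / (1 - q) + 1))).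
have d0 : 0 < e ^+ 2 / (Sg / (1 - q) + 1) by rewrite divr_gt0 ?exprn_gt0// ltr_wpDl.
move=> /(_ d0)[j _ /(_ j.+1)]; rewrite /= leqnSn => /(_ isT).
rewrite sub0r normrN ger0_norm ?exprn_ge0 ?ltW// => hj.
exists (u (2 ^ j)%N); exists (2 ^ j)%N => // N /= jN.
rewrite /ball /= distrC -(@ltr_pXn2r _ 2) ?nnegrE ?(ltW e0)// real_normK ?num_real//.
apply: (le_lt_trans (tail _ _ jN)).
move: hj; rewrite ltr_pdivlMr ?ltr_wpDl// => /(le_lt_trans _); apply.
by rewrite ler_pM2l ?exprn_gt0// lerDl.
Qed.

End dyadic_blocks.

(** * Splitting a truncated integral into annuli *)

Section annuli.
Variable R : realType.
Local Notation leb := (@lebesgue_measure R).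
Implicit Types (f : R -> R).

Definition loc_integrable f := forall b, leb.-integrable `[- b, b] (EFin \o f).

Lemma loc_integrable_of_sqr f : measurable_fun setT f ->
  loc_integrable (fun x => f x ^+ 2) -> loc_integrable f.
Proof.
move=> mf if2 b; apply/integrable_lebesgue_itv; first exact/measurable_EFinP.
apply: square_integrable_integrable => //; apply/integrable_lebesgue_itv => //.
by apply/measurable_EFinP; exact: measurable_funX.
Qed.

Lemma loc_integrableM f (p : R -> R) : measurable_fun setT f -> loc_integrable f ->
  measurable_fun setT p -> (forall x, `|p x| <= 1) ->
  loc_integrable (fun x => p x * f x).
Proof.
move=> mf fi mp p1 b; apply: (le_integrable _ _ _ (fi b)) => //.
  by apply: measurable_funTS; apply/measurable_EFinP; exact: measurable_funM.
by move=> x _; rewrite lee_fin normrM ler_piMl.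
Qed.

Lemma Rintegral_annulus f a b L : measurable_fun setT f -> b <= L ->
  \int[lebesgue_itv (- L) L]_xi (annulus a b xi * f xi) =
  \int[leb]_xi (annulus a b xi * f xi).
Proof.
move=> mf bL; have mF : measurable_fun setT (fun xi => annulus a b xi * f xi).
  by apply: measurable_funM => //; exact: measurable_annulus.
rewrite Rintegral_lebesgue_itv// Rintegral_mkcond; apply: eq_Rintegral => xi _.
rewrite /patch /annulus mem_setE /= in_itv /= -ler_norml.
case: ifPn => // h; rewrite andbC (_ : (`|xi| <= b) = false) ?mul0r//.
by apply: contraNF h => /le_trans; exact.
Qed.

Lemma Rintegral_annulus_ball f b : measurable_fun setT f ->
  \int[leb]_(xi in `[- b, b]) f xi = \int[leb]_xi (annulus (-1) b xi * f xi).
Proof.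
move=> mf; rewrite Rintegral_mkcond; apply: eq_Rintegral => xi _.
rewrite /patch /annulus mem_setE /= in_itv /= -ler_norml.
have -> : -1 < `|xi| by exact: lt_le_trans (ltrN10 R) (normr_ge0 xi).
by case: ifPn => _; rewrite ?mul1r ?mul0r.
Qed.

Lemma integrable_annulus f a b : measurable_fun setT f -> loc_integrable f ->
  leb.-integrable setT (fun xi => (annulus a b xi * f xi)%:E).
Proof.
move=> mf fi; have mF : measurable_fun setT (fun xi => annulus a b xi * f xi).
  by apply: measurable_funM => //; exact: measurable_annulus.
have := fi b; rewrite integrable_mkcond//; apply: le_integrable => //.
  exact/measurable_EFinP.
move=> xi _; rewrite /patch /annulus mem_setE /= in_itv /= -ler_norml.
rewrite andbC; case: ifPn => xb /=; last by rewrite mul0r.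
by case: (_ < _); rewrite ?mul1r ?mul0r//= normr0 lee_fin.
Qed.

Lemma annulusD a b c xi : a <= b ->
  annulus a c xi = annulus a (Num.min c b) xi + annulus b c xi :> R.
Proof.
move=> ab; rewrite /annulus le_min; have [xb|bx] := leP `|xi| b.
  by rewrite /= andbT addr0.
by rewrite !andbF add0r (le_lt_trans ab bx).
Qed.

(** Annuli inside the range are complete, the one that contains [N] is cut there, and later ones are
    empty. All cutoffs in piece [k] are natural numbers up to 2^k, hence finitely many. *)
Lemma Rintegral_dyadic_annuli f (N K : nat) : measurable_fun setT f ->
  loc_integrable f -> (N <= 2 ^ K)%N ->
  \int[leb]_(xi in `[- N%:R, N%:R]) f xi =
  \sum_(k < K.+1) \int[lebesgue_itv (- piece_hi R k) (piece_hi R k)]_xi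
    (annulus (piece_lo R k) (minn N (2 ^ k))%:R xi * f xi).
Proof.
move=> mf fi; have hiE k : (minn N (2 ^ k))%:R <= piece_hi R k.
  by rewrite /piece_hi -natrX ler_nat geq_minr.
move=> /minn_idPl {1 2}<-; rewrite Rintegral_annulus_ball//.
under eq_bigr do rewrite Rintegral_annulus//.
elim: K => [|K ih]; first by rewrite big_ord1.
rewrite big_ord_recr/= -ih -RintegralD//; last 2 first.
- exact: (integrable_annulus (f := f)).
- exact: (integrable_annulus (f := f)).
apply: eq_Rintegral => xi _; rewrite -mulrDl; congr (_ * _).
rewrite (@annulusD _ (2 ^+ K)); last by rewrite (@le_trans _ _ 0)// exprn_ge0.
congr (annulus _ _ _ + _); rewrite -natrX -natr_min; congr _%:R.
by rewrite -[LHS]minnA; congr minn; apply/minn_idPr; rewrite leq_exp2l.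
Qed.

End annuli.

(** * Choice of exponents and the bound for every piece *)

(** [theta] is the midpoint between max (0, 1 - 2 s) and min (1/2, alpha), and [theta'] between max
    (0, (1 - 2 s) / m) and min (1/2, alpha kappa). The three lower bounds on [s] say that these
    intervals are nonempty; that (1 - 2 s) / m < 1/2 also uses m > 1. *)
Lemma decay_exponents (R : realType) (m kappa alpha s : R) :
  1 < m -> 0 < kappa -> 0 < alpha ->
  Num.max (1 / 4) (Num.max ((1 - alpha) / 2) ((1 - m * alpha * kappa) / 2)) < s ->
  exists theta theta' e : R, [/\ 0 < theta, theta <= 2^-1, theta < alpha &
    [/\ 0 < theta', theta' <= 2^-1, theta' / kappa < alpha &
    [/\ 0 <= e, 1 - theta <= e, 1 - m * theta' <= e & e < 2 * s]]].
Proof.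
move=> m1 k0 a0; rewrite !gt_max => /and3P[s1 s2 s3].
have m0 : 0 < m by exact: lt_trans m1.
have sm : (1 - 2 * s) / m < 2^-1.
  rewrite ltr_pdivrMr//; apply: (@lt_le_trans _ _ 2^-1); first by lra.
  by rewrite ler_pMr// ?ltW// invr_gt0.
have sm' : (1 - 2 * s) / m < alpha * kappa by rewrite ltr_pdivrMr//; lra.
set a := Num.max 0 (1 - 2 * s); set b := Num.min 2^-1 alpha.
set a' := Num.max 0 ((1 - 2 * s) / m); set b' := Num.min 2^-1 (alpha * kappa).
have ak : 0 < alpha * kappa by exact: mulr_gt0.
have ab : a < b.
  by rewrite /a /b gt_max !lt_min invr_gt0 ltr0n a0 /=; apply/andP; split; lra.
have ab' : a' < b' by rewrite /a' /b' gt_max !lt_min invr_gt0 ltr0n ak sm sm'.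
have [aa1 aa2] : 0 <= a /\ 1 - 2 * s <= a by rewrite !le_max !lexx orbT.
have [aa1' aa2'] : 0 <= a' /\ (1 - 2 * s) / m <= a' by rewrite !le_max !lexx orbT.
have [bb1 bb2] : b <= 2^-1 /\ b <= alpha by rewrite !ge_min !lexx orbT.
have [bb1' bb2'] : b' <= 2^-1 /\ b' <= alpha * kappa by rewrite !ge_min !lexx orbT.
have h : (1 - 2 * s) / m < (a' + b') / 2 by lra.
rewrite ltr_pdivrMr// in h.
exists ((a + b) / 2), ((a' + b') / 2), (Num.max (1 - (a + b) / 2) (1 - m * ((a' + b') / 2))).
split; try lra; split; try lra.
  by rewrite ltr_pdivrMr//; lra.
split; rewrite ?le_max ?gt_max ?lexx ?orbT//.
  by apply/orP; left; lra.
by apply/andP; split; lra.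
Qed.

Section dyadic_sum.
Variables (R : realType) (m kappa alpha c C1 C2 s : R).
Variable gamma : R -> R -> R.
Variable nu : {finite_measure set (measurableTypeR R) -> \bar R}.
Hypotheses (m1 : 1 < m) (kappa01 : 0 < kappa <= 1) (alpha0 : 0 < alpha) (c0 : 0 <= c)
  (C10 : 0 < C1) (C20 : 0 < C2).
Hypothesis nu_ball : forall x r : R, 0 < r -> (nu (ball x r) <= (c * r `^ alpha)%:E)%E.
Hypothesis gamma_holder : forall x t t', `|t| <= 1 -> `|t'| <= 1 ->
  `|gamma x t - gamma x t'| <= C1 * `|t - t'| `^ kappa.
Hypothesis gamma_bilip : forall t x x', `|t| <= 1 ->
  C2^-1 * `|x - x'| <= `|gamma x t - gamma x' t| <= C2 * `|x - x'|.
Hypothesis hs :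
  Num.max (1 / 4) (Num.max ((1 - alpha) / 2) ((1 - m * alpha * kappa) / 2)) < s.
Local Notation leb := (@lebesgue_measure R).

Let m0 : 0 < m. Proof. exact: lt_trans m1. Qed.

Lemma measurable_gamma t : `|t| <= 1 -> measurable_fun setT (gamma ^~ t).
Proof.
move=> t1; apply: continuous_measurable_fun => x.
apply/cvgrPdist_lt => e e0; near=> y.
have /andP[_] := gamma_bilip x y t1; move=> /le_lt_trans; apply.
rewrite -ltr_pdivlMl// mulrC.
near: y; have := @cvgr_dist_lt _ _ _ (nbhs x) _ id x (@cvg_id _ _) (e / C2).
by apply; rewrite divr_gt0.
Unshelve. all: by end_near.
Qed.

Lemma annulus_idem a b b' (xi : R) : b <= b' ->
  annulus a b xi * annulus a b' xi = annulus a b xi.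
Proof.
move=> bb; rewrite /annulus -natrM mulnb; congr (nat_of_bool _)%:R.
case: (a < `|xi|) => //=; case: (leP `|xi| b) => // xb.
by rewrite (le_trans xb bb).
Qed.

(** [e] and [B] are fixed before the scale [k] and the function [g]: the depth of the weights and
    the grid of times depend on these, but the Schur constant depends on [k] only through 2^(e
    k). *)
Lemma dyadic_maximal_bound : exists e B : R, [/\ 0 <= e, e < 2 * s, 0 < B &
  forall (g : R -> R) (k : nat) (eta : R), measurable_fun setT g ->
  loc_integrable (fun xi => g xi ^+ 2) -> 0 < eta ->
  exists F : measurableTypeR R -> R, [/\ bounded_measurable F, forall x, 0 <= F x,
    (forall x t b, (b <= 2 ^ k)%N -> `|x| <= 1 -> `|t| <= 1 ->
      piece_cos m gamma (piece_lo R k) (piece_hi R k) g x t b%:R ^+ 2 +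
      piece_sin m gamma (piece_lo R k) (piece_hi R k) g x t b%:R ^+ 2 <= F x) &
    \int[nu]_x F x <= B * (2 `^ e) ^+ k *
      \int[leb]_xi (annulus (piece_lo R k) (piece_hi R k) xi * g xi ^+ 2) + eta]].
Proof.
have /andP[k0 k1] := kappa01.
have [th [th' [e [th0 th1 th2 [th'0 th'1 th'2 [e0 e1 e2 e3]]]]]] :=
  decay_exponents m1 k0 alpha0 hs.
set cst := piece_cst m kappa C1 C2.
have cst0 : 0 < cst.
  rewrite /cst /piece_cst mulr_gt0// (lt_le_trans ltr01)//; apply: kernel_cst_ge1 => //.
  by rewrite addr_gt0// divr_gt0// mulr_gt0// subr_gt0.
pose D (b : R) := c * 4 `^ alpha / (1 - 2 `^ (b - alpha)).
have D0 b : b < alpha -> 0 <= D b.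
  move=> ba; rewrite /D divr_ge0 ?mulr_ge0 ?powR_ge0// subr_ge0.
  by rewrite -[leRHS](powRr0 2); apply: ler_powR; rewrite ?ler1n// subr_le0 ltW.
(* The [+ 1] keeps the Schur constant strictly positive, as absorption in TT^* requires, even when
   [c] is 0. *)
pose B0 := cst * (D th + D (th' / kappa) + 1).
have B00 : 0 < B0 by rewrite mulr_gt0// ltr_wpDl// addr_ge0 ?D0.
exists e, (8 * B0); split => //; first by rewrite mulr_gt0.
move=> g k eta mg ig2 eta0.
have [J hJ] := piece_kernel m1 k0 C10 C20 gamma_holder gamma_bilip
  th0 th1 th'0 th'1 e0 e1 e2 k.
set lo := piece_lo R k; set hi := piece_hi R k in hJ *.
have hi0 : 0 < hi by exact: exprn_gt0.
have hie : hi `^ e = (2 `^ e) ^+ k.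
  by rewrite -(powR_mulrn k (powR_ge0 2 e)) -powRrM mulrC powRrM powR_mulrn.
set W := fun u => cst * hi `^ e * piece_weight kappa th th' J u.
have che : 0 < cst * hi `^ e by rewrite mulr_gt0// powR_gt0.
have bth : bounded_measurable (fun u : measurableTypeR R => dyadic_weight th J u).
  exact: bounded_measurable_dyadic_weight.
have bth' : bounded_measurable (fun u : measurableTypeR R => dyadic_weight (th' / kappa) J u).
  exact: bounded_measurable_dyadic_weight.
have bW : bounded_measurable (W : measurableTypeR R -> R).
  apply: bounded_measurableM; first exact: bounded_measurable_cst.
  exact: bounded_measurableD.
(* Localizing [g] first leaves only its energy in the annulus on the right, where the Sobolev weight
   is at least a multiple of 2^(2 s k). *)
pose g' xi := annulus lo hi xi * g xi.
have mg' : measurable_fun [set: measurableTypeR R] g'.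
  by apply: measurable_funM => //; exact: measurable_annulus.
have g'2 xi : g' xi ^+ 2 = annulus lo hi xi * g xi ^+ 2.
  by rewrite /g' exprMn expr2 annulus_idem.
have mg2 : measurable_fun setT (fun xi => g xi ^+ 2) by exact: measurable_funX.
have ig'2 : (lebesgue_itv (- hi) hi).-integrable setT (fun xi => (g' xi ^+ 2)%:E).
  apply/integrable_lebesgue_itv.
    by apply/measurable_EFinP; exact: measurable_funX.
  apply: (@integrableS _ _ _ leb setT) => //.
  have := integrable_annulus lo hi mg2 ig2.
  by apply: eq_integrable => // xi _; rewrite g'2.
have W0 u : 0 <= W u.
  by rewrite /W mulr_ge0 ?(ltW che)// addr_ge0// dyadic_weight_ge0.
have WN u : W (- u) = W u by rewrite /W /piece_weight !dyadic_weightN.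
have BB0 : 0 < cst * hi `^ e * (D th + D (th' / kappa) + 1).
  by rewrite mulr_gt0// ltr_wpDl// addr_ge0 ?D0.
have th'k : 0 < th' / kappa by rewrite divr_gt0.
have mB x : measurable_fun [set: measurableTypeR R] (fun y : measurableTypeR R => x - y : measurableTypeR R).
  exact: measurable_funB.
have bmx (h : R -> R) x : bounded_measurable (h : measurableTypeR R -> R) ->
    bounded_measurable (fun y : measurableTypeR R => h (x - y)).
  by move=> bh; exact: (@bounded_measurable_comp _ _ _ (measurableTypeR R) _ h _ bh (mB x)).
have Wint (x : R) : \int[nu]_y W (x - y) <= cst * hi `^ e * (D th + D (th' / kappa) + 1).
  rewrite RintegralZl//; last first.
    apply: (bounded_measurable_integrable nu (f := fun y => piece_weight kappa th th' J (x - y))).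
    by apply: bounded_measurableD; exact: bmx.
  rewrite ler_pM2l// RintegralD//; last 2 first.
  - exact: (bounded_measurable_integrable nu (bmx (dyadic_weight th J) x bth)).
  - exact: (bounded_measurable_integrable nu (bmx (dyadic_weight (th' / kappa) J) x bth')).
  apply: (@le_trans _ _ (D th + D (th' / kappa))); last by rewrite lerDl.
  apply: lerD; apply: (dyadic_weight_integral c0 nu_ball).
    by rewrite ltW.
  by rewrite ltW.
pose bs : seq R := [seq b%:R | b <- iota 0 (2 ^ k).+1].
have [|F [bF F0 FP FI]] := piece_maximal hi0 BB0 bW WN W0 Wint hJ mg' ig'2
  measurable_gamma kappa01 C10 gamma_holder (ltW m0) (bs := bs) eta0.
  move=> b /mapP[j]; rewrite mem_iota add0n ltnS => /= jk ->.
  by rewrite /hi /piece_hi -natrX ler_nat.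
exists F; split => //.
  move=> x t b bk x1 t1; have bbs : (b%:R : R) \in bs.
    by apply: map_f; rewrite mem_iota add0n ltnS.
  apply: le_trans (FP x t _ bbs x1 t1).
  have bh : (b%:R : R) <= hi by rewrite /hi /piece_hi -natrX ler_nat.
  rewrite le_eqVlt; apply/orP; left; apply/eqP.
  by congr (_ ^+ 2 + _ ^+ 2); apply: eq_Rintegral => xi _;
    rewrite /g' [RHS]mulrACA -mulrA annulus_idem// mulrA.
apply: (le_trans FI); rewrite lerD2r /B0 -hie.
rewrite le_eqVlt; apply/orP; left; apply/eqP.
have -> : \int[leb]_xi (annulus lo hi xi * g xi ^+ 2) =
    \int[lebesgue_itv (- hi) hi]_xi (g' xi ^+ 2).
  rewrite -(@Rintegral_annulus _ (fun xi => g xi ^+ 2) lo hi hi mg2)//.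
  by apply: eq_Rintegral => xi _; rewrite g'2.
ring.
Qed.

End dyadic_sum.

(** * The summed majorant *)

Section geometric_majorant.
Context d (T : measurableType d) (R : realType).
Variables (nu : {finite_measure set T -> \bar R}) (F : nat -> T -> R) (q A : R).
Hypotheses (q01 : 0 < q < 1) (bF : forall k, bounded_measurable (F k))
  (F0 : forall k x, 0 <= F k x) (FI : forall k, \int[nu]_x F k x <= A * (q ^+ 2) ^+ k).

(** Of the decay q^(2 k) of the integrals one factor q^k is spent on the weights, which make the
    blocks summable wherever the series is finite; the other makes the integral of the series
    finite. The value +oo is allowed, on a null set. *)
Definition geometric_majorant (x : T) : \bar R :=
  (\sum_(k <oo) (F k x / q ^+ k)%:E)%E.

Let Fq0 k x : 0 <= F k x / q ^+ k.
Proof. by have /andP[q0 _] := q01; rewrite divr_ge0// exprn_ge0// ltW. Qed.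

Let mFq k : measurable_fun setT (fun x => (F k x / q ^+ k)%:E).
Proof. by apply/measurable_EFinP; apply: measurable_funM => //; exact: (bF k).1. Qed.

Lemma measurable_geometric_majorant : measurable_fun setT geometric_majorant.
Proof.
apply: (@ge0_emeasurable_sum _ _ _ _ (fun k x => (F k x / q ^+ k)%:E) xpredT) => //.
by move=> k x _ _; rewrite lee_fin.
Qed.

Lemma geometric_majorant_ge0 x : (0 <= geometric_majorant x)%E.
Proof. by apply: nneseries_ge0 => k _ _; rewrite lee_fin. Qed.

Lemma integral_geometric_majorant :
  (\int[nu]_x geometric_majorant x <= (A / (1 - q))%:E)%E.
Proof.
have /andP[q0 q1] := q01.
have A0 : 0 <= A.
  by have := FI 0; rewrite expr0 mulr1; apply: le_trans; exact: Rintegral_ge0.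
rewrite integral_nneseries//; last by move=> k x _; rewrite lee_fin.
have term k : (\int[nu]_x (F k x / q ^+ k)%:E <= (A * q ^+ k)%:E)%E.
  have bk : bounded_measurable (fun x => F k x / q ^+ k).
    by apply: bounded_measurableM => //; exact: bounded_measurable_cst.
  have ik := bounded_measurable_integrable nu bk.
  rewrite -[leLHS]fineK; last exact: (integrable_fin_num measurableT ik).
  rewrite lee_fin -/(Rintegral nu setT (fun x => F k x / q ^+ k)).
  rewrite RintegralZr//; last exact: bounded_measurable_integrable.
  rewrite ler_pdivrMr ?exprn_gt0//; apply: (le_trans (FI k)).
  by rewrite -mulrA -exprMn expr2.
apply: lime_le.
  by apply: is_cvg_nneseries => k _ _; apply: integral_ge0 => x _; rewrite lee_fin.
near=> n; apply: (le_trans (lee_sum _ (fun k _ => term k))).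
rewrite sumEFin lee_fin big_mkord -mulr_sumr ler_wpM2l//.
exact: geometric_sum_le.
Unshelve. all: by end_near.
Qed.

Lemma geometric_majorant_ge x n : (geometric_majorant x < +oo)%E ->
  \sum_(k < n) F k x / q ^+ k <= fine (geometric_majorant x).
Proof.
move=> Soo; rewrite -lee_fin fineK ?ge0_fin_numE ?geometric_majorant_ge0//.
rewrite -sumEFin -(big_mkord xpredT (fun k => (F k x / q ^+ k)%:E)).
by apply: nneseries_lim_ge => k _ _; rewrite lee_fin.
Qed.

End geometric_majorant.

(** * The maximal function over all frequencies *)

Section dyadic_maximal.
Variables (R : realType) (m kappa alpha c C1 C2 s : R).
Variable gamma : R -> R -> R.
Variable nu : {finite_measure set (measurableTypeR R) -> \bar R}.
Hypotheses (m1 : 1 < m) (kappa01 : 0 < kappa <= 1) (alpha0 : 0 < alpha) (c0 : 0 <= c)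
  (C10 : 0 < C1) (C20 : 0 < C2).
Hypothesis nu_ball : forall x r : R, 0 < r -> (nu (ball x r) <= (c * r `^ alpha)%:E)%E.
Hypothesis gamma_holder : forall x t t', `|t| <= 1 -> `|t'| <= 1 ->
  `|gamma x t - gamma x t'| <= C1 * `|t - t'| `^ kappa.
Hypothesis gamma_bilip : forall t x x', `|t| <= 1 ->
  C2^-1 * `|x - x'| <= `|gamma x t - gamma x' t| <= C2 * `|x - x'|.
Hypothesis hs :
  Num.max (1 / 4) (Num.max ((1 - alpha) / 2) ((1 - m * alpha * kappa) / 2)) < s.
Local Notation leb := (@lebesgue_measure R).

Definition sobolev_weight (xi : R) : R := (1 + xi ^+ 2) `^ s.

Let s0 : 0 < s.
Proof. by move: hs; rewrite gt_max => /andP[h _]; apply: lt_trans h; rewrite divr_gt0. Qed.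

Lemma sobolev_weight_ge1 xi : 1 <= sobolev_weight xi.
Proof.
rewrite -[leLHS](powRr0 (1 + xi ^+ 2)); apply: ler_powR; last exact: ltW.
by rewrite lerDl sqr_ge0.
Qed.

(** Beyond piece 0 a frequency exceeds half of [piece_hi], which accounts for the extra factor 2^(2
    s); on piece 0 the weight is at least 1. *)
Lemma dyadic_sobolev_weight k xi :
  annulus (piece_lo R k) (piece_hi R k) xi * (2 `^ (2 * s)) ^+ k <=
  2 `^ (2 * s) * sobolev_weight xi.
Proof.
have w1 := sobolev_weight_ge1 xi.
have p0 : 0 < 2 `^ (2 * s) :> R by rewrite powR_gt0.
have p1 : 1 <= 2 `^ (2 * s) :> R.
  by rewrite -[leLHS](powRr0 2); apply: ler_powR; rewrite ?ler1n// mulr_ge0// ltW.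
rewrite /annulus; case: (boolP (_ && _)) => [/andP[h _]|_] /=; last by rewrite mul0r mulr_ge0// ltW// (lt_le_trans ltr01).
rewrite mul1r; case: k h => [_|k h]; first by rewrite expr0 (le_trans p1)// ler_peMr// ltW.
rewrite exprS ler_pM2l// -powR_mulrn ?powR_ge0// -powRrM.
have -> : 2 * s * k%:R = (2 * k)%:R * s by rewrite natrM; ring.
rewrite (powRrM 2 (2 * k)%:R s) (powR_mulrn (2 * k)%N (ler0n R 2)) exprM exprAC.
apply: ge0_ler_powR; rewrite ?nnegrE ?(ltW s0) ?exprn_ge0 ?addr_ge0 ?sqr_ge0//.
apply: (@le_trans _ _ (xi ^+ 2)); last by rewrite lerDr.
rewrite -[leRHS]real_normK ?num_real//; apply: lerXn2r; rewrite ?nnegrE ?exprn_ge0//.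
exact: ltW.
Qed.

Definition truncated_oscillation (F : R -> R) (x t : R) (g : R -> R) (N : nat) : R :=
  \int[leb]_(xi in `[- N%:R, N%:R]) (F (full_phase m 0 (gamma x t) t xi) * g xi).

(** One majorant [S] serves all times, all cutoffs and both trigonometric factors, so the points
    where convergence may fail form a set independent of t. *)
Lemma dyadic_maximal : exists2 C : R, 0 <= C & forall (g : R -> R) (eta : R),
  measurable_fun setT g ->
  leb.-integrable setT (fun xi => (sobolev_weight xi * g xi ^+ 2)%:E) -> 0 < eta ->
  exists S : measurableTypeR R -> \bar R, [/\ measurable_fun setT S,
    forall x, (0 <= S x)%E,
    (\int[nu]_x S x <= (C * (\int[leb]_xi (sobolev_weight xi * g xi ^+ 2) + eta))%:E)%E &
    forall x t, `|x| <= 1 -> `|t| <= 1 -> (S x < +oo)%E ->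
      forall F, F = @cos R \/ F = @sin R ->
      cvgn (truncated_oscillation F x t g) /\
      forall N, ((truncated_oscillation F x t g N ^+ 2)%:E <= S x)%E].
Proof.
have [e [B [e0 es B0 main]]] := dyadic_maximal_bound m1 kappa01 alpha0 c0 C10 C20
  nu_ball gamma_holder gamma_bilip hs.
(* Half of the gain [2 * s - e]: each piece is then bounded by q^(2 k) times the Sobolev energy. *)
pose q : R := 2 `^ ((e - 2 * s) / 2).
have q0 : 0 < q by rewrite powR_gt0.
have q1 : q < 1.
  rewrite -(powRr0 2) /q /powR (gt_eqF (ltr0n _ 2)) ltr_expR ltr_pM2r ?ln_gt0 ?ltr1n//; lra.
have q01 : 0 < q < 1 by rewrite q0.
have q1' : 0 < 1 - q by rewrite subr_gt0.
have q2 : q ^+ 2 * 2 `^ (2 * s) = 2 `^ e :> R.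
  rewrite -powR_mulrn ?powR_ge0// -powRrM -powRD ?pnatr_eq0 ?implybT//.
  by congr (_ `^ _); field.
(* One factor 1 / (1 - q) comes from integrating the majorant, the other from [dyadic_cvg]. *)
pose C := (B * 2 `^ (2 * s) + 1) / (1 - q) ^+ 2.
exists C; first by rewrite divr_ge0 ?sqr_ge0// addr_ge0// mulr_ge0 ?powR_ge0// ltW.
move=> g eta mg ig eta0.
have mw : measurable_fun setT sobolev_weight.
  apply: (measurableT_comp (measurable_powR s)).
  by apply: measurable_funD => //; exact: measurable_funX.
have mg2 : measurable_fun setT (fun xi => g xi ^+ 2) by exact: measurable_funX.
have mwg : measurable_fun setT (fun xi => sobolev_weight xi * g xi ^+ 2).
  exact: measurable_funM.
have ig2 : leb.-integrable setT (fun xi => (g xi ^+ 2)%:E).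
  apply: (le_integrable measurableT _ _ ig); first exact/measurable_EFinP.
  move=> xi _ /=; rewrite lee_fin [leRHS]normrM ler_peMl//.
  by rewrite (le_trans _ (ler_norm _))// sobolev_weight_ge1.
have lg2 : loc_integrable (fun xi => g xi ^+ 2).
  by move=> b; apply: (integrableS measurableT) ig2.
have lg : loc_integrable g by exact: loc_integrable_of_sqr.
set M := \int[leb]_xi (sobolev_weight xi * g xi ^+ 2).
have M0 : 0 <= M.
  by apply: Rintegral_ge0 => xi _; rewrite mulr_ge0 ?sqr_ge0// (le_trans ler01 (sobolev_weight_ge1 xi)).
(* Errors of size q^(2 k) remain summable after the division by q^k. *)
have etak k : 0 < eta * (q ^+ 2) ^+ k by rewrite mulr_gt0 ?exprn_gt0.
have [F HF] := choice (fun k => main g k _ mg lg2 (etak k)).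
have FI k : \int[nu]_x F k x <= (B * 2 `^ (2 * s) * M + eta) * (q ^+ 2) ^+ k.
  have [_ _ _ h] := HF k; apply: (le_trans h).
  rewrite mulrDl lerD2r -q2 exprMn.
  set I := \int[leb]_xi _.
  have -> : B * ((q ^+ 2) ^+ k * (2 `^ (2 * s)) ^+ k) * I =
    (B * (q ^+ 2) ^+ k) * ((2 `^ (2 * s)) ^+ k * I) by ring.
  have -> : B * 2 `^ (2 * s) * M * (q ^+ 2) ^+ k =
    (B * (q ^+ 2) ^+ k) * (2 `^ (2 * s) * M) by ring.
  rewrite ler_pM2l ?mulr_gt0 ?exprn_gt0// {}/I.
  rewrite /M -!RintegralZl//; last 1 first.
    exact: (integrable_annulus _ _ mg2 lg2).
  apply: le_Rintegral => //.
  - apply: (@integrableZl _ _ _ leb setT measurableT _ (fun xi => (annulus _ _ xi * g xi ^+ 2)%:E)).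
    exact: (integrable_annulus _ _ mg2 lg2).
  - exact: (@integrableZl _ _ _ leb setT measurableT _ (fun xi => (sobolev_weight xi * g xi ^+ 2)%:E)).
  move=> xi _; rewrite [leLHS]mulrA [leRHS]mulrA ler_wpM2r ?sqr_ge0// mulrC.
  exact: dyadic_sobolev_weight.
have bF k : bounded_measurable (F k) by have [] := HF k.
have F0 k x : 0 <= F k x by have [] := HF k.
pose G := geometric_majorant F q.
have i0 : 0 <= (1 - q)^-1 by rewrite invr_ge0 ltW.
have G0 x : (0 <= G x)%E by exact: geometric_majorant_ge0.
have mG : measurable_fun setT G by exact: measurable_geometric_majorant.
exists (fun x => (1 - q)^-1%:E * G x)%E; split.
- by apply: measurable_funeM.
- by move=> x; rewrite mule_ge0.
- rewrite ge0_integralZl_EFin//.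
  apply: (@le_trans _ _ ((1 - q)^-1%:E * ((B * 2 `^ (2 * s) * M + eta) / (1 - q))%:E)%E).
    rewrite lee_pmul2l ?lte_fin ?invr_gt0//.
    exact: integral_geometric_majorant.
  rewrite -EFinM lee_fin /C.
  have -> : (1 - q)^-1 * ((B * 2 `^ (2 * s) * M + eta) / (1 - q)) =
    (B * 2 `^ (2 * s) * M + eta) / (1 - q) ^+ 2 by field; rewrite gt_eqF.
  rewrite [leRHS]mulrAC ler_pM2r ?invr_gt0 ?exprn_gt0//.
  have : 0 <= B * 2 `^ (2 * s) * eta by rewrite !mulr_ge0 ?powR_ge0 ?(ltW B0) ?(ltW eta0).
  by move: M0; rewrite /M; lra.
move=> x t x1 t1 Soo trig htrig.
have Goo : (G x < +oo)%E.
  rewrite ltey; apply: contraTneq Soo => ->.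
  by rewrite gt0_muley ?lte_fin ?invr_gt0// ltxx.
have mtrig : measurable_fun setT trig.
  by case: htrig => ->; apply: continuous_measurable_fun;
    [exact: continuous_cos|exact: continuous_sin].
have trig1 a : `|trig a| <= 1.
  by case: htrig => ->; rewrite ler_norml ?cos_geN1 ?cos_le1 ?sin_geN1 ?sin_le1.
pose f xi := trig (full_phase m 0 (gamma x t) t xi) * g xi.
have mf : measurable_fun setT f.
  apply: measurable_funM => //; apply: measurableT_comp => //; exact: measurable_full_phase.
have lf : loc_integrable f.
  apply: loc_integrableM => //; apply: measurableT_comp => //.
  exact: measurable_full_phase.
pose a k (b : nat) := \int[lebesgue_itv (- piece_hi R k) (piece_hi R k)]_xi
    (annulus (piece_lo R k) b%:R xi * f xi).
have [||||cv bd] := @dyadic_cvg R (truncated_oscillation trig x t g) a (fun k => F k x) q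
   (fine (G x)).
- by [].
- move=> N K NK; rewrite /truncated_oscillation -/f.
  exact: (Rintegral_dyadic_annuli mf lf NK).
- move=> k b bk; have [_ _ h _] := HF k; apply: le_trans (h x t b bk x1 t1).
  have aE : a k b = \int[lebesgue_itv (- piece_hi R k) (piece_hi R k)]_xi
    (annulus (piece_lo R k) b%:R xi * trig (full_phase m 0 (gamma x t) t xi) * g xi).
    by apply: eq_Rintegral => xi _; rewrite /f mulrA.
  rewrite aE; case: htrig => ->; first by rewrite lerDl sqr_ge0.
  by rewrite lerDr sqr_ge0.
- by move=> i; exact: geometric_majorant_ge.
split => // N; rewrite -[G x]fineK ?ge0_fin_numE// -EFinM lee_fin mulrC.
exact: bd.
Qed.

End dyadic_maximal.

(** * A window with an integrable transform *)

Section parabolic_kernel.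
Variable R : realType.
Variables (L : R) (L0 : 0 < L).
Local Notation leb := (@lebesgue_measure R).

(** A sharp cutoff has a transform of order 1 / u, not absolutely integrable; the zeros of this
    window at both ends of [-L, L] improve the decay to u^-2. *)
Definition parabola (z : R) : R := 1 - z ^+ 2 / L ^+ 2.

Lemma parabola_itv z : `|z| <= L -> 0 <= parabola z <= 1.
Proof.
move=> zL; rewrite /parabola subr_ge0 gerBl divr_ge0 ?sqr_ge0//.
rewrite ler_pdivrMr ?exprn_gt0// mul1r andbT -real_normK ?num_real//.
by apply: lerXn2r => //; rewrite nnegrE ltW.
Qed.

Let cphase (u theta z : R) : {for z, continuous (fun z => cos (u * z + theta))}.
Proof.
apply: (@continuous_comp _ _ _ (fun z => u * z + theta) (@cos R)); last exact: continuous_cos.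
by apply: continuousD; [apply: continuousM; [exact: cvg_cst|exact: cvg_id]|exact: cvg_cst].
Qed.

Lemma continuous_parabola z : {for z, continuous parabola}.
Proof.
apply: continuousB; first exact: cvg_cst.
apply: continuousM; last exact: cvg_cst.
exact: exprn_continuous.
Qed.

(* Two integrations by parts. *)
Lemma parabola_cos_decay (u theta : R) : u != 0 ->
  `|\int[leb]_(z in `[- L, L]) (parabola z * cos (u * z + theta))| <= 8 / (L * u ^+ 2).
Proof.
move=> u0; have Ln0 : L != 0 by rewrite gt_eqF.
pose F z := parabola z * (u^-1 * sin (u * z + theta)) +
  (- 2 / (L ^+ 2 * u ^+ 2)) * (z * cos (u * z + theta)) +
  2 / (L ^+ 2 * u ^+ 3) * sin (u * z + theta).
have LNL : - L <= L by rewrite ge0_cp// ltW.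
have dF z : - L <= z <= L -> is_derive z 1 F (parabola z * cos (u * z + theta)).
  move=> _.
  have dp : is_derive z 1 (fun z => u * z + theta) u.
    have d := is_deriveD (is_deriveZ u (is_derive_id z 1)) (is_derive_cst theta z 1).
    by apply: (is_derive_eq d); rewrite /GRing.scale /= mulr1 addr0.
  have ds : is_derive z 1 (fun z => sin (u * z + theta)) (cos (u * z + theta) * u).
    exact: (@is_derive1_comp _ (@sin R) (fun z => u * z + theta)).
  have dc : is_derive z 1 (fun z => cos (u * z + theta)) (- sin (u * z + theta) * u).
    exact: (@is_derive1_comp _ (@cos R) (fun z => u * z + theta)).
  have d2 : is_derive z 1 parabola (0 - (L ^+ 2)^-1 * (z * 1 + z * 1)).
    have d := is_deriveB (is_derive_cst (1 : R) z 1)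
      (is_deriveZ (L ^+ 2)^-1 (is_deriveM (is_derive_id z 1) (is_derive_id z 1))).
    rewrite (_ : parabola = cst 1 - (L ^+ 2)^-1 \*: (id * id)); first exact: d.
    by apply/funext => y; rewrite /parabola !fctE /GRing.scale /= expr2 mulrC.
  have d := is_deriveD (is_deriveD (is_deriveM d2 (is_deriveZ u^-1 ds))
    (is_deriveZ (- 2 / (L ^+ 2 * u ^+ 2)) (is_deriveM (is_derive_id z 1) dc)))
    (is_deriveZ (2 / (L ^+ 2 * u ^+ 3)) ds).
  apply: (is_derive_eq d); rewrite /parabola /GRing.scale /= /GRing.scale /=.
  by field; rewrite Ln0 u0.
have cf z : - L <= z <= L -> {for z, continuous (fun z => parabola z * cos (u * z + theta))}.
  move=> _; apply: continuousM; first exact: continuous_parabola.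
  exact: cphase.
(* The window vanishes at both endpoints, which removes the boundary terms of order 1 / u. *)
rewrite (Rintegral_itv_derive LNL dF cf) /F /parabola sqrrN divff ?expf_neq0//.
rewrite subrr !mul0r !add0r.
set c1 := cos _; set s1 := sin (u * L + theta); set c2 := cos _; set s2 := sin _.
have hc1 : `|c1| <= 1 by rewrite ler_norml cos_geN1 cos_le1.
have hc2 : `|c2| <= 1 by rewrite ler_norml cos_geN1 cos_le1.
(* The Lipschitz bound wins back a power of u in the boundary term of order u^-3, which then matches
   the one of order u^-2. *)
have hs : `|s1 - s2| <= 2 * `|u| * L.
  apply: (le_trans (sin_lipschitz _ _)).
  have -> : u * L + theta - (u * - L + theta) = 2 * u * L by ring.
  by rewrite !normrM normr_nat (gtr0_norm L0).
have -> : - 2 / (L ^+ 2 * u ^+ 2) * (L * c1) + 2 / (L ^+ 2 * u ^+ 3) * s1 -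
  (- 2 / (L ^+ 2 * u ^+ 2) * (- L * c2) + 2 / (L ^+ 2 * u ^+ 3) * s2) =
  - (2 / (L * u ^+ 2)) * (c1 + c2) + 2 / (L ^+ 2 * u ^+ 3) * (s1 - s2).
  by field; rewrite Ln0 u0.
have u2 : 0 < L * u ^+ 2 by rewrite mulr_gt0// exprn_even_gt0.
apply: (le_trans (ler_normD _ _)).
have -> : 8 / (L * u ^+ 2) = 2 / (L * u ^+ 2) * 2 + 4 / (L * u ^+ 2) by field; rewrite Ln0 u0.
apply: lerD.
  have p0 : 0 <= 2 / (L * u ^+ 2) by rewrite divr_ge0// ltW.
  rewrite normrM normrN (ger0_norm p0).
  rewrite ler_wpM2l// (le_trans (ler_normD _ _))//; lra.
rewrite normrM; apply: (le_trans (ler_wpM2l (normr_ge0 _) hs)).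
have un0 : `|u| != 0 by rewrite normr_eq0.
rewrite normrM normfV normrM !normrX normr_nat (gtr0_norm L0).
rewrite -(real_normK (num_real u)) le_eqVlt; apply/orP; left; apply/eqP.
by field; rewrite Ln0 un0.
Qed.

(** At |L u| = 2 the trivial bound 2 L, the decay bound 8 / (L u^2) and the right-hand side
    coincide; this fixes both the threshold and the constant 10. *)
Lemma parabola_cos_le (u theta : R) :
  `|\int[leb]_(z in `[- L, L]) (parabola z * cos (u * z + theta))| <=
  10 * L / (1 + (L * u) ^+ 2).
Proof.
have d0 : 0 < 1 + (L * u) ^+ 2 by rewrite ltr_wpDr ?sqr_ge0.
have [Lu|Lu] := leP (`|L * u|) 2; last first.
  have u0 : u != 0 by apply: contraTneq Lu => ->; rewrite mulr0 normr0 -leNgt.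
  apply: (le_trans (parabola_cos_decay _ u0)).
  have u2 : 0 < u ^+ 2 by rewrite exprn_even_gt0.
  rewrite ler_pdivrMr; last exact: mulr_gt0.
  rewrite [leRHS]mulrAC ler_pdivlMr//.
  have : 4 <= (L * u) ^+ 2.
    rewrite -[leRHS]real_normK ?num_real// (_ : 4 = 2 ^+ 2); last by ring.
    by apply: lerXn2r; rewrite ?nnegrE// ltW.
  by rewrite exprMn => ?; lra.
apply: (@le_trans _ _ (2 * L)).
  have ig : leb.-integrable `[- L, L] (EFin \o (fun z => parabola z * cos (u * z + theta))).
    apply: continuous_itv_integrable => z _; apply: continuousM; first exact: continuous_parabola.
    exact: cphase.
  apply: (le_trans (le_normr_Rintegral _ ig)) => //.
  have -> : 2 * L = 1 * (L - - L) by ring.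
  apply: Rintegral_itv_le_cst; first by rewrite ge0_cp// ltW.
    exact: integrable_norm.
  move=> z; rewrite -ler_norml => /parabola_itv /andP[p0 p1].
  by rewrite normrM -[leRHS]mulr1 ler_pM//; [rewrite ger0_norm|rewrite ler_norml cos_geN1 cos_le1].
rewrite ler_pdivlMr//.
have : (L * u) ^+ 2 <= 4.
  rewrite -[leLHS]real_normK ?num_real// (_ : 4 = 2 ^+ 2); last by ring.
  by apply: lerXn2r; rewrite ?nnegrE.
have -> : 10 * L = 2 * L * 5 by ring.
by rewrite ler_pM2l ?mulr_gt0//; lra.
Qed.

End parabolic_kernel.

(** * The L^2 bound for truncated Fourier integrals *)

Section truncated_fourier.
Variable R : realType.
Local Notation leb := (@lebesgue_measure R).

Let mcos : measurable_fun setT (@cos R).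
Proof. by apply: continuous_measurable_fun; exact: continuous_cos. Qed.
Let msin : measurable_fun setT (@sin R).
Proof. by apply: continuous_measurable_fun; exact: continuous_sin. Qed.
Let cos1 (a : R) : `|cos a| <= 1. Proof. by rewrite ler_norml cos_geN1 cos_le1. Qed.
Let sin1 (a : R) : `|sin a| <= 1. Proof. by rewrite ler_norml sin_geN1 sin_le1. Qed.

(** The antiderivative is an arctangent, so the Cauchy kernel has a mass independent of its width 1
    / L: the Schur constant does not feel the truncation. *)
Lemma Rintegral_cauchy_le (L M x : R) : 0 < L -> 0 <= M ->
  \int[leb]_(y in `[- M, M]) (10 * L / (1 + (L * (x - y)) ^+ 2)) <= 10 * pi.
Proof.
move=> L0 M0; have MM : - M <= M by rewrite ge0_cp.
pose F y := 10 * atan (L * (y - x)).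
have dF y : - M <= y <= M -> is_derive y 1 F (10 * L / (1 + (L * (x - y)) ^+ 2)).
  move=> _.
  have dp : is_derive y 1 (fun y => L * (y - x)) L.
    have d := is_deriveZ L (is_deriveB (is_derive_id y 1) (is_derive_cst x y 1)).
    by apply: (is_derive_eq d); rewrite /GRing.scale /= subr0 mulr1.
  have da : is_derive y 1 (fun y => atan (L * (y - x))) ((1 + (L * (y - x)) ^+ 2)^-1 * L).
    exact: (@is_derive1_comp _ (@atan R) (fun y => L * (y - x))).
  apply: (is_derive_eq (is_deriveZ 10 da)); rewrite /GRing.scale /=.
  have -> : (L * (y - x)) ^+ 2 = (L * (x - y)) ^+ 2 by ring.
  by rewrite mulrA mulrAC.
have cf y : - M <= y <= M -> {for y, continuous (fun y => 10 * L / (1 + (L * (x - y)) ^+ 2))}.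
  move=> _; apply: continuousM; first exact: cvg_cst.
  apply: continuousV; first by rewrite gt_eqF// ltr_wpDr ?sqr_ge0.
  apply: continuousD; first exact: cvg_cst.
  apply: (@continuous_comp _ _ _ (fun y => L * (x - y)) (fun z : R => z ^+ 2)); last exact: exprn_continuous.
  apply: continuousM; first exact: cvg_cst.
  by apply: continuousB; [exact: cvg_cst|exact: cvg_id].
rewrite (Rintegral_itv_derive MM dF cf) /F -mulrBr ler_pM2l//.
have := atan_ltpi2 (L * (M - x)); have := atan_gtNpi2 (L * (- M - x)); lra.
Qed.

(** TT^* with frequencies in [-M, M] on one side and positions in [-L, L] on the other; its kernel
    is the transform of the parabolic window. *)
Lemma truncated_fourier_bound (M N : R) (h : R -> R) : 0 <= M -> 0 <= N ->
  measurable_fun setT h -> loc_integrable (fun x => h x ^+ 2) ->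
  \int[leb]_(xi in `[- M, M])
    ((\int[leb]_(x in `[- N, N]) (cos (x * xi) * h x)) ^+ 2 +
     (\int[leb]_(x in `[- N, N]) (sin (x * xi) * h x)) ^+ 2) <=
  60 * pi * \int[leb]_(x in `[- N, N]) (h x ^+ 2).
Proof.
move=> M0 N0 mh ih2.
(* With L > 2 N the window is at least 3 / 4 on |x| <= N, so dividing by it there costs at most 4 /
   3; the [+ 1] keeps L positive for N = 0. *)
pose L := 2 * N + 1; have L0 : 0 < L by rewrite /L; lra.
have NL : N <= L by rewrite /L; lra.
(* Each of the two amplitudes in TT^* carries a square root, so their product is the window; [g]
   below divides by the root and thus restores the sharp cutoff at N. *)
pose a x := Num.sqrt (parabola L x).
have ma : measurable_fun setT a.
  apply: continuous_measurable_fun => x; apply: continuous_comp; last exact: sqrt_continuous.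
  exact: continuous_parabola.
have a0 x : 0 <= a x by exact: sqrtr_ge0.
have a1 x : `|a x| <= 1.
  rewrite ger0_norm// -[leRHS]sqrtr1 ler_wsqrtr// /parabola gerBl.
  by rewrite divr_ge0 ?sqr_ge0.
have aN x : `|x| <= N -> 3 / 4 <= a x ^+ 2.
  move=> xN; have xL : `|x| <= L by exact: le_trans NL.
  have /andP[p0 _] := parabola_itv L0 xL.
  rewrite sqr_sqrtr// /parabola.
  have : x ^+ 2 / L ^+ 2 <= 1 / 4; last by lra.
  rewrite ler_pdivrMr ?exprn_gt0//.
  have : x ^+ 2 <= N ^+ 2.
    by rewrite -real_normK ?num_real//; apply: lerXn2r; rewrite ?nnegrE.
  by have := sqr_ge0 N; rewrite /L; nra.
pose amp (F : R -> R) (p : measurableTypeR R * measurableTypeR R) : R := a p.2 * F (p.2 * p.1).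
have bamp (F : R -> R) : measurable_fun setT F -> (forall x, `|F x| <= 1) -> bounded_measurable (amp F).
  move=> mF F1; split; last first.
    by exists 1 => p; rewrite normrM -[leRHS]mulr1 ler_pM.
  apply: measurable_funM.
    by apply: (@measurableT_comp _ _ _ _ _ _ a) => //; exact: measurable_snd.
  apply: (@measurableT_comp _ _ _ _ _ _ F) => //.
  by apply: measurable_funM; [exact: measurable_snd|exact: measurable_fst].
pose k (p : measurableTypeR R * measurableTypeR R) := 10 * L / (1 + (L * (p.1 - p.2)) ^+ 2).
have ck y : {for y, continuous (fun u : R => 10 * L / (1 + (L * u) ^+ 2))}.
  apply: continuousM; first exact: cvg_cst.
  apply: continuousV; first by rewrite gt_eqF// ltr_wpDr ?sqr_ge0.
  apply: continuousD; first exact: cvg_cst.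
  apply: (@continuous_comp _ _ _ (fun y => L * y) (fun z : R => z ^+ 2)); last exact: exprn_continuous.
  by apply: continuousM; [exact: cvg_cst|exact: cvg_id].
have mk1 : measurable_fun [set: measurableTypeR R] (fun u : R => 10 * L / (1 + (L * u) ^+ 2)).
  by apply: continuous_measurable_fun => y; exact: ck.
have bk : bounded_measurable k.
  split.
    apply: (@measurableT_comp _ _ _ _ _ _ (fun u : R => 10 * L / (1 + (L * u) ^+ 2))) => //.
    by apply: measurable_funB; [exact: measurable_fst|exact: measurable_snd].
  exists (10 * L) => p; have d0 : 1 <= 1 + (L * (p.1 - p.2)) ^+ 2 by rewrite lerDl sqr_ge0.
  have d0' : 0 < 1 + (L * (p.1 - p.2)) ^+ 2 by exact: lt_le_trans d0.
  rewrite /k ger0_norm; last by rewrite divr_ge0 ?mulr_ge0 ?(ltW L0) ?(ltW d0').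
  by rewrite ler_pdivrMr// ler_peMr// mulr_ge0// ltW.
pose g x := annulus (-1) N x * (h x / a x).
have mg : measurable_fun [set: measurableTypeR R] g.
  apply: measurable_funM; first exact: measurable_annulus.
  apply: measurable_funM => //; under eq_fun do rewrite -powR_inv1//.
  exact: (measurableT_comp (measurable_powR _)).
have g2 x : g x ^+ 2 <= 4 / 3 * (annulus (-1) N x * h x ^+ 2).
  rewrite /g /annulus; case: (boolP (_ && _)) => [/andP[_ xN]|_] /=; last by rewrite !mul0r expr0n mulr0.
  have ha := aN _ xN; rewrite !mul1r exprMn exprVn ler_pdivrMr; last by lra.
  by have := sqr_ge0 (h x); nra.
have mh2 : measurable_fun setT (fun x => h x ^+ 2) by exact: measurable_funX.
have i1 : (lebesgue_itv (- L) L).-integrable setT (fun x => (4 / 3 * (annulus (-1) N x * h x ^+ 2))%:E).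
  have mF : measurable_fun [set: measurableTypeR R] (fun x => 4 / 3 * (annulus (-1) N x * h x ^+ 2)).
    by apply: measurable_funM => //; apply: measurable_funM => //; exact: measurable_annulus.
  apply/integrable_lebesgue_itv; first exact/measurable_EFinP.
  apply: (@integrableS _ _ _ leb setT) => //.
  apply: (@integrableZl _ _ _ leb setT measurableT _ (fun xi => (annulus _ _ xi * h xi ^+ 2)%:E)).
  exact: integrable_annulus.
have ig2 : (lebesgue_itv (- L) L).-integrable setT (fun x => (g x ^+ 2)%:E).
  apply: (le_integrable measurableT _ _ i1).
    by apply/measurable_EFinP; exact: measurable_funX.
  by move=> x _ /=; rewrite lee_fin ger0_norm ?sqr_ge0// (le_trans (g2 x))// ler_norm.
have kint x y theta : `|\int[lebesgue_itv (- L) L]_z (a z ^+ 2 * cos ((x - y) * z + theta))| <= k (x, y).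
  rewrite Rintegral_lebesgue_itv; last first.
    apply: measurable_funM; first exact: measurable_funX.
    apply: (@measurableT_comp _ _ _ _ _ _ (@cos R)) => //.
    by apply: measurable_funD => //; exact: measurable_funM.
  apply: le_trans (parabola_cos_le L0 (x - y) theta).
  rewrite le_eqVlt; apply/orP; left; apply/eqP; congr (`|_|); apply: eq_Rintegral => z.
  rewrite inE /= in_itv /= -ler_norml => /(parabola_itv L0) /andP[p0 _].
  by rewrite sqr_sqrtr.
have ampE (F : R -> R) xi : measurable_fun setT F ->
  \int[leb]_(x in `[- N, N]) (F (x * xi) * h x) =
  \int[lebesgue_itv (- L) L]_x (amp F (xi, x) * g x).
  move=> mF; have mFh : measurable_fun setT (fun x : R => F (x * xi) * h x).
    apply: measurable_funM => //; apply: (@measurableT_comp _ _ _ _ _ _ F) => //.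
    exact: measurable_funM.
  rewrite Rintegral_annulus_ball// -(Rintegral_annulus _ mFh NL); apply: eq_Rintegral => x _.
  rewrite /amp /g /annulus; case: (boolP (_ && _)) => [/andP[_ xN]|_] /=; last by rewrite !mul0r mulr0.
  have ha := aN _ xN; have anz : a x != 0.
    by apply: contraTneq ha => ->; rewrite expr0n -ltNge divr_gt0.
  by field.
have tts : \int[lebesgue_itv (- M) M]_xi
    ((\int[lebesgue_itv (- L) L]_x (amp (@cos R) (xi, x) * g x)) ^+ 2 +
     (\int[lebesgue_itv (- L) L]_x (amp (@sin R) (xi, x) * g x)) ^+ 2) <=
    4 * (10 * pi) * \int[lebesgue_itv (- L) L]_x (g x ^+ 2).
  apply: (@ttstar _ _ _ _ R (lebesgue_itv (- M) M) (lebesgue_itv (- L) L)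
    (amp (@cos R)) (amp (@sin R)) k (10 * pi)) => //.
  - exact: bamp.
  - exact: bamp.
  - by move=> x y; rewrite /k /=; congr (_ / (1 + _)); ring.
  - move=> x y; apply: le_trans (kint x y 0).
    rewrite le_eqVlt; apply/orP; left; apply/eqP; congr (`|_|); apply: eq_Rintegral => z _.
    have -> : (x - y) * z + 0 = z * x - z * y by ring.
    by rewrite cosB /amp /=; ring.
  - move=> x y; have -> : k (x, y) = k (y, x) by rewrite /k /=; congr (_ / (1 + _)); ring.
    apply: le_trans (kint y x (- (pi / 2))).
    rewrite le_eqVlt; apply/orP; left; apply/eqP; congr (`|_|); apply: eq_Rintegral => z _.
    have -> : (y - x) * z + - (pi / 2) = (z * y - z * x) - pi / 2 by ring.
    by rewrite cosBpihalf sinB /amp /=; ring.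
  - by rewrite mulr_gt0 ?pi_gt0.
  - move=> x; rewrite Rintegral_lebesgue_itv; last exact: (bounded_measurable_pair1 bk x).1.
    exact: Rintegral_cauchy_le.
have mop (F : R -> R) : measurable_fun setT F -> (forall x, `|F x| <= 1) -> measurable_fun setT
    (fun xi : measurableTypeR R => \int[lebesgue_itv (- L) L]_x (amp F (xi, x) * g x)).
  move=> mF F1.
  exact: (bounded_measurable_operator (lebesgue_itv (- M) M) mg ig2 (bamp F mF F1)).1.
under eq_Rintegral do rewrite !ampE//.
rewrite -Rintegral_lebesgue_itv; last first.
  by apply: measurable_funD; apply: measurable_funX; exact: mop.
apply: (le_trans tts).
have gI : \int[lebesgue_itv (- L) L]_x (g x ^+ 2) <= 4 / 3 * \int[leb]_(x in `[- N, N]) (h x ^+ 2).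
  rewrite Rintegral_annulus_ball// -(Rintegral_annulus _ mh2 NL) -RintegralZl//.
    by apply: le_Rintegral => // x _; exact: g2.
  apply/integrable_lebesgue_itv.
    apply/measurable_EFinP; apply: measurable_funM => //; exact: measurable_annulus.
  apply: (@integrableS _ _ _ leb setT) => //; exact: integrable_annulus.
have I0 : 0 <= \int[leb]_(x in `[- N, N]) (h x ^+ 2).
  by apply: Rintegral_ge0 => x _; exact: sqr_ge0.
have p0 : 0 <= pi :> R by exact: pi_ge0.
move: gI I0; set A := \int[lebesgue_itv (- L) L]_x _; set B := \int[leb]_(x in _) _ => gI I0.
(* The factors are 4 from TT^*, 10 pi from Schur's test and 4 / 3 from the window; the product 160
   pi / 3 is rounded up to 60 pi. *)
apply: (@le_trans _ _ (4 * (10 * pi) * (4 / 3 * B))); first by rewrite ler_wpM2l// !mulr_ge0.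
have -> : 60 * pi * B = 4 * (10 * pi) * (4 / 3 * B) + 20 / 3 * (pi * B) by field.
by rewrite lerDl !mulr_ge0.
Qed.

End truncated_fourier.

(** * Energies and the transform of complex functions *)

Section energy.
Variable R : realType.
Local Notation leb := (@lebesgue_measure R).
Implicit Types (f g h : R -> R[i]).

Definition sqmod (z : R[i]) : R := complex.Re z ^+ 2 + complex.Im z ^+ 2.

Lemma sqmod_ge0 z : 0 <= sqmod z.
Proof. by rewrite addr_ge0 ?sqr_ge0. Qed.

Lemma cabs_sqr z : cabs z ^+ 2 = sqmod z.
Proof. by case: z => a b; rewrite /cabs /= sqr_sqrtr// addr_ge0 ?sqr_ge0. Qed.

Definition energy f : \bar R := (\int[leb]_x (sqmod (f x))%:E)%E.

Lemma energy_ge0 f : (0 <= energy f)%E.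
Proof. by apply: integral_ge0 => x _; rewrite lee_fin sqmod_ge0. Qed.

Lemma L2norm_sqr f : (L2norm f `^ 2 = energy f)%E.
Proof.
rewrite /L2norm poweR_Lnorm//; apply: eq_integral => x _.
by rewrite abse_EFin poweR_EFin powR_mulrn// real_normK ?num_real// cabs_sqr.
Qed.

Lemma L2norm_energy f : (L2norm f = energy f `^ (1 / 2))%E.
Proof. by rewrite -L2norm_sqr -poweRrM div1r mulfV// poweRe1// Lnorm_ge0. Qed.

Lemma energy_lty f : inL2 f -> (energy f < +oo)%E.
Proof. by move=> [_ _ fi]; rewrite -L2norm_sqr; exact: poweR_lty. Qed.

Lemma measurable_sqmod f : measurable_fun setT (fun x => complex.Re (f x)) ->
  measurable_fun setT (fun x => complex.Im (f x)) ->
  measurable_fun setT (fun x => sqmod (f x)).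
Proof. by move=> mr mi; apply: measurable_funD; exact: measurable_funX. Qed.

Lemma inL2_integrable_sqr f : inL2 f ->
  leb.-integrable setT (fun x => (complex.Re (f x) ^+ 2)%:E) /\
  leb.-integrable setT (fun x => (complex.Im (f x) ^+ 2)%:E).
Proof.
move=> fL; have [mr mi _] := fL.
have ie : leb.-integrable setT (fun x => (sqmod (f x))%:E).
  apply/integrableP; split; first by apply/measurable_EFinP; exact: measurable_sqmod.
  move: (energy_lty fL); congr (_ < _)%E; apply: eq_integral => x _.
  by rewrite gee0_abs// lee_fin sqmod_ge0.
split; apply: (le_integrable measurableT _ _ ie).
- by apply/measurable_EFinP; exact: measurable_funX.
- by move=> x _; rewrite lee_fin !ger0_norm ?sqr_ge0 ?sqmod_ge0// lerDl sqr_ge0.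
- by apply/measurable_EFinP; exact: measurable_funX.
- by move=> x _; rewrite lee_fin !ger0_norm ?sqr_ge0 ?sqmod_ge0// lerDr sqr_ge0.
Qed.

Lemma energyE f : inL2 f -> energy f =
  (\int[leb]_x (complex.Re (f x) ^+ 2) + \int[leb]_x (complex.Im (f x) ^+ 2))%:E.
Proof.
move=> fL; have [ir ii] := inL2_integrable_sqr fL.
by rewrite EFinD !fineK ?(integrable_fin_num measurableT)// -integralD.
Qed.

End energy.

Section bounded_fourier.
Variable R : realType.
Local Notation leb := (@lebesgue_measure R).

Lemma bounded_measurable_truncated_integral (F : R -> R) (N : R) (h : R -> R) :
  measurable_fun setT F -> (forall a, `|F a| <= 1) -> measurable_fun setT h ->
  loc_integrable (fun x => h x ^+ 2) ->
  bounded_measurable (fun xi : measurableTypeR R => \int[leb]_(x in `[- N, N]) (F (x * xi) * h x)).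
Proof.
move=> mF F1 mh ih2.
have mh2 : measurable_fun setT (fun x => h x ^+ 2) by exact: measurable_funX.
have ig2 : (lebesgue_itv (- N) N).-integrable setT (fun x => (h x ^+ 2)%:E).
  by apply/integrable_lebesgue_itv; [exact/measurable_EFinP|exact: ih2].
pose amp (p : measurableTypeR R * measurableTypeR R) : R := F (p.2 * p.1).
have bamp : bounded_measurable amp.
  split; last by exists 1 => p; exact: F1.
  apply: (@measurableT_comp _ _ _ _ _ _ F) => //.
  by apply: measurable_funM; [exact: measurable_snd|exact: measurable_fst].
have mh' : measurable_fun [set: measurableTypeR R] h by [].
have := bounded_measurable_operator (lebesgue_itv 0 0) mh' ig2 bamp.
congr bounded_measurable; apply/funext => xi; rewrite Rintegral_lebesgue_itv//.
apply: measurable_funM => //; apply: (@measurableT_comp _ _ _ _ _ _ F) => //.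
exact: (measurable_funM (f := id) (g := cst xi)).
Qed.

Let mcos : measurable_fun setT (@cos R).
Proof. by apply: continuous_measurable_fun; exact: continuous_cos. Qed.
Let msin : measurable_fun setT (@sin R).
Proof. by apply: continuous_measurable_fun; exact: continuous_sin. Qed.
Let cos1 (a : R) : `|cos a| <= 1. Proof. by rewrite ler_norml cos_geN1 cos_le1. Qed.
Let sin1 (a : R) : `|sin a| <= 1. Proof. by rewrite ler_norml sin_geN1 sin_le1. Qed.

Variable h : R -> R[i].
Hypothesis hL : inL2 h.
Let hr x := complex.Re (h x).
Let hi x := complex.Im (h x).
Let mhr : measurable_fun setT hr. Proof. by have [] := hL. Qed.
Let mhi : measurable_fun setT hi. Proof. by have [] := hL. Qed.
Let ihr : leb.-integrable setT (fun x => (hr x ^+ 2)%:E).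
Proof. exact: (inL2_integrable_sqr hL).1. Qed.
Let ihi : leb.-integrable setT (fun x => (hi x ^+ 2)%:E).
Proof. exact: (inL2_integrable_sqr hL).2. Qed.

Let loc2 (u : R -> R) : leb.-integrable setT (fun x => (u x ^+ 2)%:E) ->
  loc_integrable (fun x => u x ^+ 2).
Proof. by move=> iu b; apply: (integrableS measurableT) iu. Qed.

Let T (F : R -> R) (u : R -> R) (N xi : R) := \int[leb]_(x in `[- N, N]) (F (x * xi) * u x).

Let iT (F : R -> R) (u : R -> R) (N xi : R) : measurable_fun setT F ->
  (forall a, `|F a| <= 1) -> measurable_fun setT u ->
  leb.-integrable setT (fun x => (u x ^+ 2)%:E) ->
  leb.-integrable `[- N, N] (EFin \o (fun x => F (x * xi) * u x)).
Proof.
move=> mF F1 mu iu; apply: loc_integrableM => //.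
  by apply: loc_integrable_of_sqr => //; exact: loc2.
apply: (@measurableT_comp _ _ _ _ _ _ F) => //.
exact: (measurable_funM (f := id) (g := cst xi)).
Qed.

Lemma fourier_truncE N xi : fourier_trunc h N xi =
  (T (@cos R) hr N%:R xi + T (@sin R) hi N%:R xi) +i*
  (T (@cos R) hi N%:R xi - T (@sin R) hr N%:R xi).
Proof.
rewrite /fourier_trunc /cintegral /T -RintegralD//; try exact: iT.
rewrite -RintegralB//; try exact: iT.
congr (_ +i* _); apply: eq_Rintegral => x _; rewrite /hr /hi /cis cosN sinN;
  by case: (h x) => a b /=; ring.
Qed.

Lemma measurable_fourier_trunc N :
  measurable_fun setT (fun xi => complex.Re (fourier_trunc h N xi)) /\
  measurable_fun setT (fun xi => complex.Im (fourier_trunc h N xi)).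
Proof.
have m F u := fun mF F1 mu iu =>
  (@bounded_measurable_truncated_integral F N%:R u mF F1 mu (loc2 iu)).1.
split; under eq_fun do rewrite fourier_truncE/=.
  by apply: measurable_funD; exact: m.
by apply: measurable_funB; exact: m.
Qed.

(** The real and imaginary parts of [h] are transformed separately and recombined by (a + b)^2 <= 2
    a^2 + 2 b^2, which doubles 60 pi. *)
Lemma integral_fourier_trunc_le (M : R) (N : nat) : 0 <= M ->
  (\int[leb]_(xi in `[(- M)%R, M]) (sqmod (fourier_trunc h N xi))%:E <=
   (120 * pi)%:E * energy h)%E.
Proof.
move=> M0.
have [mTr mTi] := measurable_fourier_trunc N.
pose U u xi := (T (@cos R) u N%:R xi) ^+ 2 + (T (@sin R) u N%:R xi) ^+ 2.
have bU (u : R -> R) : measurable_fun setT u -> leb.-integrable setT (fun x => (u x ^+ 2)%:E) ->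
    bounded_measurable (U u : measurableTypeR R -> R).
  move=> mu iu; apply: bounded_measurableD; apply: bounded_measurableX;
    by apply: bounded_measurable_truncated_integral => //; exact: loc2.
have U0 u xi : 0 <= U u xi by rewrite addr_ge0 ?sqr_ge0.
have UI (u : R -> R) : measurable_fun setT u -> leb.-integrable setT (fun x => (u x ^+ 2)%:E) ->
    (\int[leb]_(xi in `[(- M)%R, M]) (U u xi)%:E <= (60 * pi * \int[leb]_x (u x ^+ 2))%:E)%E.
  move=> mu iu; have bu := bU u mu iu.
  have iU := bounded_measurable_integrable (lebesgue_itv (- M) M) bu.
  rewrite -integral_lebesgue_itv; last by apply/measurable_EFinP; exact: bu.1.
  rewrite -[leLHS]fineK; last exact: (integrable_fin_num measurableT iU).
  rewrite lee_fin -/(Rintegral (lebesgue_itv (- M) M) setT (U u)).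
  rewrite Rintegral_lebesgue_itv; last exact: bu.1.
  apply: (le_trans (truncated_fourier_bound M0 (ler0n _ N) mu (loc2 iu))).
  apply: ler_wpM2l; first by rewrite mulr_ge0// pi_ge0.
  rewrite -lee_fin !fineK; last 2 first.
  - exact: (integrable_fin_num measurableT iu).
  - by apply: (@integrable_fin_num _ _ _ leb) => //; exact: (loc2 iu).
  apply: ge0_subset_integral => //; last by move=> x _; rewrite lee_fin sqr_ge0.
  by apply/measurable_EFinP; exact: measurable_funX.
apply: (@le_trans _ _ (\int[leb]_(xi in `[(- M)%R, M]) (2 * U hr xi + 2 * U hi xi)%:E)%E).
  apply: ge0_le_integral_nonmeasurable => xi _; rewrite lee_fin ?sqmod_ge0//.
  rewrite fourier_truncE /U; move: (T _ _ _ _) (T _ _ _ _) (T _ _ _ _) (T _ _ _ _) => a b c d.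
  rewrite /sqmod /=.
  by have := sqr_ge0 (a + b); have := sqr_ge0 (c - d); lra.
have mE (u : R -> R) : measurable_fun setT u -> leb.-integrable setT (fun x => (u x ^+ 2)%:E) ->
    measurable_fun `[- M, M] (fun xi => (2 * U u xi)%:E).
  move=> mu iu; apply/measurable_EFinP; apply: measurable_funTS.
  by apply: measurable_funM => //; exact: (bU u mu iu).1.
under eq_integral do rewrite EFinD.
rewrite ge0_integralD//; try exact: mE; last 2 first.
- by move=> xi _; rewrite lee_fin mulr_ge0.
- by move=> xi _; rewrite lee_fin mulr_ge0.
have dbl (u : R -> R) : measurable_fun setT u -> leb.-integrable setT (fun x => (u x ^+ 2)%:E) ->
    (\int[leb]_(xi in `[(- M)%R, M]) (2 * U u xi)%:E <= (120 * pi * \int[leb]_x (u x ^+ 2))%:E)%E.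
  move=> mu iu; under eq_integral do rewrite EFinM.
  rewrite ge0_integralZl_EFin//; last 2 first.
  - by move=> xi _; rewrite lee_fin.
  - by apply/measurable_EFinP; apply: measurable_funTS; exact: (bU u mu iu).1.
  rewrite (_ : 120 * pi * _ = 2 * (60 * pi * \int[leb]_x u x ^+ 2)); last by ring.
  by rewrite EFinM lee_pmul2l//; exact: UI.
rewrite (energyE hL) -EFinM mulrDr EFinD.
by apply: leeD; exact: dbl.
Qed.

End bounded_fourier.

(** * The L^2 bound for the Fourier transform *)

Section plancherel.
Variable R : realType.
Local Notation leb := (@lebesgue_measure R).

Lemma sqmod_le (z w : R[i]) : sqmod z <= 2 * sqmod (z - w) + 2 * sqmod w.
Proof.
case: z => a b; case: w => c d; rewrite /sqmod /=.
by have := sqr_ge0 (a - 2 * c); have := sqr_ge0 (b - 2 * d); lra.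
Qed.

(** The bound for truncated transforms on [-M, M] is uniform in [M] and in the truncation, so it
    passes first to the L^2 limit and then, by monotone convergence, to the whole line. Comparing
    with the limit doubles 120 pi. *)
Lemma is_fourier_energy_le (h G : R -> R[i]) : is_fourier h G ->
  (energy G <= (240 * pi)%:E * energy h)%E.
Proof.
move=> [hL GL cv]; have [mGr mGi _] := GL.
pose T N xi := fourier_trunc h N xi.
have mG := measurable_sqmod mGr mGi.
have mT N : measurable_fun setT (fun xi => sqmod (T N xi)).
  by apply: measurable_sqmod; have [] := measurable_fourier_trunc hL N.
have mD N : measurable_fun setT (fun xi => sqmod (G xi - T N xi)).
  have [tr ti] := measurable_fourier_trunc hL N.
  apply: measurable_sqmod.
    rewrite (_ : (fun x => _) = (fun x => complex.Re (G x) - complex.Re (T N x))).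
      exact: measurable_funB.
    by apply/funext => x; rewrite raddfB.
  rewrite (_ : (fun x => _) = (fun x => complex.Im (G x) - complex.Im (T N x))).
    exact: measurable_funB.
  by apply/funext => x; rewrite raddfB.
have step M N : 0 <= M -> (\int[leb]_(xi in `[(- M)%R, M]) (sqmod (G xi))%:E <=
    (240 * pi)%:E * energy h + 2%:E * energy (fun xi => G xi - T N xi)%R)%E.
  move=> M0.
  apply: (@le_trans _ _ (\int[leb]_(xi in `[(- M)%R, M])
    ((2 * sqmod (T N xi))%:E + (2 * sqmod (G xi - T N xi))%:E))%E).
    apply: ge0_le_integral_nonmeasurable => xi _; rewrite lee_fin ?sqmod_ge0//.
    by rewrite addrC; exact: sqmod_le.
  rewrite ge0_integralD//; last 4 first.
  - by move=> xi _; rewrite lee_fin mulr_ge0 ?sqmod_ge0.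
  - apply/measurable_EFinP; apply: measurable_funTS; apply: measurable_funM => //; exact: mT.
  - by move=> xi _; rewrite lee_fin mulr_ge0 ?sqmod_ge0.
  - apply/measurable_EFinP; apply: measurable_funTS; apply: measurable_funM => //; exact: mD.
  apply: leeD.
    under eq_integral do rewrite EFinM.
    rewrite ge0_integralZl_EFin//; last 2 first.
    - by move=> xi _; rewrite lee_fin sqmod_ge0.
    - by apply/measurable_EFinP; apply: measurable_funTS; exact: mT.
    have -> : (240 * pi)%:E = (2%:E * (120 * pi)%:E)%E :> \bar R.
      by rewrite -EFinM; congr _%:E; ring.
    by rewrite -muleA lee_pmul2l//; exact: integral_fourier_trunc_le.
  under eq_integral do rewrite EFinM.
  rewrite ge0_integralZl_EFin//; last 2 first.
  - by move=> xi _; rewrite lee_fin sqmod_ge0.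
  - by apply/measurable_EFinP; apply: measurable_funTS; exact: mD.
  rewrite lee_pmul2l//; apply: ge0_subset_integral => //.
    by apply/measurable_EFinP; exact: mD.
  by move=> xi _; rewrite lee_fin sqmod_ge0.
have small (eps : R) : 0 < eps -> exists N, (energy (fun xi => G xi - T N xi)%R <= eps%:E)%E.
  move=> eps0; have [finN /cvgrPdist_lt /(_ (Num.sqrt eps))] := (fine_cvgP _ _).1 cv.
  rewrite sqrtr_gt0 => /(_ eps0) ltN.
  have [N _ /(_ N (leqnn N))] : \forall N \near \oo,
      L2norm (fun xi => G xi - fourier_trunc h N xi) \is a fin_num /\
      `|0 - fine (L2norm (fun xi => G xi - fourier_trunc h N xi))| < Num.sqrt eps.
    by near=> N; split; near: N.
  move=> [fN]; rewrite sub0r normrN => lN; exists N.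
  rewrite -L2norm_sqr -[L2norm _]fineK// poweR_EFin lee_fin powR_mulrn ?fine_ge0 ?Lnorm_ge0//.
  rewrite -[leRHS]sqr_sqrtr ?(ltW eps0)//; apply: lerXn2r; rewrite ?nnegrE ?fine_ge0 ?Lnorm_ge0//.
  by rewrite (le_trans (ler_norm _))// ltW.
have bound M : 0 <= M ->
    (\int[leb]_(xi in `[(- M)%R, M]) (sqmod (G xi))%:E <= (240 * pi)%:E * energy h)%E.
  move=> M0; apply/lee_addgt0Pr => eps eps0.
  have [|N hN] := small (eps / 2); first by rewrite divr_gt0.
  apply: (le_trans (step M N M0)); apply: leeD => //.
  by rewrite (_ : eps = 2 * (eps / 2)) ?EFinM ?lee_pmul2l//; field.
have UT : \bigcup_i `[(- i%:R)%R, i%:R]%classic = [set: R].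
  rewrite -subTset => x _; exists (Num.Def.archi_bound `|x|) => //=.
  by rewrite in_itv /= -ler_norml; apply/ltW/archi_boundP.
have cvM : (\int[leb]_(xi in `[(- i%:R)%R, i%:R]) (sqmod (G xi))%:E)%E @[i --> \oo] --> energy G.
  rewrite /energy -UT; apply: ge0_nondecreasing_set_cvg_integral => //.
  - move=> i j ij; rewrite subsetEset; apply: subset_itv; rewrite bnd_simp ?lerN2 ler_nat//.
  - by move=> i; apply/measurable_EFinP; apply: measurable_funTS.
  - by move=> i x _; rewrite lee_fin sqmod_ge0.
rewrite -(cvg_lim _ cvM)//; apply: lime_le; first by apply/cvg_ex; exists (energy G).
by near=> i; exact: bound.
Unshelve. all: by end_near.
Qed.

End plancherel.

(** * The maximal estimate for the evolution operator *)

Section schrodinger_maximal.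
Variables (R : realType) (m kappa alpha c C1 C2 s : R).
Variable gamma : R -> R -> R.
Variable nu : {finite_measure set (measurableTypeR R) -> \bar R}.
Hypotheses (m1 : 1 < m) (kappa01 : 0 < kappa <= 1) (alpha0 : 0 < alpha) (c0 : 0 <= c)
  (C10 : 0 < C1) (C20 : 0 < C2).
Hypothesis nu_ball : forall x r : R, 0 < r -> (nu (ball x r) <= (c * r `^ alpha)%:E)%E.
Hypothesis gamma_holder : forall x t t', `|t| <= 1 -> `|t'| <= 1 ->
  `|gamma x t - gamma x t'| <= C1 * `|t - t'| `^ kappa.
Hypothesis gamma_bilip : forall t x x', `|t| <= 1 ->
  C2^-1 * `|x - x'| <= `|gamma x t - gamma x' t| <= C2 * `|x - x'|.
Hypothesis hs :
  Num.max (1 / 4) (Num.max ((1 - alpha) / 2) ((1 - m * alpha * kappa) / 2)) < s.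
Local Notation leb := (@lebesgue_measure R).

Let mcos : measurable_fun setT (@cos R).
Proof. by apply: continuous_measurable_fun; exact: continuous_cos. Qed.
Let msin : measurable_fun setT (@sin R).
Proof. by apply: continuous_measurable_fun; exact: continuous_sin. Qed.
Let cos1 (a : R) : `|cos a| <= 1. Proof. by rewrite ler_norml cos_geN1 cos_le1. Qed.
Let sin1 (a : R) : `|sin a| <= 1. Proof. by rewrite ler_norml sin_geN1 sin_le1. Qed.

Let osc F x t u := truncated_oscillation m gamma F x t u.

Lemma schrodinger_truncE (f : R -> R[i]) x t N :
  (forall (b : R), leb.-integrable `[- b, b] (EFin \o (fun xi => complex.Re (fourier f xi)))) ->
  (forall (b : R), leb.-integrable `[- b, b] (EFin \o (fun xi => complex.Im (fourier f xi)))) ->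
  measurable_fun setT (fun xi => complex.Re (fourier f xi)) ->
  measurable_fun setT (fun xi => complex.Im (fourier f xi)) ->
  schrodinger_trunc m t f (gamma x t) N =
  ((2 * pi)^-1 * (osc (@cos R) x t (fun xi => complex.Re (fourier f xi)) N -
     osc (@sin R) x t (fun xi => complex.Im (fourier f xi)) N)) +i*
  ((2 * pi)^-1 * (osc (@cos R) x t (fun xi => complex.Im (fourier f xi)) N +
     osc (@sin R) x t (fun xi => complex.Re (fourier f xi)) N)).
Proof.
move=> ir ii mr mi.
have iF (F u : R -> R) : measurable_fun setT F -> (forall a, `|F a| <= 1) ->
    measurable_fun setT u -> loc_integrable u ->
    leb.-integrable `[- N%:R, N%:R]
      (EFin \o (fun xi => F (full_phase m 0 (gamma x t) t xi) * u xi)).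
  move=> mF F1 mu iu; apply: loc_integrableM => //.
  by apply: measurableT_comp => //; exact: measurable_full_phase.
rewrite /schrodinger_trunc /cintegral /osc /truncated_oscillation.
rewrite -RintegralD//; try exact: iF.
rewrite -RintegralB//; try exact: iF.
have -> (p a b : R) : p%:C * (a +i* b) = (p * a) +i* (p * b).
  by rewrite /GRing.mul /= !mul0r subr0 addr0.
congr ((_ * _) +i* (_ * _)); apply: eq_Rintegral => xi _;
  by rewrite /full_phase add0r; case: (fourier f xi) => a b /=; ring.
Qed.

Lemma schrodinger_maximal : exists2 C : R, 0 <= C &
  forall (f : R -> R[i]) (eta : R), inHs s f -> 0 < eta ->
  exists S : measurableTypeR R -> \bar R, [/\ measurable_fun setT S,
    forall x, (0 <= S x)%E,
    (\int[nu]_x S x <= C%:E * energy (bessel s f) + eta%:E)%E &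
    forall x t, `|x| <= 1 -> `|t| <= 1 -> (S x < +oo)%E ->
      schrodinger_defined m t f (gamma x t) /\
      ((cabs (schrodinger m t f (gamma x t)) ^+ 2)%:E <= S x)%E].
Proof.
have [C C0 main] := dyadic_maximal m1 kappa01 alpha0 c0 C10 C20 nu_ball
  gamma_holder gamma_bilip hs.
exists (C * (240 * pi)); first by rewrite !mulr_ge0// pi_ge0.
move=> f eta [fL hf] eta0.
have hb : is_fourier (bessel s f)
    (fun xi => ((1 + xi ^+ 2) `^ (s / 2))%:C * fourier f xi).
  exact: (xgetPex (fun=> 0) hf).
set w := fun xi : R => (1 + xi ^+ 2) `^ (s / 2).
set G := fun xi => (w xi)%:C * fourier f xi.
have [_ GL _] := hb; have [mGr mGi _] := GL.
have [iGr iGi] := inL2_integrable_sqr GL.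
have w0 xi : 0 < w xi by rewrite powR_gt0// ltr_wpDr// sqr_ge0.
have ReG xi : complex.Re (G xi) = w xi * complex.Re (fourier f xi).
  by rewrite /G; case: (fourier f xi) => a b /=; rewrite mul0r subr0.
have ImG xi : complex.Im (G xi) = w xi * complex.Im (fourier f xi).
  by rewrite /G; case: (fourier f xi) => a b /=; rewrite mul0r addr0.
pose gr xi := complex.Re (fourier f xi); pose gi xi := complex.Im (fourier f xi).
have mw (r : R) : measurable_fun setT (fun xi : R => (1 + xi ^+ 2) `^ r).
  apply: (measurableT_comp (measurable_powR r)).
  by apply: measurable_funD => //; exact: measurable_funX.
have div (u v : R -> R) : (forall xi, u xi = w xi * v xi) ->
    v = (fun xi => (1 + xi ^+ 2) `^ (- (s / 2)) * u xi).
  by move=> uv; apply/funext => xi; rewrite uv powRN mulKf// gt_eqF//; exact: w0.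
(* Measurability of the chosen [fourier f] is read off from the weighted transform, which
   [is_bessel] places in L^2, by dividing out the positive weight. *)
have mgr : measurable_fun setT gr.
  by rewrite (div _ gr ReG); exact: measurable_funM.
have mgi : measurable_fun setT gi.
  by rewrite (div _ gi ImG); exact: measurable_funM.
have ww xi : sobolev_weight s xi = w xi ^+ 2.
  by rewrite -(powR_mulrn 2 (ltW (w0 xi))) /w -powRrM; congr (_ `^ _); field.
have sq (u v : R -> R) : (forall xi, u xi = w xi * v xi) ->
    (fun xi => sobolev_weight s xi * v xi ^+ 2) = (fun xi => u xi ^+ 2).
  by move=> uv; apply/funext => xi; rewrite uv exprMn ww.
have igr : leb.-integrable setT (fun xi => (sobolev_weight s xi * gr xi ^+ 2)%:E).
  by have := iGr; congr (leb.-integrable _ _); apply/funext => xi; rewrite ReG exprMn ww.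
have igi : leb.-integrable setT (fun xi => (sobolev_weight s xi * gi xi ^+ 2)%:E).
  by have := iGi; congr (leb.-integrable _ _); apply/funext => xi; rewrite ImG exprMn ww.
have loc (u : R -> R) : measurable_fun setT u ->
    leb.-integrable setT (fun xi => (sobolev_weight s xi * u xi ^+ 2)%:E) -> loc_integrable u.
  move=> mu iu; have mu2 : measurable_fun setT (fun xi => u xi ^+ 2) by exact: measurable_funX.
  apply: loc_integrable_of_sqr => // b; apply: (@integrableS _ _ _ leb setT) => //.
  apply: (le_integrable measurableT _ _ iu); first exact/measurable_EFinP.
  move=> xi _ /=; rewrite lee_fin [leRHS]normrM ler_peMl//.
  rewrite (le_trans _ (ler_norm _))//; exact: (sobolev_weight_ge1 hs).
have lgr := loc _ mgr igr; have lgi := loc _ mgi igi.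
(* Each of the two majorants contributes an error [C * d], and together they stay below [eta]. *)
pose d := eta / (2 * (C + 1)).
have C1' : 0 < C + 1 by rewrite ltr_wpDl.
have d0 : 0 < d by rewrite divr_gt0// mulr_gt0.
have [Sr [mSr Sr0 ISr HSr]] := main gr d mgr igr d0.
have [Si [mSi Si0 ISi HSi]] := main gi d mgi igi d0.
exists (fun x => Sr x + Si x)%E; split.
- exact: emeasurable_funD.
- by move=> x; exact: adde_ge0.
- rewrite ge0_integralD//.
  apply: (le_trans (leeD ISr ISi)); rewrite (sq _ gr ReG) (sq _ gi ImG).
  have := is_fourier_energy_le hb; rewrite (energyE GL) => hE.
  apply: (@le_trans _ _ (C%:E * ((240 * pi)%:E * energy (bessel s f)) + eta%:E)%E); last first.
    by rewrite EFinM muleA.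
  apply: le_trans (leeD (lee_wpmul2l _ hE) (lexx eta%:E)); last by rewrite lee_fin.
  rewrite -EFinM -!EFinD lee_fin.
  have : C * d * 2 <= eta.
    have -> : C * d * 2 = eta * (C / (C + 1)) by rewrite /d; field; rewrite gt_eqF.
    by rewrite ler_piMr ?(ltW eta0)// ler_pdivrMr// mul1r lerDl.
  by rewrite !mulrDr; lra.
move=> x t x1 t1 Soo.
have Sroo : (Sr x < +oo)%E by apply: le_lt_trans Soo; rewrite leeDl.
have Sioo : (Si x < +oo)%E by apply: le_lt_trans Soo; rewrite leeDr.
have [cr br] := HSr x t x1 t1 Sroo _ (or_introl erefl).
have [cr' br'] := HSr x t x1 t1 Sroo _ (or_intror erefl).
have [ci bi] := HSi x t x1 t1 Sioo _ (or_introl erefl).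
have [ci' bi'] := HSi x t x1 t1 Sioo _ (or_intror erefl).
have RE : (fun N => complex.Re (schrodinger_trunc m t f (gamma x t) N)) =
   (fun N => (2 * pi)^-1 * (osc (@cos R) x t gr N - osc (@sin R) x t gi N)).
  by apply/funext => N; rewrite schrodinger_truncE.
have IM : (fun N => complex.Im (schrodinger_trunc m t f (gamma x t) N)) =
   (fun N => (2 * pi)^-1 * (osc (@cos R) x t gi N + osc (@sin R) x t gr N)).
  by apply/funext => N; rewrite schrodinger_truncE.
have cRE : cvgn (fun N => complex.Re (schrodinger_trunc m t f (gamma x t) N)).
  by rewrite RE; apply: is_cvgM (is_cvgB cr ci'); exact: is_cvg_cst.
have cIM : cvgn (fun N => complex.Im (schrodinger_trunc m t f (gamma x t) N)).
  by rewrite IM; apply: is_cvgM (is_cvgD ci cr'); exact: is_cvg_cst.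
split; first by split.
rewrite cabs_sqr /schrodinger /sqmod /=.
have csq : (fun N => complex.Re (schrodinger_trunc m t f (gamma x t) N) ^+ 2 +
    complex.Im (schrodinger_trunc m t f (gamma x t) N) ^+ 2) @ \oo -->
    limn (fun N => complex.Re (schrodinger_trunc m t f (gamma x t) N)) ^+ 2 +
    limn (fun N => complex.Im (schrodinger_trunc m t f (gamma x t) N)) ^+ 2.
  have cvsq (u : R^nat) : cvgn u -> (fun N => u N ^+ 2) @ \oo --> limn u ^+ 2.
    by move=> cu; rewrite expr2; under eq_fun do rewrite expr2; exact: cvgM.
  by apply: cvgD; exact: cvsq.
have fr : Sr x \is a fin_num by rewrite ge0_fin_numE.
have fi : Si x \is a fin_num by rewrite ge0_fin_numE.
rewrite -(cvg_lim _ csq)// -[Sr x]fineK// -[Si x]fineK// -EFinD lee_fin.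
apply: limr_le; first by apply/cvg_ex; eexists; exact: csq.
near=> N.
have -> : complex.Re (schrodinger_trunc m t f (gamma x t) N) =
    (2 * pi)^-1 * (osc (@cos R) x t gr N - osc (@sin R) x t gi N).
  exact: (congr1 (fun u => u N) RE).
have -> : complex.Im (schrodinger_trunc m t f (gamma x t) N) =
    (2 * pi)^-1 * (osc (@cos R) x t gi N + osc (@sin R) x t gr N).
  exact: (congr1 (fun u => u N) IM).
rewrite -!/(osc _ _ _ _ _).
set a := osc (@cos R) x t gr N; set b := osc (@sin R) x t gi N.
set a' := osc (@cos R) x t gi N; set b' := osc (@sin R) x t gr N.
have h1 : a ^+ 2 <= fine (Sr x) by rewrite -lee_fin fineK//; exact: br.
have h2 : b' ^+ 2 <= fine (Sr x) by rewrite -lee_fin fineK//; exact: br'.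
have h3 : a' ^+ 2 <= fine (Si x) by rewrite -lee_fin fineK//; exact: bi.
have h4 : b ^+ 2 <= fine (Si x) by rewrite -lee_fin fineK//; exact: bi'.
(* Expanding the two squares costs a factor 4 against [Sr x + Si x]; the prefactor, at most 1 / 16
   after squaring, absorbs it, and pi >= 2 is all this takes. *)
have p4 : (2 * pi)^-1 <= 4^-1 :> R.
  rewrite lef_pV2 ?posrE// ?mulr_gt0 ?pi_gt0//.
  by have := @pi_ge2 R; lra.
have p0 : 0 <= (2 * pi)^-1 :> R by rewrite invr_ge0 mulr_ge0// pi_ge0.
rewrite !exprMn -mulrDr.
have q2 : (2 * pi)^-1 ^+ 2 <= 4^-1 ^+ 2 :> R.
  by apply: lerXn2r => //; rewrite nnegrE invr_ge0.
have X0 : 0 <= (a - b) ^+ 2 + (a' + b') ^+ 2 by rewrite addr_ge0 ?sqr_ge0.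
apply: (le_trans (ler_wpM2r X0 q2)).
have := sqr_ge0 (a + b); have := sqr_ge0 (a' - b'); have := sqr_ge0 a; have := sqr_ge0 b.
have := sqr_ge0 a'; have := sqr_ge0 b'; lra.
Unshelve. all: by end_near.
Qed.

End schrodinger_maximal.

(** * From the majorants to the theorem *)

Theorem theorem2 (R : realType) (m kappa alpha s : R)
    (mu : {measure set (measurableTypeR R) -> \bar R}) (gamma : R -> R -> R)
    (hm : 1 < m) (hkappa : 0 < kappa <= 1) (halpha : 0 < alpha <= 1)
    (hmu : dimensional alpha mu) (hgamma : Gamma kappa gamma)
    (hs : Num.max (1 / 4)
            (Num.max ((1 - alpha) / 2) ((1 - m * alpha * kappa) / 2)) < s) :
  exists C : R, forall f : R -> R[i], inHs s f ->
    {ae mu, forall x, x \in `[-1, 1] -> forall t, t \in `[-1, 1] ->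
       schrodinger_defined m t f (gamma x t)} /\
    ((\int[mu]_(x in `[(-1)%R, 1%R]) ereal_sup
        [set (cabs (schrodinger m t f (gamma x t)) ^+ 2)%:E | t in `[(-1)%R, 1%R]])
       `^ (1 / 2)%R <= C%:E * Hsnorm s f)%E.
Proof.
have [_ _ [C1 [C2 [C10 C20 holder bilip]]]] := hgamma.
have [c hc] := hmu.
have itv1 (t : R) : (t \in `[-1, 1]) = (`|t| <= 1) by rewrite in_itv /= ler_norml.
have c0 : 0 <= c.
  have := le_trans (measure_ge0 mu _) (hc 0 1 ltr01).
  by rewrite powR1 mulr1 lee_fin.
have mI : measurable (`[-1, 1]%classic : set (measurableTypeR R)) by exact: measurable_segment.
have Ifin : (mu `[(-1)%R, 1%R]%classic < +oo)%E.
  apply: (@le_lt_trans _ _ (mu (ball (0 : R) 2))); last first.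
    by rewrite (le_lt_trans (hc 0 2 _))// ltry.
  apply: le_measure; rewrite ?inE//; first exact: measurable_ball.
  move=> x /=; rewrite itv1 /ball /= sub0r normrN => /le_lt_trans; apply.
  by rewrite ltr1n.
(* The estimates are for finite measures; the dimension condition makes [mu] finite on [-1, 1] and
   passes to the restriction. *)
pose nu : {finite_measure set (measurableTypeR R) -> \bar R} := mfrestr mI Ifin.
have nuE A : nu A = mu (A `&` `[(-1)%R, 1%R]%classic) by [].
have nu_ball (x r : R) : 0 < r -> (nu (ball x r) <= (c * r `^ alpha)%:E)%E.
  move=> r0; apply: le_trans (hc x r r0); rewrite nuE; apply: le_measure; rewrite ?inE.
  - by apply: measurableI => //; exact: measurable_ball.
  - exact: measurable_ball.
  - by move=> y [].
have holder' x t t' : `|t| <= 1 -> `|t'| <= 1 ->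
    `|gamma x t - gamma x t'| <= C1 * `|t - t'| `^ kappa.
  by rewrite -!itv1; exact: holder.
have bilip' t x x' : `|t| <= 1 ->
    C2^-1 * `|x - x'| <= `|gamma x t - gamma x' t| <= C2 * `|x - x'|.
  by rewrite -itv1; exact: bilip.
have /andP[alpha0 _] := halpha.
have [C C0 main] := schrodinger_maximal hm hkappa alpha0 c0 C10 C20 nu_ball
  holder' bilip' hs.
(* The maximal estimate concerns squares, so the constant gets a square root. *)
exists (C `^ (1 / 2)) => f hf.
have [h0 hb] : inHs s f by [].
have [hL _ _] : is_bessel s f (bessel s f) := xgetPex (fun=> 0) hb.
split.
  (* Any positive error serves here: the integral of [S] is finite, hence so is [S] almost
     everywhere. *)
  have [S [mS S0 IS HS]] := main f 1 hf ltr01.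
  have iS : nu.-integrable setT S.
    apply/integrableP; split => //; under eq_integral do rewrite gee0_abs//.
    apply: (le_lt_trans IS); rewrite lte_add_pinfty ?ltry//.
    by rewrite lte_mul_pinfty ?lee_fin// energy_lty.
  have [A [mA A0 hA]] := integrable_ae measurableT iS.
  (* A null set of [nu] is null for [mu] only within [-1, 1]; outside this segment the claim is
     void. *)
  exists (A `&` `[(-1)%R, 1%R]%classic); split; first exact: measurableI.
    exact: A0.
  move=> x /= nx; have xI : x \in `[-1, 1].
    by apply/negPn/negP => xI; apply: nx => xI'; rewrite xI' in xI.
  split => //; apply: hA => /= fx; apply: nx => _ t.
  rewrite itv1 => t1; have [] := HS x t _ t1 _ => //; first by rewrite -itv1.
  by have := fx I; rewrite ge0_fin_numE.
have sup0 x : (0 <= ereal_sup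
    [set (cabs (schrodinger m t f (gamma x t)) ^+ 2)%:E | t in `[(-1)%R, 1%R]])%E.
  apply: (@le_trans _ _ (cabs (schrodinger m 0 f (gamma x 0)) ^+ 2)%:E).
    by rewrite lee_fin sqr_ge0.
  by apply: ereal_sup_ubound; exists 0 => //=; rewrite itv1 normr0.
have key : (\int[mu]_(x in `[(-1)%R, 1%R]) ereal_sup
    [set (cabs (schrodinger m t f (gamma x t)) ^+ 2)%:E | t in `[(-1)%R, 1%R]] <=
    C%:E * energy (bessel s f))%E.
  (* The majorant depends on [eta], but the two sides of the estimate do not, so the error can be
     sent to 0. *)
  apply/lee_addgt0Pr => eta eta0.
  have [S [mS S0 IS HS]] := main f eta hf eta0.
  apply: le_trans IS; rewrite integral_mfrestr//.
  apply: ge0_le_integral_nonmeasurable => x xI; first exact: sup0.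
  apply: ge_ereal_sup => _ [t /= t1 <-].
  (* Where [S] is infinite the comparison is trivial, so the values of [limn] on divergent sequences
     do no harm. *)
  have [Soo|] := ltP (S x) +oo%E; last by rewrite leye_eq => /eqP ->; exact: leey.
  have [] := HS x t _ _ Soo => //; by rewrite -itv1.
rewrite /Hsnorm L2norm_energy -poweR_EFin -poweRM ?lee_fin ?energy_ge0//.
apply: gt0_ler_poweR => //; rewrite ?in_itv /= ?leey ?andbT//.
- by apply: integral_ge0 => x _; exact: sup0.
- by rewrite mule_ge0 ?lee_fin ?energy_ge0.
Qed.
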